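(* Let $N,N_1,N_2\in\{1,2,\ldots\}$ with $N_1+N_2=N$. Let $\mathbf{l}\in\mathcal{L}^N$ and $L\in\mathcal{L}$. Suppose $\mathbf{l}=(\mathbf{l}^{(1)},\mathbf{l}^{(2)})\in\mathcal{L}^{N_1}\times\mathcal{L}^{N_2}$. Then a spanning set of $\bar V^{\mathbf{l},L}$ is $$b^{\mathbf{l},L}_{(L_1,i_1,L_2,i_2,j)}=\Big[\sum_{k_1\in\mathcal{M}_{L_1},\,k_2\in\mathcal{M}_{L_2}}c^{(L_1,L_2),L}_{(k_1,k_2),k,j}\,[b^{\mathbf{l}^{(1)},L_1}_{i_1}]_{k_1}\,[b^{\mathbf{l}^{(2)},L_2}_{i_2}]_{k_2}\Big]_{k\in\mathcal{M}_L},$$ for $L_1,L_2\in\mathcal{L}$, $i_1\in\{1,\ldots,\dim(\bar V^{\mathbf{l}^{(1)},L_1})\}$, $i_2\in\{1,\ldots,\dim(\bar V^{\mathbf{l}^{(2)},L_2})\}$, $j\in\{1,\ldots,\dim(V^{(L_1,L_2),L})\}$, where $\{b^{\mathbf{l}^{(1)},L_1}_{i_1}\}_{i_1=1,\ldots,\dim(\bar V^{\mathbf{l}^{(1)},L_1})}$ and $\{b^{\mathbf{l}^{(2)},L_2}_{i_2}\}_{i_2=1,\ldots,\dim(\bar V^{\mathbf{l}^{(2)},L_2})}$ are bases of $\bar V^{\mathbf{l}^{(1)},L_1}$ and $\bar V^{\mathbf{l}^{(2)},L_2}$, respectively, and $\{c^{(L_1,L_2),L}_{(k_1,k_2),k,j}\}_{j=1,\ldots,\dim(V^{(L_1,L_2),L})}$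 is a basis of $\ker(M^{(L_1,L_2),L})$. Moreover, if $\mathbf{l}^{(1)}\cap\mathbf{l}^{(2)}=\varnothing$ (i.e. $\mathbf{l}^{(1)}_p\neq\mathbf{l}^{(2)}_q$ for all $p,q$), this family is a basis of $\bar V^{\mathbf{l},L}$ and $$\dim(\bar V^{\mathbf{l},L})=\sum_{L_1,L_2\in\mathcal{L}}\dim(V^{(L_1,L_2),L})\,\dim(\bar V^{\mathbf{l}^{(1)},L_1})\,\dim(\bar V^{\mathbf{l}^{(2)},L_2}).$$
   Context: Setting. $G$ is a compact connected linear Lie group with Lie algebra $\mathfrak{g}$; $X_1,\ldots,X_{N_{\rm dim}}$ is a set of generators of $\mathfrak{g}$. $\mathbb{F}$ is a vector space over a field $\mathbb{K}$ (typically $\mathbb{R}$ or $\mathbb{C}$). $G$ acts on a domain $\Omega$, and diagonally on $\Omega^n$ for every $n$. $\mathcal{L}$ is a (typically countable and totally ordered) index set; for $l\in\mathcal{L}$, $\mathcal{M}_l$ is a finite totally ordered set and $V^l=\mathrm{Span}\{\phi^l_m:m\in\mathcal{M}_l\}$, where the functions $\phi^l_m:\Omega\to\mathbb{F}$ are orthonormal for a given scalar product ($\langle\phi^l_m,\phi^{l'}_{m'}\rangle=\delta_{ll'}\delta_{mm'}$) and $V^l$ is stable under $G$, with continuous matrix representation $\rho^l$ of $G$: $\phi^l_m(g\cdot r)=\sum_{m'\in\mathcal{M}_l}\rho^l_{m,m'}(g)\phi^l_{m'}(r)$. The $\rho^l$, $l\in\mathcal{L}$, with corresponding spaces $V^l$,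 are assumed to be a complete set of mutually inequivalent irreducible representations of $G$. The products $\prod_i\phi^{l_i}_{m_i}(r_i)$ are orthonormal for the induced tensor-product scalar product. Permutation-invariant functions. $\bar\phi^l_m:\Omega^N\to\mathbb{F}$, $\bar\phi^l_m(r_1,\ldots,r_N)=\sum_{i=1}^N\phi^l_m(r_i)$. For a tuple $\mathbf{l}'=(l'_1,\ldots,l'_n)\in\mathcal{L}^n$, $n\in\{N_1,N_2,N\}$, and $\mathbf{m}\in\mathcal{M}_{\mathbf{l}'}=\prod_i\mathcal{M}_{l'_i}$, $\bar\phi^{\mathbf{l}'}_{\mathbf{m}}=\prod_{i=1}^n\bar\phi^{l'_i}_{m_i}$ (a function on $\Omega^N$) and $\bar V^{\mathbf{l}'}=\mathrm{Span}\{\bar\phi^{\mathbf{l}'}_{\mathbf{m}}:\mathbf{m}\in\mathcal{M}_{\mathbf{l}'}\}$. For $L\in\mathcal{L}$, $\bar V^{\mathbf{l}',L}$ is the space of (group-equivariant, permutation-invariant) functions $F\in[\bar V^{\mathbf{l}'}]^{|\mathcal{M}_L|}$ with $F(g\cdot R)=\rho^L(g)F(R)$ for all $g\in G$, $R\in\Omega^N$; $[F]_k$, $k\in\mathcal{M}_L$, is the $k$-th component of $F$. $V^{(L_1,L_2),L}$ is the space of functions $F\in[V^{L_1}\otimes V^{L_2}]^{|\mathcal{M}_L|}$ of two variables with $F(g\cdot R)=\rho^L(g)F(R)$ for all $g\in G$, $R\in\Omega^2$ (no permutation invariance). Matrix $M^{(L_1,L_2),L}$: with $\varrho^{l,d}=\frac{d}{dt}|_{t=0}\rho^l(\exp(tX_d))$,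 it is the vertical stacking over $d=1,\ldots,N_{\rm dim}$ of the matrices $M_d$ with rows and columns indexed by $((k_1,k_2),k)\in(\mathcal{M}_{L_1}\times\mathcal{M}_{L_2})\times\mathcal{M}_L$ and entries $$M_d[((k_1,k_2),k),((k_1',k_2'),k')]=\varrho^{L_1,d}_{k_1',k_1}\delta_{k_2k_2'}\delta_{kk'}+\delta_{k_1k_1'}\varrho^{L_2,d}_{k_2',k_2}\delta_{kk'}-\delta_{k_1k_1'}\delta_{k_2k_2'}\varrho^{L,d}_{k,k'}.$$ Its kernel has dimension $\dim(V^{(L_1,L_2),L})$.
   Formalization: The basis and dimension claims additionally assume every ρ^l is irreducible over ℂ: automatic for 𝕂=ℂ, but needed for 𝕂=ℝ (real SO(2), N₁=N₂=1, L=l₁+l₂ gives 8 versus 2). The spanning claim is unrestricted. *)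

(* Defs.v *)
From HB Require Import structures.
From mathcomp Require Export all_boot all_order all_algebra.
From mathcomp.real_closed Require Export complex.
From mathcomp Require Export all_classical all_reals all_analysis.

Set Implicit Arguments.
Unset Strict Implicit.
Unset Printing Implicit Defensive.

Export Order.TTheory GRing.Theory Num.Theory.
Export numFieldNormedType.Exports.

Local Open Scope classical_set_scope.
Local Open Scope ring_scope.

Section LinearAlgebra.
Variables (K : pzRingType) (V : lmodType K).

Definition subspace (W : set V) : Prop :=
  W 0 /\ forall (a : K) (u v : V), W u -> W v -> W (a *: u + v).

Definition lspan (S : set V) : set V :=
  [set v | exists n (a : 'I_n -> K) (u : 'I_n -> V),
     (forall i, S (u i)) /\ v = \sum_i a i *: u i].

Definition lin_indep (T : Type) (b : T -> V) : Prop :=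
  forall n (t : 'I_n -> T), injective t ->
  forall a : 'I_n -> K, \sum_i a i *: b (t i) = 0 -> forall i, a i = 0.

Definition is_basis (T : Type) (W : set V) (b : T -> V) : Prop :=
  lin_indep b /\ lspan (range b) = W.

(* The value is 0 by default when W has no finite basis. *)
Definition dimension (W : set V) : nat :=
  xget 0%N [set n | exists b : 'I_n -> V, is_basis W b].

End LinearAlgebra.

Variant scalar_kind := RealScalars | ComplexScalars.

Definition scalars (R : realType) (s : scalar_kind) : numFieldType :=
  match s with
  | RealScalars => R
  | ComplexScalars => R[i]
  end.

Definition of_real (R : realType) (s : scalar_kind) : R -> scalars R s :=
  match s with
  | RealScalars => fun x => x
  | ComplexScalars => fun x => x%:C%C
  end.

Definition to_complex (R : realType) (s : scalar_kind) :
    scalars R s -> scalars R ComplexScalars :=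
  match s with
  | RealScalars => fun x => x%:C%C
  | ComplexScalars => fun z => z
  end.

Definition scalar_conj (R : realType) (s : scalar_kind) :
    scalars R s -> scalars R s :=
  match s with
  | RealScalars => fun x => x
  | ComplexScalars => fun z => (z^*)%C
  end.

Arguments of_real {R} s.
Arguments to_complex {R s}.
Arguments scalar_conj {R s}.

(* Derivative at 0 of a scalar-valued function of a real variable; R[i] carries
   no structure of normed module over R, hence the difference quotient. *)
Definition deriv0 (R : realType) (s : scalar_kind) (f : R -> scalars R s) :
    scalars R s :=
  lim ((fun t : R => (of_real s t)^-1 * (f t - f 0)) @ 0^').

(* A scalar product given on the subspace H; the values of dot outside H are
   irrelevant. *)
Record scalar_product (R : realType) (s : scalar_kind)
    (V : lmodType (scalars R s)) (H : set V) (dot : V -> V -> scalars R s) :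
    Prop := ScalarProduct {
  sp_subspace : subspace H;
  sp_linear : forall a u v w, H u -> H v -> H w ->
    dot (a *: u + v) w = a * dot u w + dot v w;
  sp_conj : forall u v, H u -> H v -> dot u v = scalar_conj (dot v u);
  sp_pos : forall u, H u -> u != 0 -> 0 < dot u u
}.

Section LieGroups.
Variables (R : realType) (q : nat).
Implicit Types (G : set 'M[R]_q) (X Y : 'M[R]_q).

Record compact_connected_linear_lie_group G : Prop := LinearLieGroup {
  ll_unit : forall g, G g -> g \in unitmx;
  ll_1 : G 1%:M;
  ll_mul : forall g h, G g -> G h -> G (g *m h);
  ll_inv : forall g, G g -> G (invmx g);
  ll_compact : compact G;
  ll_connected : connected G
}.

Definition expmx X : 'M[R]_q :=
  lim (series (fun n : nat => (n`!%:R)^-1 *: X ^+ n) @ \oo).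

Definition lie_algebra G : set 'M[R]_q :=
  [set X | forall t : R, G (expmx (t *: X))].

Definition lie_subalgebra (h : set 'M[R]_q) : Prop :=
  subspace h /\ forall X Y, h X -> h Y -> h (X *m Y - Y *m X).

(* The X_d generate the Lie algebra of G as a Lie algebra; in particular this
   holds when they span it, or form a basis of it, as a vector space. *)
Definition lie_generators G (D : nat) (X : 'I_D -> 'M[R]_q) : Prop :=
  (forall d, lie_algebra G (X d)) /\
  (forall h, lie_subalgebra h -> (forall d, h (X d)) -> lie_algebra G `<=` h).

Definition group_action G (Om : Type) (act : 'M[R]_q -> Om -> Om) : Prop :=
  (forall r, act 1%:M r = r) /\
  (forall g h r, G g -> G h -> act (g *m h) r = act g (act h r)).

Definition diag_act (Om : Type) (act : 'M[R]_q -> Om -> Om) (n : nat)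
    (g : 'M[R]_q) (r : 'I_n -> Om) : 'I_n -> Om := fun i => act g (r i).

Section Representations.
Variable s : scalar_kind.
Local Notation K := (scalars R s).

Record continuous_repr G (n : nat) (rho : 'M[R]_q -> 'M[K]_n) : Prop :=
  ContinuousRepr {
  cr_1 : rho 1%:M = 1%:M;
  cr_mul : forall g h, G g -> G h -> rho (g *m h) = rho g *m rho h;
  cr_continuous : {within G, continuous rho}
}.

(* A subspace of K^n (column vectors) is given by the row space of a matrix U
   after transposition, hence the (rho g)^T. *)
Definition irreducible_repr G (n : nat) (rho : 'M[R]_q -> 'M[K]_n) : Prop :=
  (0 < n)%N /\
  forall U : 'M[K]_n, (forall g, G g -> stablemx U (rho g)^T) ->
  U = 0 \/ row_full U.

Definition equivalent_repr G (n m : nat) (rho : 'M[R]_q -> 'M[K]_n)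
    (sigma : 'M[R]_q -> 'M[K]_m) : Prop :=
  exists (P : 'M[K]_(n, m)) (Q : 'M[K]_(m, n)),
    [/\ P *m Q = 1%:M, Q *m P = 1%:M &
        forall g, G g -> rho g *m P = P *m sigma g].

Record complete_irreducible_reprs G (LL : Type) (dl : LL -> nat)
    (rho : forall l, 'M[R]_q -> 'M[K]_(dl l)) : Prop :=
  CompleteIrreducibleReprs {
  ci_repr : forall l, continuous_repr G (rho l);
  ci_irr : forall l, irreducible_repr G (rho l);
  ci_inequiv : forall l l', l <> l' -> ~ equivalent_repr G (rho l) (rho l');
  ci_complete : forall n (sigma : 'M[R]_q -> 'M[K]_n),
    continuous_repr G sigma -> irreducible_repr G sigma ->
    exists l, equivalent_repr G sigma (rho l)
}.


Definition drepr (n : nat) (rho : 'M[R]_q -> 'M[K]_n) (X : 'M[R]_q) : 'M[K]_n :=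
  \matrix_(i, j) deriv0 (fun t : R => rho (expmx (t *: X)) i j).

End Representations.

(* Irreducibility over the complex numbers; for complex scalars this is
   irreducible_repr itself. *)
Definition absolutely_irreducible_repr (s : scalar_kind) G (n : nat)
    (rho : 'M[R]_q -> 'M[scalars R s]_n) : Prop :=
  irreducible_repr (s := ComplexScalars) G
    (fun g => map_mx (@to_complex R s) (rho g)).

End LieGroups.

Section FunctionSpaces.
Variables (R : realType) (s : scalar_kind) (q : nat).
Local Notation K := (scalars R s).
Variables (G : set 'M[R]_q) (Om : Type) (act : 'M[R]_q -> Om -> Om).
(* The vector space A of values of the functions is a commutative algebra (for
   instance K itself), since products of values are formed. *)
Variables (A : comAlgType K) (LL : Type) (dl : LL -> nat).
(* 'I_(dl l) is the finite totally ordered index set of the basis phi l of the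
   space V^l. *)
Variable phi : forall l, 'I_(dl l) -> Om -> A.
Variable rho : forall l, 'M[R]_q -> 'M[K]_(dl l).

Definition tensor (n : nat) (f : 'I_n -> Om -> A) : ('I_n -> Om) -> A :=
  fun r => \prod_i f i (r i).

(* dotn n is the scalar product induced by dot on a space Hn n of functions of
   n variables containing the products of n elements of H. *)
Definition induced_scalar_products (H : set (Om -> A))
    (dot : (Om -> A) -> (Om -> A) -> K)
    (Hn : forall n, set (('I_n -> Om) -> A))
    (dotn : forall n, (('I_n -> Om) -> A) -> (('I_n -> Om) -> A) -> K) : Prop :=
  forall n, scalar_product (Hn n) (dotn n) /\
    forall f : 'I_n -> Om -> A, (forall i, H (f i)) ->
      Hn n (tensor f) /\
      forall g : 'I_n -> Om -> A, (forall i, H (g i)) ->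
        dotn n (tensor f) (tensor g) = \prod_i dot (f i) (g i).

Definition orthonormal_functions (dot : (Om -> A) -> (Om -> A) -> K) : Prop :=
  (forall l (m m' : 'I_(dl l)), dot (phi m) (phi m') = (m == m')%:R) /\
  (forall l l' (m : 'I_(dl l)) (m' : 'I_(dl l')), l <> l' ->
     dot (phi m) (phi m') = 0).

Definition transforms_by : Prop :=
  forall l (m : 'I_(dl l)) g r, G g ->
    phi m (act g r) = \sum_(m' < dl l) rho l g m m' *: phi m' r.

Definition Vspace (l : LL) : set (Om -> A) :=
  lspan (range (fun m : 'I_(dl l) => phi m)).

Definition equivariant (n : nat) (L : LL)
    (F : 'I_(dl L) -> ('I_n -> Om) -> A) : Prop :=
  forall g, G g -> forall (r : 'I_n -> Om) (k : 'I_(dl L)),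
    F k (diag_act act g r) = \sum_(k' < dl L) rho L g k k' *: F k' r.

Definition phibar (N : nat) (l : LL) (m : 'I_(dl l)) : ('I_N -> Om) -> A :=
  fun r => \sum_(i < N) phi m (r i).

Definition phibar_prod (N n : nat) (l : n.-tuple LL)
    (m : forall i, 'I_(dl (tnth l i))) : ('I_N -> Om) -> A :=
  fun r => \prod_(i < n) phibar (m i) r.

Definition Vbar (N n : nat) (l : n.-tuple LL) : set (('I_N -> Om) -> A) :=
  lspan (range (phibar_prod (N := N) (l := l))).

Definition Vbar_equiv (N n : nat) (l : n.-tuple LL) (L : LL) :
    set ('I_(dl L) -> ('I_N -> Om) -> A) :=
  [set F | (forall k, Vbar (N := N) l (F k)) /\ equivariant F].

Definition Vtensor2 (L1 L2 : LL) : set (('I_2 -> Om) -> A) :=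
  lspan [set F | exists f1 f2, [/\ Vspace L1 f1, Vspace L2 f2 &
    F = (fun r => f1 (r ord0) * f2 (r ord_max))]].

Definition V2_equiv (L1 L2 L : LL) : set ('I_(dl L) -> ('I_2 -> Om) -> A) :=
  [set F | (forall k, Vtensor2 L1 L2 (F k)) /\ equivariant F].

(* Index ((k1, k2), k) of the coupling coefficients. *)
Definition cidx (L1 L2 L : LL) : finType :=
  (('I_(dl L1) * 'I_(dl L2)) * 'I_(dl L))%type.

Definition Mcoupling (D : nat) (X : 'I_D -> 'M[R]_q) (L1 L2 L : LL)
    (row : 'I_D * cidx L1 L2 L) (col : cidx L1 L2 L) : K :=
  let: (d, ((k1, k2), k)) := row in
  let: ((k1', k2'), k') := col in
  drepr (rho L1) (X d) k1' k1 * (k2 == k2')%:R * (k == k')%:R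
  + (k1 == k1')%:R * drepr (rho L2) (X d) k2' k2 * (k == k')%:R
  - (k1 == k1')%:R * (k2 == k2')%:R * drepr (rho L) (X d) k k'.

Definition ker_Mcoupling (D : nat) (X : 'I_D -> 'M[R]_q) (L1 L2 L : LL) :
    set (cidx L1 L2 L -> K^o) :=
  [set c | forall row, \sum_col Mcoupling X row col * c col = 0].

End FunctionSpaces.

Arguments phibar {R s Om A LL dl} phi N {l} m r.
Arguments phibar_prod {R s Om A LL dl} phi N {n} l m r.
Arguments Vbar {R s Om A LL dl} phi N {n} l.
Arguments Vbar_equiv {R s q} G {Om} act {A LL dl} phi rho N {n} l L.
Arguments Vtensor2 {R s Om A LL dl} phi L1 L2.
Arguments V2_equiv {R s q} G {Om} act {A LL dl} phi rho L1 L2 L.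
Arguments ker_Mcoupling {R s q LL dl} rho {D} X L1 L2 L.

Section Coupling.
Variables (R : realType) (s : scalar_kind) (q : nat).
Local Notation K := (scalars R s).
Variables (Om : Type) (A : comAlgType K) (LL : Type) (dl : LL -> nat).
Variables (N : nat) (L : LL) (n1 n2 : LL -> nat) (n12 : LL -> LL -> nat).

(* Index (L1, i1, L2, i2, j). *)
Definition bidx : Type :=
  {p : LL * LL & ('I_(n1 p.1) * 'I_(n2 p.2) * 'I_(n12 p.1 p.2))%type}.

Definition coupled
    (b1 : forall L1, 'I_(n1 L1) -> 'I_(dl L1) -> ('I_N -> Om) -> A)
    (b2 : forall L2, 'I_(n2 L2) -> 'I_(dl L2) -> ('I_N -> Om) -> A)
    (c : forall L1 L2, 'I_(n12 L1 L2) -> cidx dl L1 L2 L -> K^o)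
    (t : bidx) : 'I_(dl L) -> ('I_N -> Om) -> A :=
  let: existT (L1, L2) (i1, i2, j) := t in
  fun k r => \sum_(k1 < dl L1) \sum_(k2 < dl L2)
    c L1 L2 j (k1, k2, k) *: (b1 L1 i1 k1 r * b2 L2 i2 k2 r).

End Coupling.

(* Main.v *)
(* Compactness of G gives fixed points in affine families of matrices stable under
   Q |-> sigma(g) Q tau(g)^-1, by minimising the sup over G of the norm. Hence every
   continuous representation is a sum of rho^l's, and an equivariant tuple in the
   span of a family that transforms under G has an equivariant array of
   coefficients. Since G is connected, an array intertwines two representations as
   soon as it intertwines their derivatives along the generators, so ker M consists
   of the equivariant coupling arrays. Decomposing both factors of
   Vbar^l = Vbar^l1 Vbar^l2 into blocks that transform by the rho^L then shows that
   the coupled functions span.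
   For independence, Schur's lemma makes all components of all basis tuples of
   Vbar^l1 independent (likewise for l2), and it remains to see that multiplication
   is injective on Vbar^l1 (x) Vbar^l2 when l1 and l2 are disjoint. A relation is a
   homogeneous polynomial P of degree N in the values phi^l_m, vanishing on every
   sum over N points. Homogeneity and vanishing of iterated differences extend this
   to sums over any number of points, and polarisation turns it into a relation
   between symmetrised tensors, which orthonormality makes trivial. *)
Require Import Defs.
From mathcomp Require Import fingroup perm lra ring.
From mathcomp.real_closed Require Import mxtens.
Set Implicit Arguments.
Unset Strict Implicit.
Unset Printing Implicit Defensive.
Local Open Scope classical_set_scope.
Local Open Scope ring_scope.

(** * Matrix norm and exponential *)

(** The second half assumes absolute irreducibility because independence needs every
    self-intertwiner of rho^l to be scalar: over the reals the commutant may be C or H, and a tuple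
    F and its image T F under a non-scalar T of the commutant have dependent components.
    Representations are only assumed continuous and [lie_algebra] is defined by one-parameter
    subgroups, so differentiability along X_d must be established: t |-> rho(exp(tX)) is a
    continuous one-parameter group, hence an exponential. Monomials may be linearly dependent: if l
    has repeated entries, permuted words give the same function. So coefficient arrays are averaged
    rather than read off, and a relation between monomials determines only the sums of coefficients
    over classes of permuted words. Disjointness of l1 and l2 enters exactly there: the class of a
    concatenated word is then a pair of classes, so that class sums of products are products of
    class sums. Values lie in an arbitrary commutative algebra A, possibly with zero divisors, which
    is why polynomial arguments go through finite differences. *)

Lemma mx_cvgP (K : numFieldType) (T : Type) (F : set_system T) {FF : Filter F}
    (m n : nat) (f : T -> 'M[K]_(m, n)) (A : 'M[K]_(m, n)) :
  f @ F --> A <-> forall i j, (fun x => f x i j) @ F --> A i j.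
Proof.
split=> [fA i j|fA].
  exact: (@cvg_comp _ _ _ f (fun M : 'M[K]_(m, n) => M i j) _ _ _ fA
           (@coord_continuous K m n i j A)).
apply/cvg_ballP => e e0.
have : \forall x \near F, forall i j, ball (A i j) e (f x i j).
  apply: filter_forall => i; apply: filter_forall => j.
  by have /cvg_ballP/(_ _ e0) := fA i j.
by apply: filterS => x Hx; split.
Qed.

Section MatrixNorm.
Variable R : realType.

Lemma mx_entry_le m n (A : 'M[R]_(m, n)) i j : `|A i j| <= `|A|.
Proof.
rewrite [leRHS]/Num.norm /= mx_normrE.
exact: (le_bigmax _ (fun ij : 'I_m * 'I_n => `|A ij.1 ij.2|) (i, j)).
Qed.

Lemma mx_norm_le m n (A : 'M[R]_(m, n)) c :
  0 <= c -> (forall i j, `|A i j| <= c) -> `|A| <= c.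
Proof.
move=> c0 Ac; rewrite [leLHS]/Num.norm /= mx_normrE.
by apply/bigmax_leP; split=> // -[i j] _; apply: Ac.
Qed.

Lemma mx_normM m n p (A : 'M[R]_(m, n)) (B : 'M[R]_(n, p)) :
  `|A *m B| <= n%:R * `|A| * `|B|.
Proof.
apply: mx_norm_le => [|i j]; first by rewrite !mulr_ge0.
rewrite mxE; apply: le_trans (ler_norm_sum _ _ _) _.
rewrite -mulrA mulr_natl -[X in _ *+ X](card_ord n) -sumr_const.
by apply: ler_sum => k _; rewrite normrM ler_pM ?mx_entry_le.
Qed.

(* The factor q makes the sup norm on entries submultiplicative. *)
Definition nu q (A : 'M[R]_q) : R := q%:R * `|A|.

Lemma nu_ge0 q (A : 'M[R]_q) : 0 <= nu A.
Proof. by rewrite mulr_ge0. Qed.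

Lemma nuM q (A B : 'M[R]_q) : nu (A *m B) <= nu A * nu B.
Proof.
by rewrite /nu -mulrA ler_wpM2l // mulrCA mulrA mx_normM.
Qed.

Lemma nuD q (A B : 'M[R]_q) : nu (A + B) <= nu A + nu B.
Proof. by rewrite /nu -mulrDr ler_wpM2l // ler_normD. Qed.

Lemma nuZ q a (A : 'M[R]_q) : nu (a *: A) = `|a| * nu A.
Proof. by rewrite /nu normrZ mulrCA. Qed.

Lemma norm_le_nu q (A : 'M[R]_q) : `|A| <= nu A.
Proof.
case: q A => [|q] A; last by rewrite /nu ler_peMl // ler1n.
by rewrite (flatmx0 A) normr0 nu_ge0.
Qed.

Lemma nu_sum q (I : Type) (r : seq I) (P : pred I) (A : I -> 'M[R]_q) :
  nu (\sum_(i <- r | P i) A i) <= \sum_(i <- r | P i) nu (A i).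
Proof.
elim/big_ind2: _ => [|x a y b xa yb|//]; first by rewrite /nu normr0 mulr0.
exact: le_trans (nuD _ _) (lerD xa yb).
Qed.

(** [nu 1] is q rather than 1, whence the extra factor; it reappears in the bounds on exponentials
    below. *)
Lemma nuX q (A : 'M[R]_q) n : nu (A ^+ n) <= nu (1 : 'M[R]_q) * nu A ^+ n.
Proof.
elim: n => [|n IHn]; first by rewrite !expr0 mulr1.
by rewrite !exprSr mulrA (le_trans (nuM _ _)) // ler_wpM2r ?nu_ge0.
Qed.

End MatrixNorm.

(** The square i, j < m splits into the triangle i + j < m, where the binomial formula applies, and
    a remainder. With [a i] standing for 1/i! in both rings, the lemma serves once for matrices and
    once for reals, and the two remainders are compared term by term. *)
Lemma truncated_exp_mul (B : pzRingType) (a : nat -> B) (x y : B) (m : nat) :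
  (forall k z, GRing.comm (a k) z) ->
  (forall i j, a (i + j)%N *+ 'C(i + j, i) = a i * a j) ->
  GRing.comm x y ->
  (\sum_(i < m) a i * x ^+ i) * (\sum_(j < m) a j * y ^+ j) =
  \sum_(k < m) a k * (x + y) ^+ k +
  \sum_(i < m) \sum_(j < m | (m <= i + j)%N) a i * a j * (x ^+ i * y ^+ j).
Proof.
move=> ca abin cxy.
have -> : \sum_(k < m) a k * (x + y) ^+ k =
   \sum_(i < m) \sum_(j < m | (i + j < m)%N) a i * a j * (x ^+ i * y ^+ j).
  transitivity (\sum_(k < m) \sum_(j < m | (j <= k)%N)
      a j * a (k - j)%N * (x ^+ j * y ^+ (k - j))).
    apply: eq_bigr => k _; rewrite addrC (exprDn_comm _ (commr_sym cxy)) mulr_sumr.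
    under eq_bigr => j _.
      rewrite mulrnAr -mulrnAl.
      have jk : (j <= k)%N by rewrite -ltnS.
      rewrite -{1 2}(subnKC jk) abin (commrX _ (commr_sym (commrX _ cxy))).
      over.
    have km : (k.+1 <= m)%N by [].
    by rewrite (big_ord_widen m (fun j => a j * a (k - j)%N * (x ^+ j * y ^+ (k - j))) km).
  rewrite (exchange_big_dep xpredT) //=; apply: eq_bigr => i _.
  rewrite -[RHS](big_mkord (fun j => (i + j < m)%N) (fun j => a i * a j * (x ^+ i * y ^+ j))).
  rewrite -(big_mkord (fun j => (i <= j)%N) (fun j => a i * a (j-i)%N * (x ^+ i * y ^+ (j - i)%N))).
  rewrite (big_cat_nat (leq0n i) (ltnW (ltn_ord i))) /=.
  rewrite [RHS](big_cat_nat (leq0n (m - i)) (leq_subr i m)) /=.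
  rewrite big_nat_cond big1 ?add0r; last first.
    by move=> j /andP[/andP[_ ji] ij]; rewrite ltnNge ij in ji.
  rewrite [X in _ = _ + X]big_nat_cond [X in _ = _ + X]big1 ?addr0; last first.
    by move=> j /andP[/andP[mij _]]; rewrite leq_subLR ltnNge in mij *; rewrite mij.
  rewrite -{1}[i : nat]add0n big_addn [LHS]big_nat_cond [RHS]big_nat_cond.
  apply: eq_big => [j|j _]; last by rewrite addnK.
  by rewrite leq_addl ltn_subRL /=; case: ltnP.
rewrite mulr_suml -big_split /=; apply: eq_bigr => i _.
rewrite mulr_sumr [LHS](bigID (fun j : 'I_m => (i + j < m)%N)) /=.
congr (_ + _); [|under [RHS]eq_bigl do rewrite leqNgt];
 by apply: eq_bigr => j _; rewrite -!mulrA; congr (_ * _); rewrite !mulrA (ca j).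
Qed.

Lemma cvg_sum_fin (K : numFieldType) (V : normedModType K) (T : Type) (F : set_system T)
    {FF : Filter F} (I : Type) (r : seq I) (P : pred I) (f : I -> T -> V) (a : I -> V) :
  (forall i, P i -> f i @ F --> a i) ->
  (fun x => \sum_(i <- r | P i) f i x) @ F --> \sum_(i <- r | P i) a i.
Proof. by move=> fa; apply: cvg_big => //; apply: add_continuous. Qed.

Lemma cvg_mulmx (K : numFieldType) (T : Type) (F : set_system T) {FF : Filter F}
    m n p (f : T -> 'M[K]_(m, n)) (g : T -> 'M[K]_(n, p)) (A : 'M[K]_(m, n)) (B : 'M[K]_(n, p)) :
  f @ F --> A -> g @ F --> B -> (fun x => f x *m g x) @ F --> A *m B.
Proof.
move=> /mx_cvgP fA /mx_cvgP gB; apply/mx_cvgP => i j.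
under eq_fun do rewrite mxE; rewrite mxE.
by apply: cvg_sum_fin => k _; apply: cvgM.
Qed.

Section MatrixExp.
Variable R : realType.

Definition exp_sum q (X : 'M[R]_q) : nat -> 'M[R]_q :=
  series (fun n : nat => (n`!%:R)^-1 *: X ^+ n).

Lemma invfact_bin (i j : nat) :
  ((i + j)`!%:R^-1 : R) *+ 'C(i + j, i) = i`!%:R^-1 * j`!%:R^-1.
Proof.
have fN0 k : (k`!%:R : R) != 0 by rewrite pnatr_eq0 -lt0n fact_gt0.
have := bin_fact (leq_addr j i); rewrite addKn => /(congr1 (fun n => n%:R : R)).
rewrite !natrM => H.
rewrite -[LHS]mulr_natr -invfM -H [in LHS]invfM mulrC mulrA divff ?mul1r //.
by rewrite pnatr_eq0 -lt0n bin_gt0 leq_addr.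
Qed.

Lemma exp_sumE q (X : 'M[R]_q) n :
  exp_sum X n = \sum_(i < n) (i`!%:R^-1)%:M * X ^+ i.
Proof.
by rewrite /exp_sum /series /= big_mkord; apply: eq_bigr => i _; rewrite -mulmxE mul_scalar_mx.
Qed.

(** After [truncated_exp_mul] both sides are remainders over i + j >= n. Each matrix term is bounded
    by the real one at the cost of a factor [nu 1] for each of the two powers, hence the square. *)
Lemma exp_sum_dominated q (X Y : 'M[R]_q) n : X *m Y = Y *m X ->
  nu (exp_sum X n *m exp_sum Y n - exp_sum (X + Y) n) <=
  nu (1 : 'M[R]_q) ^+ 2 * (series (exp_coeff (nu X)) n * series (exp_coeff (nu Y)) n
     - series (exp_coeff (nu X + nu Y)) n).
Proof.
move=> cXY; rewrite !exp_sumE mulmxE.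
rewrite (@truncated_exp_mul _ (fun i => (i`!%:R^-1)%:M) X Y n) //; last first.
- move=> i j; rewrite -mulmxE -scalar_mxM -raddfMn; congr (_%:M).
  exact: invfact_bin.
- by move=> k z; rewrite /GRing.comm -mulmxE scalar_mxC.
rewrite addrC addKr.
have serE x : series (exp_coeff x) n = \sum_(i < n) i`!%:R^-1 * x ^+ i :> R.
  by rewrite /series /= big_mkord; apply: eq_bigr => i _; rewrite /exp_coeff /= mulrC.
rewrite !serE (@truncated_exp_mul R (fun i => i`!%:R^-1)); last first.
- by rewrite /GRing.comm mulrC.
- exact: invfact_bin.
- by move=> k z; rewrite /GRing.comm mulrC.
rewrite addrAC subrr add0r mulr_sumr; apply: le_trans (nu_sum _ _ _) _.
apply: ler_sum => i _; rewrite mulr_sumr; apply: le_trans (nu_sum _ _ _) _.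
apply: ler_sum => j _; rewrite -!mulmxE -scalar_mxM mul_scalar_mx nuZ.
rewrite ger0_norm ?mulr_ge0 ?invr_ge0 // [leRHS]mulrCA ler_wpM2l ?mulr_ge0 ?invr_ge0 //.
apply: le_trans (nuM _ _) _; rewrite expr2 [leRHS]mulrACA.
by apply: ler_pM; rewrite ?nu_ge0 ?nuX.
Qed.

Lemma exp_sum_cvg q (X : 'M[R]_q) : exp_sum X @ \oo --> expmx X.
Proof.
suff : cvgn (exp_sum X) by [].
have ce i j : cvgn (fun n => exp_sum X n i j).
  have -> : (fun n => exp_sum X n i j) =
      series (fun n : nat => ((n`!%:R)^-1 *: X ^+ n) i j).
    by apply/funext => n; rewrite /exp_sum /series /= summxE.
  apply: normed_cvg.
  apply: (@series_le_cvg _ _ (fun n => nu (1 : 'M[R]_q) * exp_coeff (nu X) n)).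
  - by move=> n /=.
  - by move=> n; rewrite mulr_ge0 ?nu_ge0 // exp_coeff_ge0 // nu_ge0.
  - move=> n /=; apply: le_trans (mx_entry_le _ _ _) _.
    apply: le_trans (norm_le_nu _) _; rewrite nuZ ger0_norm ?invr_ge0 //.
    rewrite /exp_coeff /= mulrA [leRHS]mulrC ler_wpM2l ?invr_ge0 //.
    exact: nuX.
  have -> : (fun n => nu (1 : 'M[R]_q) * exp_coeff (nu X) n) =
     (nu (1 : 'M[R]_q) *: (exp_coeff (nu X) : nat -> R^o)) by [].
  exact: is_cvg_seriesZ (is_cvg_series_exp_coeff _).
apply/cvg_ex; exists (\matrix_(i, j) limn (fun n => exp_sum X n i j)).
by apply/mx_cvgP => i j; rewrite mxE; apply: ce.
Qed.

(** The defect of multiplicativity of the partial sums is dominated by the corresponding real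
    defect, which tends to 0 because [expR] is already multiplicative. *)
Lemma expmxD q (X Y : 'M[R]_q) : X *m Y = Y *m X ->
  expmx (X + Y) = expmx X *m expmx Y.
Proof.
move=> cXY; apply/eqP; rewrite eq_sym -subr_eq0; apply/eqP.
have h1 : (fun n => exp_sum X n *m exp_sum Y n - exp_sum (X + Y) n) @ \oo -->
    expmx X *m expmx Y - expmx (X + Y).
  by apply: cvgB; [apply: cvg_mulmx|]; apply: exp_sum_cvg.
apply: (cvg_unique _ h1); first exact: norm_hausdorff.
apply/norm_cvg0P.
pose g n : R := nu (1 : 'M[R]_q) ^+ 2 * (series (exp_coeff (nu X)) n * series (exp_coeff (nu Y)) n
     - series (exp_coeff (nu X + nu Y)) n).
have sc (x : R) : series (exp_coeff x) @ \oo --> expR x by exact: is_cvg_series_exp_coeff.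
apply: (@squeeze_cvgr _ _ _ _ (cst 0) g).
- near=> n; rewrite normr_ge0 /=; apply: le_trans (norm_le_nu _) _.
  exact: exp_sum_dominated.
- exact: cvg_cst.
- have -> : 0 = nu (1 : 'M[R]_q) ^+ 2 * (expR (nu X) * expR (nu Y) - expR (nu X + nu Y)).
    by rewrite expRD subrr mulr0.
  by apply: cvgMr; apply: cvgB => //; apply: cvgM.
Unshelve. all: by end_near.
Qed.

Lemma series_exp_coeff_le (x : R) n : 0 <= x -> series (exp_coeff x) n <= expR x.
Proof.
move=> x0; apply: nondecreasing_cvgn_le; last exact: is_cvg_series_exp_coeff.
apply/nondecreasing_seqP => k; rewrite /series /= big_nat_recr //= lerDl.
exact: exp_coeff_ge0.
Qed.

Lemma cvg_norm_le m n (T : Type) (F : set_system T) {FF : ProperFilter F}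
  (f : T -> 'M[R]_(m, n)) (A : 'M[R]_(m, n)) (c : R) :
  f @ F --> A -> (\forall x \near F, `|f x| <= c) -> `|A| <= c.
Proof.
move=> fA fc; rewrite leNgt; apply/negP => cA.
have h : \forall x \near F, c < `|f x| by exact: (cvgr_gt (`|A|) (cvg_norm fA) c cA).
have [x []] := filter_ex (filterI h fc); rewrite /= => h1 h2.
by have := lt_le_trans h1 h2; rewrite ltxx.
Qed.

Lemma expmx_bound q (X : 'M[R]_q) : `|expmx X| <= nu (1 : 'M[R]_q) * expR (nu X).
Proof.
apply: (cvg_norm_le (@exp_sum_cvg q X)); near=> n.
apply: le_trans (norm_le_nu _) _.
apply: (@le_trans _ _ (nu (1 : 'M[R]_q) * series (exp_coeff (nu X)) n)); last first.
  by rewrite ler_wpM2l ?nu_ge0 // series_exp_coeff_le ?nu_ge0.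
rewrite /exp_sum /series /= mulr_sumr; apply: le_trans (nu_sum _ _ _) _.
apply: ler_sum => i _; rewrite nuZ ger0_norm ?invr_ge0 //.
by rewrite /exp_coeff /= mulrA [leRHS]mulrC ler_wpM2l ?invr_ge0 // nuX.
Unshelve. all: by end_near.
Qed.

(** In the tail of degree at least 2, 1/(i+2)! <= 1/i! allows the square of [nu X] to be factored
    out and leaves the scalar exponential series. *)
Lemma expmx_taylor1 q (X : 'M[R]_q) :
  `|expmx X - 1%:M - X| <= nu (1 : 'M[R]_q) * nu X ^+ 2 * expR (nu X).
Proof.
have h : (fun n => exp_sum X (n + 2)%N - 1%:M - X) @ \oo --> expmx X - 1%:M - X.
  apply: cvgB; last exact: cvg_cst.
  apply: cvgB; last exact: cvg_cst.
  by have := @exp_sum_cvg q X; rewrite -(cvg_shiftn 2).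
apply: (cvg_norm_le h); near=> n.
apply: le_trans (norm_le_nu _) _.
apply: (@le_trans _ _ (nu (1 : 'M[R]_q) * nu X ^+ 2 * series (exp_coeff (nu X)) n)); last first.
  by rewrite ler_wpM2l ?mulr_ge0 ?exprn_ge0 ?nu_ge0 // series_exp_coeff_le ?nu_ge0.
rewrite exp_sumE addn2 !big_ord_recl /= !fact0 invr1 mul1r expr0 expr1.
rewrite -[1%:M]/(1 : 'M[R]_q).
rewrite (_ : _ - 1 - X = \sum_(i < n) ((i.+2)`!%:R^-1) *: X ^+ i.+2); last first.
  rewrite mul1r [1 + _]addrC addrK addrC addKr.
  by apply: eq_bigr => i _; rewrite -mulmxE mul_scalar_mx.
rewrite /series /= big_mkord mulr_sumr; apply: le_trans (nu_sum _ _ _) _.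
apply: ler_sum => i _; rewrite nuZ ger0_norm ?invr_ge0 //.
apply: (@le_trans _ _ (i`!%:R^-1 * nu (X ^+ i.+2))).
  rewrite ler_wpM2r ?nu_ge0 // lef_pV2 ?posrE ?ltr0n ?fact_gt0 // ler_nat.
  by apply: leq_fact; rewrite -addn2 leq_addr.
rewrite /exp_coeff /= mulrA [leRHS]mulrC ler_wpM2l ?invr_ge0 //.
by rewrite -mulrA -exprD add2n nuX.
Unshelve. all: by end_near.
Qed.

Lemma nu0 q : nu (0 : 'M[R]_q) = 0.
Proof. by rewrite /nu normr0 mulr0. Qed.

Lemma expmx0 q : expmx (0 : 'M[R]_q) = 1%:M.
Proof.
have := @expmx_taylor1 q 0.
by rewrite nu0 expr0n /= mulr0 mul0r subr0 normr_le0 subr_eq0 => /eqP.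
Qed.

Lemma expmx_add q (s t : R) (X : 'M[R]_q) :
  expmx ((s + t) *: X) = expmx (s *: X) *m expmx (t *: X).
Proof.
by rewrite scalerDl expmxD // -!scalemxAl -!scalemxAr scalerA mulrC -scalerA.
Qed.

Lemma expmxNK q (X : 'M[R]_q) : expmx (- X) *m expmx X = 1%:M.
Proof.
by rewrite -expmxD ?addNr ?expmx0 // mulNmx mulmxN.
Qed.

Lemma expmxKN q (X : 'M[R]_q) : expmx X *m expmx (- X) = 1%:M.
Proof. by rewrite -{1}[X]opprK expmxNK. Qed.

Lemma expmx_natmul q n (X : 'M[R]_q) : expmx (n%:R *: X) = expmx X ^+ n.
Proof.
elim: n => [|n IHn]; first by rewrite scale0r expmx0 expr0.
by rewrite exprSr -IHn -mulmxE -natr1 expmx_add scale1r.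
Qed.

Section Limits.
Variables (T : Type) (F : set_system T).
Context {FF : Filter F}.

Lemma nu_cvg q (Y : T -> 'M[R]_q) A : Y @ F --> A -> (fun x => nu (Y x)) @ F --> nu A.
Proof. by move=> YA; apply: cvgMr; apply: cvg_norm. Qed.

Lemma cvg_dominated (V : normedModType R) (f : T -> V) (l : V) (g : T -> R) :
  (\forall x \near F, `|f x - l| <= g x) -> g @ F --> (0 : R) -> f @ F --> l.
Proof.
move=> fg g0; apply/cvgrPdist_lt => e e0.
have gl : \forall x \near F, `|g x| < e by apply: cvgr0_norm_lt.
apply: filterS2 fg gl => x fx gx; rewrite distrC; apply: le_lt_trans fx _.
by apply: le_lt_trans gx; rewrite ler_norm.
Qed.

Lemma expR_cvg (f : T -> R) a : f @ F --> a -> (fun x => expR (f x)) @ F --> expR a.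
Proof.
by move=> fa; apply: (@cvg_comp _ _ _ f expR _ _ _ fa (@continuous_expR R a)).
Qed.

Lemma expmx_cvg1 q (Y : T -> 'M[R]_q) :
  Y @ F --> (0 : 'M[R]_q) -> (fun x => expmx (Y x)) @ F --> (1%:M : 'M[R]_q).
Proof.
move=> Y0.
apply: (@cvg_dominated _ _ _ (fun x => nu (1 : 'M[R]_q) * nu (Y x) ^+ 2 * expR (nu (Y x)) + `|Y x|)).
  near=> x; apply: le_trans (lerD (@expmx_taylor1 q (Y x)) (lexx _)).
  by apply: le_trans (ler_normD _ _); rewrite subrK.
have n0 := nu_cvg Y0; rewrite nu0 in n0.
have -> : 0 = nu (1 : 'M[R]_q) * 0 ^+ 2 * expR 0 + `|0 : 'M[R]_q|.
  by rewrite expr0n mulr0 mul0r normr0 addr0.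
apply: cvgD; last exact: cvg_norm.
apply: cvgM; last exact: expR_cvg.
by apply: cvgMr; rewrite expr2; apply: cvgM.
Unshelve. all: by end_near.
Qed.

Lemma expmx_cvg q (s : T -> R) (t : R) (X : 'M[R]_q) :
  s @ F --> t -> (fun x => expmx (s x *: X)) @ F --> expmx (t *: X).
Proof.
move=> st.
have -> : (fun x => expmx (s x *: X)) =
          (fun x => expmx (t *: X) *m expmx ((s x - t) *: X)).
  by apply/funext => x; rewrite -expmx_add addrC subrK.
rewrite -[X in _ --> X]mulmx1.
apply: cvg_mulmx; first exact: cvg_cst.
apply: expmx_cvg1; rewrite -(scale0r X); apply: cvgZl.
by rewrite -(subrr t); apply: cvgB => //; apply: cvg_cst.
Qed.

Lemma expmx_quotient q (eps : T -> R) (X : 'M[R]_q) :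
  eps @ F --> (0 : R) -> (\forall x \near F, eps x != 0) ->
  (fun x => (eps x)^-1 *: (expmx (eps x *: X) - 1%:M)) @ F --> X.
Proof.
move=> e0 en0.
apply: (@cvg_dominated _ _ _ (fun x => `|eps x| *
   (nu (1 : 'M[R]_q) * nu X ^+ 2 * expR (`|eps x| * nu X)))); last first.
  have -> : (0 : R) = `|0 : R| * (nu (1 : 'M[R]_q) * nu X ^+ 2 * expR (`|0 : R| * nu X)).
    by rewrite normr0 mul0r.
  have ne : (fun x => `|eps x|) @ F --> `|0 : R| by apply: cvg_norm.
  by apply: cvgM => //; apply: cvgMr; apply: expR_cvg; apply: cvgMl.
near=> x; have ex0 : eps x != 0 by near: x.
rewrite -[X in _ - X](scalerK ex0) -scalerBr normrZ normfV.
rewrite ler_pdivrMl ?normr_gt0 //.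
apply: le_trans (expmx_taylor1 _) _.
by rewrite nuZ exprMn le_eqVlt; apply/orP; left; apply/eqP; ring.
Unshelve. all: by end_near.
Qed.
End Limits.

(** The noncommutative factorisation of a^k - b^k; with C = 1 it bounds a k-step error by one-step
    errors. *)
Lemma telescope_intertwine m n (A : 'M[R]_m) (B : 'M[R]_n) (C : 'M[R]_(m, n)) k :
  A ^+ k *m C - C *m B ^+ k =
  \sum_(i < k) A ^+ i *m (A *m C - C *m B) *m B ^+ (k.-1 - i).
Proof.
elim: k => [|k IHk]; first by rewrite big_ord0 !expr0 mul1mx mulmx1 subrr.
rewrite big_ord_recr /= subnn expr0 mulmx1.
have -> : \sum_(i < k) A ^+ i *m (A *m C - C *m B) *m B ^+ (k - i) =
   (A ^+ k *m C - C *m B ^+ k) *m B.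
  rewrite IHk mulmx_suml; apply: eq_bigr => i _; rewrite -[in RHS]mulmxA; congr (_ *m _).
  by rewrite mulmxE -exprSr; congr (_ ^+ _); case: k {IHk} i => [[]//|k] i /=; rewrite subSn // -ltnS.
rewrite mulmxBl mulmxBr addrC !exprSr -!mulmxE -!mulmxA addrA subrK.
by rewrite mulmxA.
Qed.

Lemma telescope_bound m n (A : 'M[R]_m) (B : 'M[R]_n) (C : 'M[R]_(m, n)) k (M : R) :
  (forall i, (i < k)%N -> `|A ^+ i| <= M) -> (forall i, (i < k)%N -> `|B ^+ i| <= M) ->
  `|A ^+ k *m C - C *m B ^+ k| <=
     k%:R * (m%:R * n%:R * M ^+ 2 * `|A *m C - C *m B|).
Proof.
move=> AM BM; rewrite telescope_intertwine; apply: le_trans (ler_norm_sum _ _ _) _.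
rewrite mulr_natl -[X in _ *+ X](card_ord k) -sumr_const; apply: ler_sum => i _.
apply: le_trans (mx_normM _ _) _.
have -> : m%:R * n%:R * M ^+ 2 * `|A *m C - C *m B| =
  (n%:R * (m%:R * M * `|A *m C - C *m B|)) * M by ring.
apply: ler_pM => //.
  rewrite ler_wpM2l //; apply: le_trans (mx_normM _ _) _.
  by rewrite ler_wpM2r // ler_wpM2l // AM.
by apply: BM; case: k {AM} i => [[]//|k] i /=; rewrite ltnS leq_subr.
Qed.

Lemma norm_exp1D q (Y : 'M[R]_q) i :
  `|(1%:M + Y) ^+ i| <= nu (1 : 'M[R]_q) * expR (i%:R * nu Y).
Proof.
apply: le_trans (norm_le_nu _) _.
apply: (@le_trans _ _ (nu (1 : 'M[R]_q) * (1 + nu Y) ^+ i)).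
  elim: i => [|i IHi]; first by rewrite !expr0 mulr1.
  rewrite exprSr -mulmxE mulmxDr mulmx1 exprSr mulrA mulrDr mulr1.
  by apply: le_trans (nuD _ _) _; rewrite lerD // (le_trans (nuM _ _)) // ler_wpM2r ?nu_ge0.
rewrite ler_wpM2l ?nu_ge0 // expRM_natl.
by apply: lerXn2r; rewrite ?nnegrE ?addr_ge0 ?nu_ge0 ?expR_ge0 // expR_ge1Dx.
Qed.

(** A perturbed form of (1 + tZ/n)^n -> exp(tZ). The comparison is with exp(eps Z)^k, whose limit is
    known: by telescoping, the difference is at most a bounded multiple of k eps times the gap
    between the slopes Z_ and (exp(eps Z) - 1)/eps. That gap tends to 0, and the intermediate powers
    stay bounded since k eps converges. *)
Lemma exp_limit q (T : Type) (F : set_system T) {FF : Filter F}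
    (eps : T -> R) (k : T -> nat) (Z_ : T -> 'M[R]_q) (Z : 'M[R]_q) (t : R) :
  eps @ F --> (0 : R) -> (\forall x \near F, 0 < eps x) -> Z_ @ F --> Z ->
  (fun x => (k x)%:R * eps x) @ F --> t ->
  (fun x => (1%:M + eps x *: Z_ x) ^+ k x) @ F --> expmx (t *: Z).
Proof.
move=> e0 ep ZZ kt.
have en0 : \forall x \near F, eps x != 0 by apply: filterS ep => x /lt0r_neq0.
have bk : (fun x => expmx (eps x *: Z) ^+ k x) @ F --> expmx (t *: Z).
  have -> : (fun x => expmx (eps x *: Z) ^+ k x) = (fun x => expmx (((k x)%:R * eps x) *: Z)).
    by apply/funext => x; rewrite -expmx_natmul scalerA.
  exact: expmx_cvg.
rewrite -[X in _ --> X]addr0.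
have -> : (fun x => (1%:M + eps x *: Z_ x) ^+ k x) = (fun x =>
   expmx (eps x *: Z) ^+ k x + ((1%:M + eps x *: Z_ x) ^+ k x - expmx (eps x *: Z) ^+ k x)).
  by apply/funext => x; rewrite [RHS]addrC subrK.
apply: cvgD => //.
pose c1 := nu (1 : 'M[R]_q).
(* A bound common to the powers of both matrices with exponent below k: each summand bounds one of
   the two. *)
pose M x := c1 * expR ((k x)%:R * eps x * nu (Z_ x)) + c1 * expR ((k x)%:R * eps x * nu Z).
pose Q x := (eps x)^-1 *: (expmx (eps x *: Z) - 1%:M).
have QZ : Q @ F --> Z by apply: expmx_quotient.
apply: (@cvg_dominated _ _ _ _ _ _ (fun x => ((k x)%:R * eps x) *
     (q%:R * q%:R * M x ^+ 2 * `|Z_ x - Q x|))); last first.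
  have -> : (0 : R) = t * (q%:R * q%:R * (c1 * expR (t * nu Z) + c1 * expR (t * nu Z)) ^+ 2 *
      `|Z - Z|) by rewrite subrr normr0 !mulr0.
  apply: cvgM => //; apply: cvgM; last by apply: cvg_norm; apply: cvgB.
  apply: cvgMr; rewrite expr2.
  have MM : M @ F --> c1 * expR (t * nu Z) + c1 * expR (t * nu Z).
    apply: cvgD; apply: cvgMr; apply: expR_cvg; apply: cvgM => //; first exact: nu_cvg.
    exact: cvg_cst.
  exact: cvgM.
near=> x.
have ex : 0 < eps x by near: x.
have := @telescope_bound q q (1%:M + eps x *: Z_ x) (expmx (eps x *: Z)) 1%:M (k x) (M x).
rewrite !mulmx1 !mul1mx subr0 => H; apply: le_trans (H _ _) _.
- move=> i ik; apply: le_trans (norm_exp1D _ _) _.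
  apply: (@le_trans _ _ (c1 * expR ((k x)%:R * eps x * nu (Z_ x)))).
    rewrite ler_wpM2l ?nu_ge0 // ler_expR nuZ gtr0_norm // mulrA.
    by rewrite ler_wpM2r ?nu_ge0 // ler_wpM2r ?(ltW ex) // ler_nat ltnW.
  by rewrite lerDl mulr_ge0 ?nu_ge0 ?expR_ge0.
- move=> i ik; rewrite -expmx_natmul; apply: le_trans (expmx_bound _) _.
  rewrite -[nu 1]/c1; apply: (@le_trans _ _ (c1 * expR ((k x)%:R * eps x * nu Z))).
    rewrite ler_wpM2l ?nu_ge0 // ler_expR nuZ ger0_norm // nuZ gtr0_norm // mulrA.
    by rewrite ler_wpM2r ?nu_ge0 // ler_wpM2r ?(ltW ex) // ler_nat ltnW.
  by rewrite lerDr mulr_ge0 ?nu_ge0 ?expR_ge0.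
have -> : 1%:M + eps x *: Z_ x - expmx (eps x *: Z) = eps x *: (Z_ x - Q x).
  rewrite scalerBr /Q scalerA divff ?lt0r_neq0 // scale1r opprB.
  by rewrite [1%:M + _]addrC -addrA.
by rewrite normrZ gtr0_norm // le_eqVlt; apply/orP; left; apply/eqP; ring.
Unshelve. all: by end_near.
Qed.

(** * Closed matrix groups and their Lie algebras *)

(** Supplies the step count for [exp_limit]: the integer part of t/eps is off by less than 1, so the
    error is below eps. *)
Lemma floor_cvg (T : Type) (F : set_system T) {FF : Filter F} (eps : T -> R) (t : R) :
  0 <= t -> eps @ F --> (0 : R) -> (\forall x \near F, 0 < eps x) ->
  (fun x => (Num.trunc (t / eps x))%:R * eps x) @ F --> t.
Proof.
move=> t0 e0 ep.
apply: (@cvg_dominated _ _ _ _ _ _ (fun x => `|eps x|)); last first.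
  by rewrite -(normr0 R); apply: cvg_norm.
near=> x; have ex : 0 < eps x by near: x.
have /andP[h1 h2] := truncn_itv (divr_ge0 t0 (ltW ex)).
rewrite [leRHS]gtr0_norm // ler_norml; rewrite ler_pdivlMr // in h1.
rewrite ltr_pdivrMr // -natr1 mulrDl mul1r in h2.
by lra.
Unshelve. all: by end_near.
Qed.

(** Weaker than the condition on G: the elements of G intertwined by a given array form such a
    group, about whose connectedness nothing is known beforehand. *)
Record closed_matrix_group q (G : set 'M[R]_q) : Prop := ClosedMatrixGroup {
  cg_unit : forall g, G g -> g \in unitmx;
  cg_1 : G 1%:M;
  cg_mul : forall g h, G g -> G h -> G (g *m h);
  cg_inv : forall g, G g -> G (invmx g);
  cg_closed : closed G }.

Lemma compact_closed_group q (G : set 'M[R]_q) :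
  compact_connected_linear_lie_group G -> closed_matrix_group G.
Proof.
case=> u o m i c _; split=> //.
exact: (compact_closed (@norm_hausdorff _ _) c).
Qed.

Lemma cg_pow q (G : set 'M[R]_q) g n : closed_matrix_group G -> G g -> G (g ^+ n).
Proof.
move=> cG Gg; elim: n => [|n IHn]; first by rewrite expr0; apply: cg_1.
by rewrite exprS -mulmxE; apply: cg_mul.
Qed.

Lemma invmx_expmx q (X : 'M[R]_q) : invmx (expmx X) = expmx (- X).
Proof.
have u : expmx X \in unitmx by case/mulmx1_unit: (expmxKN X).
by rewrite -[RHS]mul1mx -(mulVmx u) -mulmxA expmxKN mulmx1.
Qed.

(** Powers of 1 + eps Z_ stay in G, and with about t/eps factors they approach exp(tZ), which
    closedness puts in G; negative t follow by inversion. Sums, brackets and tangent directions are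
    all obtained as such limits. *)
Lemma lie_algebra_limit q (G : set 'M[R]_q) (T : Type) (F : set_system T)
    {FF : ProperFilter F} (eps : T -> R) (Z_ : T -> 'M[R]_q) (Z : 'M[R]_q) :
  closed_matrix_group G ->
  eps @ F --> (0 : R) -> (\forall x \near F, 0 < eps x) -> Z_ @ F --> Z ->
  (\forall x \near F, G (1%:M + eps x *: Z_ x)) ->
  lie_algebra G Z.
Proof.
move=> cG e0 ep ZZ GF.
have pos t : 0 <= t -> G (expmx (t *: Z)).
  move=> t0.
  apply: (closed_cvg G (cg_closed cG) _ (expmx (t *: Z)) (exp_limit e0 ep ZZ (floor_cvg t0 e0 ep))).
  by apply: filterS GF => x; apply: cg_pow.
move=> t; have [/pos//|t0] := leP 0 t.
rewrite -[t]opprK scaleNr -invmx_expmx; apply: (cg_inv cG).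
by apply: pos; rewrite oppr_ge0 ltW.
Qed.

(** With a, b the exponentials of xX, xY and a', b' their inverses, the group commutator takes the
    form 1 + x^2 Z_x with Z_x -> XY - YX, as [lie_algebra_limit] requires. *)
Lemma commutator_quotient q (x : R) (a b a' b' : 'M[R]_q) : x != 0 ->
  a *m a' = 1%:M -> b *m b' = 1%:M ->
  1%:M + (x * x) *: (((x^-1 *: (a - 1%:M)) *m (x^-1 *: (b - 1%:M)) -
    (x^-1 *: (b - 1%:M)) *m (x^-1 *: (a - 1%:M))) *m (a' *m b')) =
  a *m b *m a' *m b'.
Proof.
move=> x0 aa bb.
have zE (V : zmodType) (p r c d o : V) :
    p - c - (d - o) - (r - d - (c - o)) = p - r.
  have -> : r - d - (c - o) = r - (c + (d - o)).
    by rewrite -addrA -opprD addrCA.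
  by rewrite -[p - c - _]addrA -opprD opprB addrA subrK.
have E (U V : 'M[R]_q) : (x^-1 *: U) *m (x^-1 *: V) = (x * x)^-1 *: (U *m V).
  by rewrite -scalemxAl -scalemxAr scalerA invfM.
rewrite (E (a - 1%:M)) (E (b - 1%:M)) -scalerBr -scalemxAl scalerA divff ?mulf_neq0 // scale1r.
have -> : (a - 1%:M) *m (b - 1%:M) - (b - 1%:M) *m (a - 1%:M) = a *m b - b *m a.
  by rewrite !mulmxBl !mulmxBr !mulmx1 !mul1mx zE.
rewrite mulmxBl (_ : b *m a *m (a' *m b') = 1%:M); first by rewrite addrC subrK !mulmxA.
by rewrite mulmxA -[b *m a *m a']mulmxA aa mulmx1 bb.
Qed.

Lemma product_quotient q (x : R) (a b : 'M[R]_q) : x != 0 ->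
  1%:M + x *: ((x^-1 *: (a - 1%:M)) *m b + x^-1 *: (b - 1%:M)) = a *m b.
Proof.
move=> x0; rewrite -scalemxAl -scalerDr scalerA divff // scale1r mulmxBl mul1mx.
have zE (V : zmodType) (o p c : V) : o + (p - c + (c - o)) = p.
  by rewrite addrCA [X in _ + X]addrC !subrK.
exact: zE.
Qed.

Lemma lie_algebra_subalgebra q (G : set 'M[R]_q) :
  closed_matrix_group G -> lie_subalgebra (lie_algebra G).
Proof.
move=> cG.
pose F := (0 : R)^'+.
have FF : ProperFilter F by exact: at_right_proper_filter.
have e0 : (fun x : R => x) @ F --> (0 : R) by apply: cvg_at_right_filter; exact: cvg_id.
have ep : \forall x \near F, 0 < x by exact: nbhs_right_gt.
have en : \forall x \near F, x != 0 by apply: filterS ep => x /lt0r_neq0.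
have Q (X : 'M[R]_q) : (fun x => x^-1 *: (expmx (x *: X) - 1%:M)) @ F --> X by exact: (@expmx_quotient _ F _ q id X e0 en).
have c1 (X : 'M[R]_q) : (fun x => expmx (x *: X)) @ F --> (1%:M : 'M[R]_q).
  by rewrite -(expmx0 q) -(scale0r X); apply: expmx_cvg.
have cN1 (X : 'M[R]_q) : (fun x => expmx (- (x *: X))) @ F --> (1%:M : 'M[R]_q).
  by under eq_fun do rewrite -scalerN; apply: c1.
split; first split.
- by move=> t; rewrite scaler0 expmx0; apply: cg_1.
- move=> a u v Gu Gv.
  have Gau : lie_algebra G (a *: u) by move=> t; rewrite scalerA.
  move: (a *: u) Gau => {a u Gu} u Gu.
  apply: (@lie_algebra_limit _ _ _ F _ id (fun x =>
     x^-1 *: (expmx (x *: u) - 1%:M) *m expmx (x *: v) + x^-1 *: (expmx (x *: v) - 1%:M))) => //.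
    apply: cvgD => //; rewrite -[X in _ --> X]mulmx1.
    exact: cvg_mulmx.
  near=> x; have x0 : x != 0 by near: x.
  by rewrite /= product_quotient //; apply: cg_mul.
- move=> X Y GX GY.
  pose A x := x^-1 *: (expmx (x *: X) - 1%:M).
  pose B x := x^-1 *: (expmx (x *: Y) - 1%:M).
  apply: (@lie_algebra_limit _ _ _ F _ (fun x => x * x) (fun x =>
     (A x *m B x - B x *m A x) *m (expmx (- (x *: X)) *m expmx (- (x *: Y))))) => //.
  + by rewrite -(mulr0 0); apply: cvgM.
  + by apply: filterS ep => x x0; rewrite mulr_gt0.
  + have -> : X *m Y - Y *m X = (X *m Y - Y *m X) *m (1%:M *m 1%:M) by rewrite !mulmx1.
    apply: cvg_mulmx; last exact: cvg_mulmx.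
    by apply: cvgB; apply: cvg_mulmx; apply: Q.
  near=> x; have x0 : x != 0 by near: x.
  rewrite /A /B commutator_quotient // ?expmxKN // -!scaleNr.
  by do !apply: cg_mul => //.
Unshelve. all: by end_near.
Qed.

Lemma compact_norm_le n (c : R) : compact [set v : 'rV[R]_n | `|v| <= c].
Proof.
apply: bounded_closed_compact.
  by exists c; split=> [|x cx v /= vc]; rewrite ?num_real // (le_trans vc) // ltW.
have := @closed_closed_ball_ R 'rV[R]_n 0 c.
by rewrite /closed_ball_; under eq_set do rewrite sub0r normrN.
Qed.

(* Finer filters play the role of convergent subsequences. *)
Lemma bounded_cluster m n (T : Type) (F : set_system T) {FF : ProperFilter F}
    (f : T -> 'M[R]_(m, n)) (c : R) :
  (\forall x \near F, `|f x| <= c) ->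
  exists (G : set_system T) (A : 'M[R]_(m, n)),
    [/\ ProperFilter G, F `<=` G & f @ G --> A].
Proof.
(* [compact_norm_le] concerns row vectors, hence the detour through [mxvec]. *)
move=> fc; pose g x := mxvec (f x).
have gc : (g @ F) [set v | `|v| <= c].
  apply: filterS fc => x fx /=; apply: (le_trans _ fx).
  apply: mx_norm_le => // i j; rewrite /g ord1.
  by case/mxvec_indexP: j => i' j'; rewrite mxvecE mx_entry_le.
have [v [_ cv]] := @compact_norm_le _ c (g @ F) _ gc.
(* The filter generated by F and the preimages of the neighbourhoods of the cluster point v; its
   properness is the cluster property. *)
pose G : set_system T := fun A =>
  exists2 B, F B & exists2 U, nbhs v U & B `&` g @^-1` U `<=` A.
have PG : ProperFilter G.
  split.
    move=> [B FB [U vU BU]].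
    have gB : F (g @^-1` (g @` B)) by apply: filterS FB => x Bx; exists x.
    by have [_ [[x Bx <-] Ugx]] := cv _ _ gB vU; apply: (BU x).
  split.
  - by exists setT; [exact: filterT|exists setT => //; exact: filterT].
  - move=> A A' [B FB [U vU BU]] [B' FB' [U' vU' BU']].
    exists (B `&` B'); first exact: filterI.
    exists (U `&` U'); first exact: filterI.
    by move=> x [[Bx B'x] [Ux U'x]]; split; [apply: BU|apply: BU'].
  - move=> A A' AA' [B FB [U vU BU]]; exists B => //; exists U => //.
    exact: subset_trans AA'.
exists G, (vec_mx v); split => //.
  by move=> A FA; exists A => //; exists setT; [exact: filterT|move=> x []].
have gv : g @ G --> v.
  by move=> U vU; exists setT; [exact: filterT|exists U => // x []].
apply/mx_cvgP => i j.
have /mx_cvgP/(_ 0 (mxvec_index i j)) := gv.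
by rewrite -{1}(vec_mxK v) mxvecE; under eq_fun do rewrite mxvecE.
Qed.

Lemma nearest_in_subgroup q (H : set 'M[R]_q) (g : 'M[R]_q) :
  H 1%:M -> compact H -> exists2 h, H h & forall h', H h' -> `|h *m g - 1%:M| <= `|h' *m g - 1%:M|.
Proof.
move=> H1 cH.
have cf : continuous (fun h : 'M[R]_q => `|h *m g - 1%:M| : R).
  move=> h.
  have c : (fun x : 'M[R]_q => x *m g - 1%:M) @ h --> h *m g - 1%:M.
    apply: (@cvgB R 'M[R]_q _ (nbhs h)); last exact: cvg_cst.
    by apply: (@cvg_mulmx R _ (nbhs h)); [exact: cvg_id|exact: cvg_cst].
  exact: cvg_norm c.
have [|h Hh hmin] := @compact_EVT_min _ R _ H _ cH (continuous_subspaceT cf).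
  by exists 1%:M.
by exists h; [exact: set_mem|move=> h' Hh'; apply: hmin; exact: mem_set].
Qed.

(* Otherwise there are w_n -> 1 in G outside H, chosen nearest to 1 in H w_n.
   The directions (w_n - 1) / e_n, with e_n = |w_n - 1|, have a cluster point Z,
   which lies in the Lie algebra of G, hence of H; and then exp(- e_n Z) w_n is
   closer to 1 than w_n. *)
Lemma subgroup_locally_full q (G H : set 'M[R]_q) :
  compact_connected_linear_lie_group G -> closed_matrix_group H -> H `<=` G ->
  lie_algebra G `<=` lie_algebra H ->
  exists2 d : R, 0 < d & forall g, G g -> `|g - 1%:M| < d -> H g.
Proof.
move=> cG cH HG lGH; apply: contrapT => nex.
have cpH : compact H by apply: subclosed_compact (ll_compact cG) HG; apply: cg_closed.
have wex n : exists w, [/\ G w, ~ H w, `|w - 1%:M| < n.+1%:R^-1 &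
    forall h, H h -> `|w - 1%:M| <= `|h *m w - 1%:M| ].
  have [g [Gg gn nHg]] : exists g, [/\ G g, `|g - 1%:M| < n.+1%:R^-1 & ~ H g].
    apply: contrapT => ne; apply: nex; exists n.+1%:R^-1 => // g Gg gn.
    by apply: contrapT => nHg; apply: ne; exists g.
  have [h Hh hmin] := nearest_in_subgroup g (cg_1 cH) cpH.
  exists (h *m g); split.
  - by apply: (ll_mul cG) => //; apply: HG.
  - move=> Hhg; apply: nHg; rewrite -[g]mul1mx -(mulVmx (cg_unit cH Hh)) -mulmxA.
    by apply: (cg_mul cH) => //; apply: (cg_inv cH).
  - by apply: le_lt_trans gn; have := hmin _ (cg_1 cH); rewrite mul1mx.
  - by move=> h' Hh'; rewrite mulmxA; apply: hmin; apply: (cg_mul cH).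
have /choice [w wP] := wex.
pose e n := `|w n - 1%:M|.
have en0 n : 0 < e n.
  have [_ nH _ _] := wP n; rewrite normr_gt0 subr_eq0; apply/eqP => w1.
  by apply: nH; rewrite w1; apply: cg_1.
pose Z_ n := (e n)^-1 *: (w n - 1%:M).
have Z1 n : `|Z_ n| = 1.
  by rewrite normrZ gtr0_norm ?invr_gt0 // mulVf // lt0r_neq0.
have [|F [Z [FF ooF ZZ]]] := @bounded_cluster q q nat \oo _ Z_ 1.
  by apply: nearW => n; rewrite Z1.
have e0 : e @ F --> (0 : R).
  apply: (@cvg_dominated _ F _ _ e 0 (fun n => n.+1%:R^-1)).
    by apply: nearW => n; have [_ _ /ltW] := wP n; rewrite subr0 /e normr_id.
  by apply: cvg_trans cvg_harmonic => A /ooF.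
have w1 : w @ F --> (1%:M : 'M[R]_q).
  by apply: (@cvg_dominated _ F _ _ w 1%:M e _ e0); apply: nearW => n.
have LZ : lie_algebra H Z.
  apply: lGH; apply: (lie_algebra_limit (compact_closed_group cG) e0 _ ZZ).
    exact: nearW.
  apply: nearW => n; rewrite scalerA divff ?lt0r_neq0 // scale1r addrC subrK.
  by have [] := wP n.
pose U n := (e n)^-1 *: (expmx (e n *: - Z) - 1%:M).
have UZ : U @ F --> - Z.
  by apply: expmx_quotient => //; apply: nearW => n; rewrite lt0r_neq0.
have lim0 : (fun n => U n *m w n + Z_ n) @ F --> (0 : 'M[R]_q).
  have -> : (0 : 'M[R]_q) = - Z *m 1%:M + Z by rewrite mulmx1 addNr.
  exact: cvgD (cvg_mulmx UZ w1) ZZ.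
have small : \forall n \near F, `|U n *m w n + Z_ n| < 1 by exact: cvgr0_norm_lt.
have [n] := filter_ex small; apply/negP; rewrite -leNgt.
have [_ _ _ /(_ (expmx (e n *: - Z)))] := wP n.
rewrite -(product_quotient _ _ (lt0r_neq0 (en0 n))) -/(U n) -/(Z_ n).
rewrite [1%:M + _]addrC addrK normrZ gtr0_norm // -/(e n) ler_pMr //.
by apply; rewrite scalerN -scaleNr; apply: LZ.
Qed.

(** Translating the neighbourhood of 1 from [subgroup_locally_full] by the elements of H shows that
    H is open in G; it is also closed and nonempty. *)
Lemma connected_group_eq q (G H : set 'M[R]_q) :
  compact_connected_linear_lie_group G -> closed_matrix_group H -> H `<=` G ->
  lie_algebra G `<=` lie_algebra H -> H = G.
Proof.
move=> cG cH HG lGH.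
have [d d0 dH] := subgroup_locally_full cG cH HG lGH.
have lc (h : 'M[R]_q) : continuous (fun g : 'M[R]_q => `|h *m g - 1%:M| : R).
  move=> g.
  have c : (fun x : 'M[R]_q => h *m x - 1%:M) @ g --> h *m g - 1%:M.
    apply: (@cvgB R 'M[R]_q _ (nbhs g)); last exact: cvg_cst.
    by apply: (@cvg_mulmx R _ (nbhs g)); [exact: cvg_cst|exact: cvg_id].
  exact: cvg_norm c.
apply: (ll_connected cG).
- by exists 1%:M; apply: cg_1.
- exists (\bigcup_(h in H) [set g | `|invmx h *m g - 1%:M| < d]).
    apply: bigcup_open => h Hh.
    exact: (open_comp (fun g _ => @lc (invmx h) g) (@open_lt R d)).
  apply/seteqP; split=> [g Hg|g [Gg [h Hh] /= hg]].
    split; first exact: HG.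
    by exists g => //=; rewrite mulVmx ?subrr ?normr0 //; apply: cg_unit Hg.
  rewrite -[g]mul1mx -(mulmxV (cg_unit cH Hh)) -mulmxA.
  apply: (cg_mul cH) => //; apply: dH => //.
  by apply: (ll_mul cG) => //; apply: (ll_inv cG); apply: HG.
- exists H; first exact: cg_closed.
  by apply/seteqP; split=> [g Hg|g []//]; split=> //; apply: HG.
Qed.

(** * Continuous one-parameter groups of matrices *)

Section OneParameter.
Variables (m : nat) (gam : R -> 'M[R]_m).
Hypothesis gam0 : gam 0 = 1%:M.
Hypothesis gamD : forall s t, gam (s + t) = gam s *m gam t.
Hypothesis gam_cont : gam @ (0 : R) --> (1%:M : 'M[R]_m).

Lemma gam_natmul (k : nat) (s : R) : gam (k%:R * s) = gam s ^+ k.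
Proof.
elim: k => [|k IHk]; first by rewrite mul0r gam0 expr0.
by rewrite exprSr -natr1 mulrDl mul1r gamD IHk mulmxE.
Qed.

Lemma gam_cvg (T : Type) (F : set_system T) {FF : Filter F} (s : T -> R) (t : R) :
  s @ F --> t -> (fun x => gam (s x)) @ F --> gam t.
Proof.
move=> st.
have -> : (fun x => gam (s x)) = (fun x => gam t *m gam (s x - t)).
  by apply/funext => x; rewrite -gamD addrC subrK.
rewrite -[X in _ --> X]mulmx1.
apply: cvg_mulmx; first exact: cvg_cst.
apply: (@cvg_comp _ _ _ (fun x => s x - t) gam _ _ _ _ gam_cont).
by rewrite -(subrr t); apply: cvgB => //; apply: cvg_cst.
Qed.

Let a n := gam n.+1%:R^-1.

(* Otherwise the normalised slopes have a cluster point W of norm 1 with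
   exp(t W) = 1 for all t >= 0, which is absurd. *)
Lemma gam_slope_bounded : exists c : R, \forall n \near \oo, `|n.+1%:R *: (a n - 1%:M)| <= c.
Proof.
apply: contrapT => nb.
have nK (K : nat) : exists n, (K <= n)%N /\ K.+1%:R < `|n.+1%:R *: (a n - 1%:M)|.
  apply: contrapT => ne; apply: nb; exists K.+1%:R; exists K => // n /= Kn.
  by rewrite leNgt; apply/negP => h; apply: ne; exists n.
have /choice [n nP] := nK.
pose d K := `|a (n K) - 1%:M|.
have dK K : K.+1%:R < (n K).+1%:R * d K.
  by have [_] := nP K; rewrite normrZ ger0_norm.
have d0 K : 0 < d K.
  by rewrite -(pmulr_rgt0 _ (ltr0Sn R (n K))); apply: le_lt_trans (dK K).
pose W_ K := (d K)^-1 *: (a (n K) - 1%:M).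
have W1 K : `|W_ K| = 1.
  by rewrite normrZ gtr0_norm ?invr_gt0 // mulVf // lt0r_neq0.
have [|F [W [FF ooF WW]]] := @bounded_cluster m m nat \oo _ W_ 1.
  by apply: nearW => k; rewrite W1.
have h0 : (fun K => K.+1%:R^-1 : R) @ F --> (0 : R).
  by apply: cvg_trans (@cvg_harmonic R) => A /ooF.
have n0 : (fun K => (n K).+1%:R^-1 : R) @ F --> (0 : R).
  apply: (@cvg_dominated _ F _ _ _ 0 _ _ h0); apply: nearW => K.
  rewrite subr0 ger0_norm ?invr_ge0 // lef_pV2 ?posrE ?ltr0n // ler_nat ltnS.
  by have [] := nP K.
have dd : d @ F --> (0 : R).
  have hB : (fun K => a (n K) - 1%:M) @ F --> (1%:M - 1%:M : 'M[R]_m).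
    by apply: cvgB; [rewrite -gam0; exact: gam_cvg n0|exact: cvg_cst].
  by rewrite -(normr0 'M[R]_m) -(subrr 1%:M); exact: cvg_norm hB.
(* Two limits of gam(k / (n K).+1), with k the integer part of t / d K. As k-th powers of 1 + d K W_
   they tend to exp(tW); but the arguments are at most t/(K+1), since the slopes exceed K+1, so they
   also tend to gam 0. *)
have E t : 0 <= t -> expmx (t *: W) = 1%:M.
  move=> t0.
  have dpos : \forall K \near F, 0 < d K by apply: nearW.
  pose proof (exp_limit dd dpos WW (floor_cvg t0 dd dpos)) as h1.
  have h2 : (fun K => gam ((Num.trunc (t / d K))%:R * (n K).+1%:R^-1)) @ F --> gam 0.
    apply: gam_cvg.
    have th : (fun K => t * K.+1%:R^-1) @ F --> (0 : R).
      by rewrite -(mulr0 t); apply: cvgMr.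
    apply: (@cvg_dominated _ F _ _ _ 0 _ _ th); apply: nearW => K.
    rewrite subr0 ger0_norm ?mulr_ge0 ?invr_ge0 //.
    rewrite ler_pdivrMr ?ltr0n // -mulrA.
    have /andP[h _] := truncn_itv (divr_ge0 t0 (ltW (d0 K))).
    apply: le_trans h _; rewrite ler_wpM2l //.
    rewrite -[leRHS]mulrC ler_pdivlMr ?ltr0n // ler_pdivrMl // mulrC.
    exact: ltW (dK K).
  have h3 : (fun K => (1%:M + d K *: W_ K) ^+ Num.trunc (t / d K)) =
            (fun K => gam ((Num.trunc (t / d K))%:R * (n K).+1%:R^-1)).
    apply/funext => K; rewrite gam_natmul /W_ scalerA divff ?lt0r_neq0 // scale1r.
    by rewrite addrC subrK.
  rewrite h3 in h1; rewrite -gam0.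
  exact: (cvg_unique (@norm_hausdorff _ _) h1 h2).
pose P := (0 : R)^'+.
have FP : ProperFilter P by exact: at_right_proper_filter.
have e0 : (fun x : R => x) @ P --> (0 : R) by apply: cvg_at_right_filter; exact: cvg_id.
have ep : \forall x \near P, 0 < x by exact: nbhs_right_gt.
have en : \forall x \near P, x != 0 by apply: filterS ep => x /lt0r_neq0.
(* The derivative at 0 of exp(tW), which is constantly 1 for t >= 0, is W; hence W = 0, against its
   norm 1. *)
pose proof (@expmx_quotient _ P _ m id W e0 en) as h4.
have h5 : (fun x : R => x^-1 *: (expmx (x *: W) - 1%:M)) @ P --> (0 : 'M[R]_m).
  apply: (@cvg_dominated _ P _ _ _ 0 (fun=> 0)); last exact: cvg_cst.
  apply: filterS ep => x x0; have -> := E x (ltW x0).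
  by rewrite subrr scaler0 subr0 normr0.
have W0 : W = 0 by exact: (cvg_unique (@norm_hausdorff _ _) h4 h5).
have := @cvg_unique _ (@norm_hausdorff _ _) _ _ _ _ (cvg_norm WW) (_ : (fun K => `|W_ K|) @ F --> (1 : R)).
rewrite W0 normr0 => h6.
have : (0 : R) = 1 by apply: h6; under eq_fun do rewrite W1; apply: cvg_cst.
by apply/eqP; rewrite eq_sym oner_eq0.
Qed.

(** C is a cluster point of the slopes (n+1)(gam(1/(n+1)) - 1). Along the finer filter, gam(k/(n+1))
    tends to gam(t) by continuity, and as a k-th power of gam(1/(n+1)) it tends to exp(tC) by
    [exp_limit]. *)
Theorem one_parameter_group_exp : exists C, forall t, gam t = expmx (t *: C).
Proof.
have [c Zc] := gam_slope_bounded.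
pose Z_ n := n.+1%:R *: (a n - 1%:M).
have [F [C [FF ooF ZC]]] := bounded_cluster Zc.
exists C.
have e0 : (fun n => n.+1%:R^-1 : R) @ F --> (0 : R).
  by apply: cvg_trans (@cvg_harmonic R) => A /ooF.
have ep : \forall n \near F, 0 < (n.+1%:R^-1 : R) by apply: nearW => n; rewrite invr_gt0.
have pos t : 0 <= t -> gam t = expmx (t *: C).
  move=> t0; pose proof (floor_cvg t0 e0 ep) as fl.
  pose proof (exp_limit e0 ep ZC fl) as h1; pose proof (gam_cvg fl) as h2.
  have h3 : (fun n => (1%:M + n.+1%:R^-1 *: (n.+1%:R *: (a n - 1%:M))) ^+
       Num.trunc (t / n.+1%:R^-1)) =
       (fun n => gam ((Num.trunc (t / n.+1%:R^-1))%:R * n.+1%:R^-1)).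
    apply/funext => n.
    by rewrite gam_natmul scalerA mulVf ?pnatr_eq0 // scale1r addrC subrK.
  rewrite /= h3 in h1.
  exact: (cvg_unique (@norm_hausdorff _ _) h2 h1).
move=> t; have [/pos//|t0] := leP 0 t.
have t0' : 0 <= - t by rewrite oppr_ge0 ltW.
have u : expmx (- t *: C) *m gam t = 1%:M by rewrite -pos // -gamD addNr gam0.
by rewrite -[LHS]mul1mx -(expmxKN (t *: C)) -scaleNr -mulmxA u mulmx1.
Qed.

End OneParameter.

End MatrixExp.

(** * Derivatives of representations *)

Section Scalars.
Variables (R : realType) (s : scalar_kind).
Local Notation K := (scalars R s).

Definition re_part : K -> R :=
  match s return scalars R s -> R with
  | RealScalars => fun x => x
  | ComplexScalars => fun z => complex.Re z
  end.

Definition im_part : K -> R :=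
  match s return scalars R s -> R with
  | RealScalars => fun=> 0
  | ComplexScalars => fun z => complex.Im z
  end.
End Scalars.
Arguments re_part {R s}.
Arguments im_part {R s}.

Section ScalarTheory.
Variables (R : realType) (s : scalar_kind).
Local Notation K := (scalars R s).
Implicit Types x y : K.

Lemma re_partD x y : re_part (x + y) = re_part x + re_part y.
Proof. by case: s x y => //= -[a b] [c d]. Qed.
Lemma im_partD x y : im_part (x + y) = im_part x + im_part y.
Proof. by case: s x y => [x y|[a b] [c d]] //=; rewrite addr0. Qed.
Lemma re_partN x : re_part (- x) = - re_part x.
Proof. by case: s x => //= -[a b]. Qed.
Lemma im_partN x : im_part (- x) = - im_part x.
Proof. by case: s x => [x|[a b]] //=; rewrite oppr0. Qed.
Lemma re_partM x y : re_part (x * y) = re_part x * re_part y - im_part x * im_part y.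
Proof. by case: s x y => [x y|[a b] [c d]] //=; rewrite mul0r subr0. Qed.
Lemma im_partM x y : im_part (x * y) = re_part x * im_part y + im_part x * re_part y.
Proof. by case: s x y => [x y|[a b] [c d]] //=; rewrite mul0r mulr0 addr0. Qed.
Lemma re_part_nat n : re_part (n%:R : K) = n%:R.
Proof.
case: s => //=; elim: n => [|n IHn]; first by rewrite !mulr0n.
by rewrite -natr1 -[in RHS]natr1 -IHn; case: (_%:R).
Qed.
Lemma im_part_nat n : im_part (n%:R : K) = 0.
Proof.
case: s => //=; elim: n => [|n IHn]; first by rewrite !mulr0n.
by rewrite -natr1 -[RHS]IHn; case: (_%:R) => a b /=; rewrite addr0.
Qed.
Lemma re_im_inj x y : re_part x = re_part y -> im_part x = im_part y -> x = y.
Proof. by case: s x y => //= -[a b] [c d] /= -> ->. Qed.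
Lemma re_part_of_real (a : R) : re_part (of_real s a) = a.
Proof. by case: s. Qed.
Lemma im_part_of_real (a : R) : im_part (of_real s a) = 0.
Proof. by case: s. Qed.

Lemma norm_re_part (z : K) : `|of_real s (re_part z)| <= `|z|.
Proof.
case: s z => //= z; apply: le_trans (normc_ge_Re z).
by rewrite !normc_def /= expr0n addr0 sqrtr_sqr.
Qed.

Lemma norm_im_part (z : K) : `|of_real s (im_part z)| <= `|z|.
Proof.
case: s z => [z|z] /=; first by rewrite normr0.
rewrite !normc_def /= expr0n addr0 lecR ler_wsqrtr // lerDr.
exact: sqr_ge0.
Qed.

Lemma norm_scalar_le (z : K) : `|z| <= of_real s (`|re_part z| + `|im_part z|).
Proof.
case: s z => [z|z] /=; first by rewrite normr0 addr0.
rewrite normc_def lecR -[leRHS]ger0_norm ?addr_ge0 // -sqrtr_sqr ler_wsqrtr //.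
rewrite sqrrD !real_normK ?num_real // -addrA lerD2l lerDr mulrn_wge0 //.
Qed.

Lemma ltr_of_real (a b : R) : (of_real s a < of_real s b) = (a < b).
Proof. by case: s => //=; apply: ltcR. Qed.

Lemma norm_of_real (a : R) : `|of_real s a| = of_real s `|a|.
Proof. by case: s => //=; rewrite normc_def /= expr0n addr0 sqrtr_sqr. Qed.

Lemma pos_of_real (e : K) : 0 < e -> exists2 a : R, 0 < a & e = of_real s a.
Proof.
case: s e => [e e0|[a b]] /=; first by exists e.
by rewrite ltcE /= => /andP[/eqP -> a0]; exists a.
Qed.

Lemma re_partB x y : re_part (x - y) = re_part x - re_part y.
Proof. by rewrite re_partD re_partN. Qed.
Lemma im_partB x y : im_part (x - y) = im_part x - im_part y.
Proof. by rewrite im_partD im_partN. Qed.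

Lemma scalar_cvgP (T : Type) (F : set_system T) {FF : Filter F} (f : T -> K) (z : K) :
  f @ F --> z <-> (fun t => re_part (f t)) @ F --> re_part z /\
                  (fun t => im_part (f t)) @ F --> im_part z.
Proof.
split=> [fz|[fr fi]].
  have h (e : R) : 0 < e -> \forall t \near F, `|z - f t| < of_real s e.
    move=> e0; have e0' : 0 < of_real s e.
      by have := ltr_of_real 0 e; case: (s) => [->//|/= ->].
    exact: cvgr_dist_lt fz _ e0'.
  split; apply/cvgrPdist_lt => e e0; apply: filterS (h e e0) => t ht.
    rewrite -ltr_of_real -norm_of_real -re_partB.
    exact: le_lt_trans (norm_re_part _) ht.
  rewrite -ltr_of_real -norm_of_real -im_partB.
  exact: le_lt_trans (norm_im_part _) ht.
apply/cvgrPdist_lt => e' /pos_of_real[e e0 ->].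
have e20 : 0 < e / 2 by rewrite divr_gt0.
have /cvgrPdist_lt/(_ _ e20) hr := fr.
have /cvgrPdist_lt/(_ _ e20) hi := fi.
apply: filterS2 hr hi => t hr hi.
apply: le_lt_trans (norm_scalar_le _) _; rewrite ltr_of_real re_partB im_partB.
by rewrite [ltRHS]splitr ltrD.
Qed.

Lemma scalar_cvg_ex (T : Type) (F : set_system T) {FF : ProperFilter F} (f : T -> K) (a b : R) :
  (fun t => re_part (f t)) @ F --> a -> (fun t => im_part (f t)) @ F --> b ->
  exists z : K, [/\ f @ F --> z, re_part z = a & im_part z = b].
Proof.
move=> fa fb.
suff [z [za zb]] : exists z : K, re_part z = a /\ im_part z = b.
  by exists z; split => //; apply/scalar_cvgP; rewrite za zb.
case: s f fa fb => /= f fa fb; last by exists (a +i* b)%C.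
exists a; split=> //.
exact: (cvg_unique (@norm_hausdorff _ _) (@cvg_cst _ 0 _ F _) fb).
Qed.

Lemma re_part_sum I (r : seq I) (P : pred I) (f : I -> K) :
  re_part (\sum_(i <- r | P i) f i) = \sum_(i <- r | P i) re_part (f i).
Proof. by apply: big_morph => [x y|]; [exact: re_partD|case: (s)]. Qed.
Lemma im_part_sum I (r : seq I) (P : pred I) (f : I -> K) :
  im_part (\sum_(i <- r | P i) f i) = \sum_(i <- r | P i) im_part (f i).
Proof. by apply: big_morph => [x y|]; [exact: im_partD|case: (s)]. Qed.

(** The usual embedding a + ib |-> (a, -b; b, a) of complex matrices into real ones. Being
    multiplicative and injective, it carries the results on real exponentials to both kinds of
    scalars; for real scalars it merely duplicates the matrix. *)
Definition real_mx m n (A : 'M[K]_(m, n)) : 'M[R]_(m + m, n + n) :=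
  block_mx (map_mx re_part A) (- map_mx im_part A) (map_mx im_part A) (map_mx re_part A).

Lemma real_mxM m n p (A : 'M[K]_(m, n)) (B : 'M[K]_(n, p)) :
  real_mx (A *m B) = real_mx A *m real_mx B.
Proof.
have hr : map_mx re_part (A *m B) = map_mx re_part A *m map_mx re_part B -
    map_mx im_part A *m map_mx im_part B.
  apply/matrixP => i j; rewrite !mxE re_part_sum -sumrB.
  by apply: eq_bigr => k _; rewrite re_partM !mxE.
have hi : map_mx im_part (A *m B) = map_mx im_part A *m map_mx re_part B +
    map_mx re_part A *m map_mx im_part B.
  apply/matrixP => i j; rewrite !mxE im_part_sum -big_split.
  by apply: eq_bigr => k _; rewrite im_partM !mxE addrC.
rewrite /real_mx mulmx_block hr hi !mulNmx !mulmxN -opprD.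
by rewrite [X in block_mx _ (- X) _ _]addrC [X in block_mx _ _ _ X]addrC.
Qed.

Lemma real_mx1 n : real_mx (1%:M : 'M[K]_n) = 1%:M.
Proof.
rewrite /real_mx [RHS]scalar_mx_block; congr block_mx;
  apply/matrixP => i j; rewrite !mxE ?im_part_nat ?re_part_nat ?oppr0 //.
Qed.

Lemma real_mxB m n (A B : 'M[K]_(m, n)) : real_mx (A - B) = real_mx A - real_mx B.
Proof.
rewrite /real_mx opp_block_mx add_block_mx; congr block_mx;
  by apply/matrixP => i j; rewrite !mxE ?re_partB ?im_partB ?opprD.
Qed.

Lemma real_mxZ m n (a : R) (A : 'M[K]_(m, n)) :
  real_mx (of_real s a *: A) = a *: real_mx A.
Proof.
rewrite /real_mx scale_block_mx; congr block_mx; apply/matrixP => i j; rewrite !mxE;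
  rewrite ?re_partM ?im_partM re_part_of_real im_part_of_real ?mul0r ?subr0 ?addr0 //.
by rewrite mulrN.
Qed.

Lemma real_mx_inj m n : injective (@real_mx m n).
Proof.
move=> A B /eq_block_mx [hr _ hi _]; apply/matrixP => i j.
have /matrixP/(_ i j) := hr; have /matrixP/(_ i j) := hi; rewrite !mxE => h1 h2.
exact: re_im_inj.
Qed.

Lemma real_mx_cvg (T : Type) (F : set_system T) {FF : Filter F} m n
    (f : T -> 'M[K]_(m, n)) (A : 'M[K]_(m, n)) :
  f @ F --> A -> (fun t => real_mx (f t)) @ F --> real_mx A.
Proof.
move=> /mx_cvgP fA; apply/mx_cvgP => i j.
have h1 i' j' : (fun t => re_part (f t i' j')) @ F --> re_part (A i' j').
  by have /scalar_cvgP[] := fA i' j'.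
have h2 i' j' : (fun t => im_part (f t i' j')) @ F --> im_part (A i' j').
  by have /scalar_cvgP[] := fA i' j'.
rewrite -(splitK i) -(splitK j) /real_mx.
case: (fintype.split i) => i'; case: (fintype.split j) => j' /=.
- by under eq_fun do rewrite block_mxEul mxE; rewrite block_mxEul mxE; exact: h1.
- under eq_fun do rewrite block_mxEur !mxE; rewrite block_mxEur !mxE.
  exact: cvgN (h2 _ _).
- by under eq_fun do rewrite block_mxEdl mxE; rewrite block_mxEdl mxE; exact: h2.
- by under eq_fun do rewrite block_mxEdr mxE; rewrite block_mxEdr mxE; exact: h1.
Qed.

(** The image of [real_mx] is closed, the limit being read off the left blocks. This brings a
    derivative found for real blocks back to a matrix over K. *)
Lemma real_mx_cvg_ex (T : Type) (F : set_system T) {FF : ProperFilter F} m n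
    (f : T -> 'M[K]_(m, n)) (B : 'M[R]_(m + m, n + n)) :
  (fun t => real_mx (f t)) @ F --> B ->
  exists2 A : 'M[K]_(m, n), f @ F --> A & real_mx A = B.
Proof.
move=> fB.
have zex i j : exists z : K, (fun t => f t i j) @ F --> z.
  have /mx_cvgP fB' := fB.
  have h1 := fB' (lshift m i) (lshift n j).
  have h2 := fB' (rshift m i) (lshift n j).
  have h1' : (fun t => re_part (f t i j)) @ F --> B (lshift m i) (lshift n j).
    by move: h1; under eq_fun do rewrite block_mxEul mxE.
  have h2' : (fun t => im_part (f t i j)) @ F --> B (rshift m i) (lshift n j).
    by move: h2; under eq_fun do rewrite block_mxEdl mxE.
  by have [z []] := scalar_cvg_ex h1' h2'; exists z.
have /choice [z zP] : forall ij : 'I_m * 'I_n, exists z : K, (fun t => f t ij.1 ij.2) @ F --> z.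
  by move=> [i j]; apply: zex.
have fA : f @ F --> (\matrix_(i, j) z (i, j) : 'M[K]_(m, n)).
  by apply/mx_cvgP => i j; rewrite mxE; apply: (zP (i, j)).
exists (\matrix_(i, j) z (i, j)) => //.
exact: (cvg_unique (@norm_hausdorff _ _) (real_mx_cvg fA) fB).
Qed.

End ScalarTheory.

Section LieTheorem.
Variables (R : realType) (s : scalar_kind) (q : nat).
Local Notation K := (scalars R s).
Variable G : set 'M[R]_q.
Hypothesis hG : compact_connected_linear_lie_group G.

Lemma repr_cvg n (rho : 'M[R]_q -> 'M[K]_n) (T : Type) (F : set_system T) {FF : Filter F}
    (f : T -> 'M[R]_q) (g : 'M[R]_q) :
  continuous_repr G rho -> G g -> (\forall t \near F, G (f t)) -> f @ F --> g ->
  (fun t => rho (f t)) @ F --> rho g.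
Proof.
move=> rr Gg GF fg; have /subspace_continuousP/(_ g Gg) := cr_continuous rr.
move=> h A hA.
have h2 : F (fun t => G (f t) -> A (rho (f t))) by exact: (fg _ (h A hA)).
have h3 : F (fun t => A (rho (f t))) by apply: filterS2 h2 GF => t; apply.
exact: h3.
Qed.

Lemma real_of_scaler m n (a : R) (A : 'M[K]_(m, n)) :
  (real_mx ((of_real s a)^-1 *: A)) = a^-1 *: real_mx A.
Proof.
rewrite -real_mxZ; congr (real_mx (_ *: A)).
case: (s) => //=; exact: (esym (fmorphV (real_complex R) a)).
Qed.

(** The real form of rho(exp(tX)) is a continuous one-parameter group, hence exp(tC) for some C. As
    a limit of real forms of difference quotients, C is itself the real form of a matrix, which is
    the entrywise derivative. *)
Lemma repr_derivative n (rho : 'M[R]_q -> 'M[K]_n) (X : 'M[R]_q) :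
  continuous_repr G rho -> lie_algebra G X ->
  (fun t : R => (of_real s t)^-1 *: (rho (expmx (t *: X)) - 1%:M)) @ (0 : R)^' --> drepr rho X /\
  forall t, real_mx (rho (expmx (t *: X))) = expmx (t *: real_mx (drepr rho X)).
Proof.
move=> rr GX.
pose gam t := real_mx (rho (expmx (t *: X))).
have gam0 : gam 0 = 1%:M by rewrite /gam scale0r expmx0 (cr_1 rr) real_mx1.
have gamD u v : gam (u + v) = gam u *m gam v.
  by rewrite /gam expmx_add (cr_mul rr) // real_mxM.
have gamc : gam @ (0 : R) --> (1%:M : 'M[R]_(n + n)).
  rewrite -gam0; apply: (@real_mx_cvg _ _ _ (nbhs (0 : R))).
  apply: (@repr_cvg _ _ _ (nbhs (0 : R))) => //; first exact: nearW.
  by apply: (@expmx_cvg R _ (nbhs (0 : R))); exact: cvg_id.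
have [C gamC] := one_parameter_group_exp gam0 gamD gamc.
pose F := (0 : R)^'.
have FF : ProperFilter F by exact: Proper_dnbhs_numFieldType.
have e0 : (fun t : R => t) @ F --> (0 : R) by apply: cvg_within.
have en : \forall t \near F, t != 0 by exact: nbhs_dnbhs_neq.
have qC : (fun t : R => real_mx ((of_real s t)^-1 *: (rho (expmx (t *: X)) - 1%:M))) @ F --> C.
  rewrite (_ : (fun t => _) = (fun t => t^-1 *: (expmx (t *: C) - 1%:M))).
    exact: (@expmx_quotient _ _ F _ _ id C e0 en).
  by apply/funext => t; rewrite real_of_scaler real_mxB real_mx1 -gamC.
have [S qS SC] := real_mx_cvg_ex qC.
suff -> : drepr rho X = S by split=> // t; rewrite SC -gamC.
apply/matrixP => i j; rewrite mxE /deriv0.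
apply: cvg_lim; first exact: norm_hausdorff.
rewrite (_ : (fun t => _) = (fun t => ((of_real s t)^-1 *: (rho (expmx (t *: X)) - 1%:M)) i j)).
  by have /mx_cvgP := qS; apply.
by apply/funext => t; rewrite !mxE scale0r expmx0 (cr_1 rr) mxE.
Qed.

Lemma intertwine_exp m n (A : 'M[R]_m) (B : 'M[R]_n) (C : 'M[R]_(m, n)) :
  A *m C = C *m B -> expmx A *m C = C *m expmx B.
Proof.
move=> AC.
have h k : exp_sum A k *m C = C *m exp_sum B k.
  rewrite /exp_sum /series /= mulmx_suml mulmx_sumr; apply: eq_bigr => i _.
  rewrite -scalemxAl -scalemxAr; congr (_ *: _).
  elim: i => [|i IHi]; first by rewrite !expr0 mul1mx mulmx1.
  by rewrite !exprSr -!mulmxE -mulmxA AC !mulmxA IHi.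
have h1 : (fun k => exp_sum A k *m C) @ \oo --> expmx A *m C.
  by apply: cvg_mulmx; [exact: exp_sum_cvg|exact: cvg_cst].
have h2 : (fun k => exp_sum A k *m C) @ \oo --> C *m expmx B.
  rewrite (_ : (fun k => _) = (fun k => C *m exp_sum B k)); last exact/funext.
  by apply: cvg_mulmx; [exact: cvg_cst|exact: exp_sum_cvg].
exact: (cvg_unique (@norm_hausdorff _ _) h1 h2).
Qed.

Definition intertwines m n (sigma : 'M[R]_q -> 'M[K]_m) (tau : 'M[R]_q -> 'M[K]_n)
    (C : 'M[K]_(m, n)) : Prop :=
  forall g, G g -> sigma g *m C = C *m tau g.

Lemma intertwines_subgroup m n (sigma : 'M[R]_q -> 'M[K]_m) (tau : 'M[R]_q -> 'M[K]_n)
    (C : 'M[K]_(m, n)) :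
  continuous_repr G sigma -> continuous_repr G tau ->
  closed_matrix_group [set g | G g /\ sigma g *m C = C *m tau g].
Proof.
move=> rs rt; have cG := compact_closed_group hG.
split.
- by move=> g [Gg _]; apply: cg_unit Gg.
- by split; [exact: cg_1|rewrite (cr_1 rs) (cr_1 rt) mul1mx mulmx1].
- move=> g h [Gg gC] [Gh hC]; split; first exact: cg_mul.
  by rewrite (cr_mul rs) // (cr_mul rt) // -mulmxA hC !mulmxA gC.
- move=> g [Gg gC]; have Gi := cg_inv cG Gg; split => //.
  have s1 : sigma (invmx g) *m sigma g = 1%:M.
    by rewrite -(cr_mul rs) // mulVmx ?(cr_1 rs) //; apply: cg_unit Gg.
  have t1 : tau g *m tau (invmx g) = 1%:M.
    by rewrite -(cr_mul rt) // mulmxV ?(cr_1 rt) //; apply: cg_unit Gg.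
  by rewrite -[LHS]mulmx1 -t1 mulmxA -(mulmxA _ C) -gC !mulmxA s1 mul1mx.
- move=> p; rewrite closureEcvg => -[F FF [Fp HF]].
  have FG : \forall g \near F, G g by apply: HF => g [].
  have FC : \forall g \near F, sigma g *m C = C *m tau g by apply: HF => g [].
  have Gp : G p by apply: (closed_cvg G (cg_closed cG) FG p Fp).
  split => //.
  have h1 : (fun g => sigma g *m C) @ F --> sigma p *m C.
    by apply: cvg_mulmx; [exact: repr_cvg|exact: cvg_cst].
  have h2 : (fun g => C *m tau g) @ F --> C *m tau p.
    by apply: cvg_mulmx; [exact: cvg_cst|exact: repr_cvg].
  apply: (cvg_unique (@norm_hausdorff _ _) _ h2).
  apply: cvg_trans h1; apply: near_eq_cvg.
  by apply: filterS FC => g ->.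
Qed.

(* For the converse, the elements of G that C intertwines form a closed subgroup
   whose Lie algebra contains the generators X_d, hence that of G. *)
Theorem intertwines_drepr D (X : 'I_D -> 'M[R]_q) m n
    (sigma : 'M[R]_q -> 'M[K]_m) (tau : 'M[R]_q -> 'M[K]_n) (C : 'M[K]_(m, n)) :
  lie_generators G X -> continuous_repr G sigma -> continuous_repr G tau ->
  intertwines sigma tau C <->
  forall d, drepr sigma (X d) *m C = C *m drepr tau (X d).
Proof.
move=> [GX genX] rs rt; split=> [sC d|dC].
  have [s1 _] := repr_derivative rs (GX d).
  have [t1 _] := repr_derivative rt (GX d).
  have FF : ProperFilter ((0 : R)^') by exact: Proper_dnbhs_numFieldType.
  pose proof (cvg_mulmx s1 (@cvg_cst _ C _ _ _)) as h1.
  pose proof (cvg_mulmx (@cvg_cst _ C _ _ _) t1) as h2.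
  apply: (cvg_unique (@norm_hausdorff _ _) h1).
  rewrite (_ : (fun t => _) = (fun t : R => C *m ((of_real s t)^-1 *: (tau (expmx (t *: X d)) - 1%:M)))) //.
  apply/funext => t; rewrite -scalemxAl -scalemxAr; congr (_ *: _).
  by rewrite mulmxBl mulmxBr mul1mx mulmx1 sC //; apply: GX.
pose H := [set g | G g /\ sigma g *m C = C *m tau g].
have cH : closed_matrix_group H by exact: intertwines_subgroup.
have XH d : lie_algebra H (X d).
  move=> t; split; first exact: GX.
  apply: (@real_mx_inj R s); rewrite !real_mxM.
  have [_ ->] := repr_derivative rs (GX d).
  have [_ ->] := repr_derivative rt (GX d).
  by apply: intertwine_exp; rewrite -scalemxAl -scalemxAr -!real_mxM dC.
have lGH := genX _ (lie_algebra_subalgebra cH) XH.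
have HG : H `<=` G by move=> g [].
by rewrite /intertwines -(connected_group_eq hG cH HG lGH) => g [].
Qed.

End LieTheorem.

(** * Equivariant fixed points and complete reducibility *)

(** A matrix of maximal rank among those with rows in U spans U, since adjoining a vector of U
    cannot raise its rank. Predicates on vectors thus receive the matrix form in which
    irreducibility is stated. *)
Lemma subspace_rowspace (K : fieldType) n (U : set 'rV[K]_n) :
  subspace U -> exists M : 'M[K]_n, forall v, U v <-> (v <= M)%MS.
Proof.
move=> [U0 Ulin].
have UD u v : U u -> U v -> U (u + v) by move=> Uu Uv; rewrite -[u]scale1r; apply: Ulin.
have Usum m (M : 'M[K]_(m, n)) : (forall i, U (row i M)) -> forall v, (v <= M)%MS -> U v.
  move=> UM v /submxP[D ->]; rewrite mulmx_sum_row.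
  by elim/big_ind: _ => // i _; rewrite -[_ *: _]addr0; apply: Ulin.
pose P k := `[< exists M : 'M[K]_n, (forall i, U (row i M)) /\ \rank M = k >].
have exP : exists k, P k.
  by exists 0; apply/asboolP; exists 0; split=> [i|]; rewrite ?row0 ?mxrank0.
have ubP k : P k -> (k <= n)%N by move=> /asboolP[M [_ <-]]; apply: rank_leq_col.
case: (ex_maxnP exP ubP) => r /asboolP[M [UM Mr]] rmax.
exists M => v; split=> [Uv|]; last exact: Usum.
have UMv : P (\rank (M + v)%MS).
  apply/asboolP; exists (M + v)%MS; split=> // i.
  have : (row i (M + v)%MS <= M + v)%MS by exact: row_sub.
  move=> /sub_addsmxP[[a b] /= ->]; apply: UD; first exact: (Usum _ M) (submxMl _ _).
  rewrite (_ : b *m v = (b 0 0) *: v) ?[_ *: v]addr0.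
    by rewrite -[_ *: _]addr0; apply: Ulin.
  by rewrite [b]mx11_scalar mul_scalar_mx mxE eqxx mulr1n.
have := rmax _ UMv; rewrite -Mr => h.
apply: submx_trans (addsmxSr M v) _.
have := mxrank_leqif_sup (addsmxSl M v) => /leqifP; case: ifP => // _ /ltn_geF.
by rewrite h.
Qed.

Section FixedPoint.
Variables (R : realType) (s : scalar_kind) (q : nat).
Local Notation K := (scalars R s).

(** The coefficients a, -a, 1 add up to 1: one formula for stability under affine combinations. *)
Definition affine_closed m n (W : set 'M[K]_(m, n)) : Prop :=
  forall a u v w, W u -> W v -> W w -> W (a *: (u - v) + w).

(** Translated by one of its points, W becomes a subspace, hence the kernel of a matrix, and this
    condition passes to the limit. *)
Lemma affine_limit m n (W : set 'M[K]_(m, n)) (T : Type) (F : set_system T) {FF : ProperFilter F}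
    (f : T -> 'M[K]_(m, n)) (u : 'M[K]_(m, n)) :
  affine_closed W -> (\forall t \near F, W (f t)) -> f @ F --> u -> W u.
Proof.
move=> aW Wf fu.
have [t0 Wt0] := filter_ex Wf; set w := f t0 in Wt0.
pose U := [set v : 'rV[K]_(m * n) | W (vec_mx v + w)].
have sU : subspace U.
  split=> [|a x y Ux Uy]; rewrite /U /=; first by rewrite linear0 add0r.
  rewrite linearD linearZ /=.
  by have := aW a _ _ _ Ux Wt0 Uy; rewrite addrK addrA.
have [M UM] := subspace_rowspace sU.
have WM v : W v <-> mxvec (v - w) *m cokermx M = 0.
  rewrite (_ : W v <-> U (mxvec (v - w))); last by rewrite /U /= mxvecK subrK.
  by rewrite UM submxE; split=> /eqP.
apply/WM.
have h : (fun t => mxvec (f t - w) *m cokermx M) @ F --> mxvec (u - w) *m cokermx M.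
  apply: cvg_mulmx; last exact: cvg_cst.
  apply/mx_cvgP => i j; rewrite ord1; case/mxvec_indexP: j => i' j'.
  rewrite mxvecE !mxE; under eq_fun do rewrite mxvecE !mxE.
  by apply: cvgB; [have /mx_cvgP := fu; apply|exact: cvg_cst].
apply: (cvg_unique (@norm_hausdorff _ _) h).
apply: cvg_near_cst; apply: filterS Wf => t /WM ->; exact.
Qed.

(** The squared Frobenius norm. The sup norm would not satisfy the parallelogram law, on which the
    uniqueness of the minimiser rests. *)
Definition sqnorm m n (A : 'M[K]_(m, n)) : R :=
  \sum_i \sum_j (re_part (A i j) ^+ 2 + im_part (A i j) ^+ 2).

Lemma sqnorm_ge0 m n (A : 'M[K]_(m, n)) : 0 <= sqnorm A.
Proof. by do 2!apply: sumr_ge0 => ? _; rewrite addr_ge0 ?sqr_ge0. Qed.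

Lemma sqnorm_eq0 m n (A : 'M[K]_(m, n)) : sqnorm A = 0 -> A = 0.
Proof.
move=> A0; apply/matrixP => i j; rewrite mxE.
have pos i' j' : 0 <= re_part (A i' j') ^+ 2 + im_part (A i' j') ^+ 2.
  by rewrite addr_ge0 ?sqr_ge0.
have Ai : \sum_j (re_part (A i j) ^+ 2 + im_part (A i j) ^+ 2) = 0.
  by move: A0; rewrite /sqnorm => /psumr_eq0P; apply=> // i' _; apply: sumr_ge0.
have /eqP : re_part (A i j) ^+ 2 + im_part (A i j) ^+ 2 = 0.
  by move: Ai => /psumr_eq0P; apply.
rewrite paddr_eq0 ?sqr_ge0 // !sqrf_eq0 => /andP[/eqP r0 /eqP i0].
by apply: re_im_inj; rewrite ?r0 ?i0; case: (s).
Qed.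

Lemma sqnorm_parallelogram m n (A B : 'M[K]_(m, n)) :
  sqnorm (A - B) + sqnorm (A + B) = 2 * sqnorm A + 2 * sqnorm B.
Proof.
rewrite /sqnorm !mulr_sumr -!big_split /=; apply: eq_bigr => i _.
rewrite !mulr_sumr -!big_split /=; apply: eq_bigr => j _.
by rewrite !mxE re_partB im_partB re_partD im_partD; ring.
Qed.

Lemma sqnormZ m n (a : R) (A : 'M[K]_(m, n)) :
  sqnorm (of_real s a *: A) = a ^+ 2 * sqnorm A.
Proof.
rewrite /sqnorm !mulr_sumr; apply: eq_bigr => i _.
rewrite !mulr_sumr; apply: eq_bigr => j _.
by rewrite mxE re_partM im_partM re_part_of_real im_part_of_real; ring.
Qed.

Lemma sqnorm_cvg m n (T : Type) (F : set_system T) {FF : Filter F}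
    (f : T -> 'M[K]_(m, n)) (A : 'M[K]_(m, n)) :
  f @ F --> A -> (fun t => sqnorm (f t)) @ F --> sqnorm A.
Proof.
move=> /mx_cvgP fA; rewrite /sqnorm.
apply: (@cvg_sum_fin R R^o) => i _; apply: (@cvg_sum_fin R R^o) => j _.
have /scalar_cvgP[hr hi] := fA i j.
by rewrite !expr2; apply: cvgD; apply: cvgM.
Qed.

Lemma entry_real_mx_le m n (A : 'M[K]_(m, n)) i j :
  `|re_part (A i j)| <= `|real_mx A| /\ `|im_part (A i j)| <= `|real_mx A|.
Proof.
split.
  have := mx_entry_le (real_mx A) (lshift m i) (lshift n j).
  by rewrite block_mxEul mxE.
have := mx_entry_le (real_mx A) (rshift m i) (lshift n j).
by rewrite block_mxEdl mxE.
Qed.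

Lemma sqnorm_le m n (A : 'M[K]_(m, n)) :
  sqnorm A <= (m%:R * n%:R * 2) * `|real_mx A| ^+ 2.
Proof.
rewrite -!mulrA mulr_natl -[X in _ *+ X](card_ord m) -sumr_const; apply: ler_sum => i _.
rewrite mulr_natl -[X in _ *+ X](card_ord n) -sumr_const; apply: ler_sum => j _.
have [h1 h2] := entry_real_mx_le A i j.
rewrite mulrDl mul1r lerD // -[_ ^+ 2]real_normK ?num_real //;
  by rewrite lerXn2r // nnegrE.
Qed.

Lemma real_mx_norm_le m n (A : 'M[K]_(m, n)) : `|real_mx A| ^+ 2 <= sqnorm A.
Proof.
have term i j : re_part (A i j) ^+ 2 + im_part (A i j) ^+ 2 <= sqnorm A.
  rewrite /sqnorm (bigD1 i) //= (bigD1 j) //= -addrA lerDl addr_ge0 //.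
    by apply: sumr_ge0 => ? _; rewrite addr_ge0 ?sqr_ge0.
  by do 2!apply: sumr_ge0 => ? _; rewrite addr_ge0 ?sqr_ge0.
have tr i j : `|re_part (A i j)| <= Num.sqrt (sqnorm A).
  rewrite -sqrtr_sqr ler_wsqrtr //; apply: le_trans (term i j).
  by rewrite lerDl sqr_ge0.
have ti i j : `|im_part (A i j)| <= Num.sqrt (sqnorm A).
  rewrite -sqrtr_sqr ler_wsqrtr //; apply: le_trans (term i j).
  by rewrite lerDr sqr_ge0.
rewrite -[leRHS]sqr_sqrtr ?sqnorm_ge0 // lerXn2r ?nnegrE ?sqrtr_ge0 //.
apply: mx_norm_le => [|i j]; first exact: sqrtr_ge0.
rewrite -(splitK i) -(splitK j) /real_mx.
case: (fintype.split i) => i'; case: (fintype.split j) => j' /=.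
- by rewrite block_mxEul mxE.
- by rewrite block_mxEur !mxE normrN.
- by rewrite block_mxEdl mxE.
- by rewrite block_mxEdr mxE.
Qed.

Variable G : set 'M[R]_q.
Hypothesis hG : compact_connected_linear_lie_group G.

Lemma repr_bounded n (rho : 'M[R]_q -> 'M[K]_n) :
  continuous_repr G rho -> exists c : R, forall g, G g -> `|real_mx (rho g)| <= c.
Proof.
move=> rr.
have [||g _ gmax] := @compact_EVT_max _ R (fun g => `|real_mx (rho g)|) G _ (ll_compact hG).
- by exists 1%:M; apply: ll_1.
- apply/subspace_continuousP => g Gg.
  apply: cvg_norm; apply: real_mx_cvg; apply: (@repr_cvg _ _ _ G) => //.
    exact: withinT.
  exact: cvg_within.
by exists `|real_mx (rho g)| => h Gh; apply: gmax; exact: mem_set.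
Qed.
End FixedPoint.

Section EquivariantFixedPoint.
Variables (R : realType) (s : scalar_kind) (q : nat).
Local Notation K := (scalars R s).
Variable G : set 'M[R]_q.
Hypothesis hG : compact_connected_linear_lie_group G.
Variables (m n : nat) (sigma : 'M[R]_q -> 'M[K]_m) (tau : 'M[R]_q -> 'M[K]_n).
Hypotheses (rs : continuous_repr G sigma) (rt : continuous_repr G tau).

Let act g (u : 'M[K]_(m, n)) := sigma g *m u *m tau (invmx g).

Lemma repr_invK p (rho : 'M[R]_q -> 'M[K]_p) g : continuous_repr G rho -> G g ->
  rho g *m rho (invmx g) = 1%:M /\ rho (invmx g) *m rho g = 1%:M.
Proof.
move=> rr Gg; have u := ll_unit hG Gg; have Gi := ll_inv hG Gg.
by rewrite -!(cr_mul rr) // mulmxV // mulVmx // (cr_1 rr).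
Qed.

Let actM g h u : G g -> G h -> act g (act h u) = act (g *m h) u.
Proof.
move=> Gg Gh; rewrite /act (cr_mul rs) // -!mulmxA; congr (_ *m (_ *m (_ *m _))).
rewrite -(cr_mul rt); try exact: (ll_inv hG).
congr tau; have ug := ll_unit hG Gg; have uh := ll_unit hG Gh.
apply: (can_inj (mulKmx (_ : g *m h \in unitmx))); first by rewrite unitmx_mul ug.
rewrite mulmxV ?unitmx_mul ?ug // -mulmxA (mulmxA h).
by rewrite mulmxV // mul1mx mulmxV.
Qed.

Let actK g u : G g -> act (invmx g) (act g u) = u.
Proof.
move=> Gg; rewrite actM ?(ll_inv hG) //; last exact: (ll_inv hG).
by rewrite mulVmx ?(ll_unit hG) // /act invmx1 (cr_1 rs) (cr_1 rt) mul1mx mulmx1.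
Qed.

Let actB g u v : act g (u - v) = act g u - act g v.
Proof. by rewrite /act mulmxBr mulmxBl. Qed.
Let actD g u v : act g (u + v) = act g u + act g v.
Proof. by rewrite /act mulmxDr mulmxDl. Qed.
Let actZ g a u : act g (a *: u) = a *: act g u.
Proof. by rewrite /act -scalemxAr -scalemxAl. Qed.

Let act_bounded : exists c : R, forall g u, G g -> sqnorm (act g u) <= c * sqnorm u.
Proof.
have [c1 h1] := repr_bounded hG rs; have [c2 h2] := repr_bounded hG rt.
pose c := (n + n)%:R * ((m + m)%:R * c1) * c2.
exists ((m%:R * n%:R * 2) * c ^+ 2) => g u Gg.
apply: le_trans (sqnorm_le _) _; rewrite -[leRHS]mulrA ler_wpM2l ?mulr_ge0 //.
apply: (@le_trans _ _ (c ^+ 2 * `|real_mx u| ^+ 2)).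
  rewrite -exprMn lerXn2r ?nnegrE //.
    rewrite !mulr_ge0 //; [exact: le_trans (h1 g Gg)|exact: le_trans (h2 g Gg)].
  rewrite !real_mxM; apply: le_trans (mx_normM _ _) _.
  have -> : c * `|real_mx u| = ((n + n)%:R * ((m + m)%:R * c1 * `|real_mx u|)) * c2.
    by rewrite /c; ring.
  apply: ler_pM => //.
    rewrite ler_wpM2l //; apply: le_trans (mx_normM _ _) _.
    by rewrite ler_wpM2r // ler_wpM2l // h1.
  by apply: h2; apply: (ll_inv hG).
by rewrite ler_wpM2l ?sqr_ge0 // real_mx_norm_le.
Qed.

(* The fixed point minimises the sup over g in G of the squared Euclidean norm of
   sigma g *m u *m tau (invmx g); by the parallelogram law minimising sequences are
   Cauchy and the minimiser is unique. No invariant measure is needed. *)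
Theorem equivariant_fixed_point (W : set 'M[K]_(m, n)) :
  W !=set0 -> affine_closed W ->
  (forall g u, G g -> W u -> W (sigma g *m u *m tau (invmx g))) ->
  exists2 u, W u & intertwines G sigma tau u.
Proof.
move=> [w0 Ww0] aW stW.
have [c cP] := act_bounded.
pose B := [set b : R | exists2 u, W u & forall g, G g -> sqnorm (act g u) <= b].
have B0 : B !=set0 by exists (c * sqnorm w0); exists w0 => // g; apply: cP.
have Blb : lbound B 0.
  by move=> b [u Wu /(_ _ (ll_1 hG))]; apply: le_trans; apply: sqnorm_ge0.
have Binf : has_inf B by split => //; exists 0.
pose mu := inf B.
have almost (e : R) : 0 < e -> exists2 u, W u & forall g, G g -> sqnorm (act g u) <= mu + e.
  move=> e0; have [b [u Wu ub] be] := inf_adherent e0 Binf.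
  by exists u => // g Gg; apply: le_trans (ub g Gg) (ltW be).
(* By the parallelogram law for act g u and act g v, 4(mu + e) minus 4 times a quantity above mu - e
   leaves 8e; undoing act g costs the factor c. *)
have close (e : R) u v : 0 < e -> W u -> W v ->
    (forall g, G g -> sqnorm (act g u) <= mu + e) ->
    (forall g, G g -> sqnorm (act g v) <= mu + e) ->
    sqnorm (u - v) <= `|c| * (8 * e).
  move=> e0 Wu Wv ue ve.
  pose h : K := of_real s (2^-1).
  have hh : h + h = 1.
    apply: re_im_inj; rewrite ?re_partD ?im_partD ?re_part_of_real ?im_part_of_real.
      by rewrite [RHS](re_part_nat R s 1); lra.
    by rewrite addr0 [RHS](im_part_nat R s 1).
  pose mid := h *: (u - v) + v.
  have Wmid : W mid by apply: aW.
  have midE : mid = h *: (u + v).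
    rewrite /mid -{2}[v]scale1r -hh scalerDl !scalerDr scalerN -addrA; congr (_ + _).
    by rewrite addrA addNr add0r.
  (* Otherwise the midpoint would put mu - e into B, below its infimum. *)
  have [g Gg gmid] : exists2 g, G g & mu - e < sqnorm (act g mid).
    apply: contrapT => ne.
    have : mu <= mu - e.
      apply: ge_inf; first by exists 0.
      exists mid => // g Gg; rewrite leNgt; apply/negP => lt; apply: ne; by exists g.
    by rewrite lerBrDr gerDl leNgt e0.
  have par := sqnorm_parallelogram (act g u) (act g v).
  rewrite midE actZ sqnormZ actD in gmid.
  have du : sqnorm (act g (u - v)) <= 8 * e.
    rewrite actB; have := ue g Gg; have := ve g Gg.
    by rewrite exprVn in gmid; lra.
  rewrite -(actK (u - v) Gg); apply: le_trans (cP _ _ (ll_inv hG Gg)) _.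
  apply: (@le_trans _ _ (`|c| * sqnorm (act g (u - v)))).
    by rewrite ler_wpM2r ?sqnorm_ge0 // ler_norm.
  by rewrite ler_wpM2l.
have seq k : exists u, W u /\ forall g, G g -> sqnorm (act g u) <= mu + k.+1%:R^-1.
  by have [|u Wu ub] := almost k.+1%:R^-1; [rewrite invr_gt0|exists u].
have /choice [w wP] := seq.
(* A crude bound suffices: if x is the norm, x^2 <= mu + 1 and (x - 1)^2 >= 0 give 2x <= mu + 2. *)
have [|F [A [FF ooF FA]]] := @bounded_cluster R _ _ nat \oo _ (fun k => real_mx (w k)) (mu + 2).
  apply: nearW => k; have [_ /(_ _ (ll_1 hG))] := wP k.
  rewrite /act (cr_1 rs) invmx1 (cr_1 rt) mul1mx mulmx1 => h.
  have h1 : `|real_mx (w k)| ^+ 2 <= mu + 1.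
    apply: le_trans (real_mx_norm_le _) _; apply: le_trans h _.
    by rewrite lerD2l invf_le1 // ler1n.
  have := sqr_ge0 (`|real_mx (w k)| - 1); have := normr_ge0 (real_mx (w k)).
  by nra.
have [u wu uA] := real_mx_cvg_ex FA.
have Wu : W u by apply: (affine_limit aW _ wu); apply: nearW => k; have [] := wP k.
have h0 : (fun k => k.+1%:R^-1 : R) @ F --> (0 : R).
  by apply: cvg_trans (@cvg_harmonic R) => P /ooF.
have umin g : G g -> sqnorm (act g u) <= mu.
  move=> Gg; rewrite -[mu]addr0.
  have a1 : (fun k => act g (w k)) @ F --> act g u.
    by apply: cvg_mulmx; [apply: cvg_mulmx => //|]; exact: cvg_cst.
  pose proof (sqnorm_cvg a1) as a2.
  have a3 : (fun k => mu + k.+1%:R^-1) @ F --> mu + 0.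
    by apply: cvgD => //; exact: cvg_cst.
  rewrite leNgt; apply/negP; rewrite -subr_gt0 => lt.
  have a4 : (fun k => sqnorm (act g (w k)) - (mu + k.+1%:R^-1)) @ F --> sqnorm (act g u) - (mu + 0).
    exact: cvgB a2 a3.
  have a5 : \forall k \near F, 0 < sqnorm (act g (w k)) - (mu + k.+1%:R^-1).
    exact: (cvgr_gt _ a4 _ lt).
  have [k] := filter_ex a5.
  by rewrite subr_gt0 ltNge; have [_ ->] := wP k.
exists u => // g Gg.
suff e : act g u = u.
  by rewrite -{2}e /act -!mulmxA (repr_invK rt Gg).2 mulmx1.
apply/eqP; rewrite -subr_eq0; apply/eqP; apply: sqnorm_eq0; apply/eqP.
rewrite eq_le sqnorm_ge0 andbT; apply/ler_addgt0Pl => e e0; rewrite addr0.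
(* Both act g u and u are minimisers, so [close] bounds their squared distance by 8 |c| times this
   value, which is at most e; the summand 1 covers c = 0. *)
have e0' : 0 < e / (8 * (`|c| + 1)) by rewrite divr_gt0 // mulr_gt0 // ltr_wpDl.
apply: le_trans (close _ _ _ e0' _ Wu _ _) _.
- exact: stW.
- move=> h Gh; rewrite actM //; apply: le_trans (umin _ (ll_mul hG Gh Gg)) _.
  by rewrite lerDl ltW.
- by move=> h Gh; apply: le_trans (umin _ Gh) _; rewrite lerDl ltW.
rewrite mulrA mulrA ler_pdivrMr ?mulr_gt0 ?ltr_wpDl //.
by have := normr_ge0 c; nra.
Qed.
End EquivariantFixedPoint.

Section CompleteReducibility.
Variables (R : realType) (s : scalar_kind) (q : nat).
Local Notation K := (scalars R s).
Variable G : set 'M[R]_q.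
Hypothesis hG : compact_connected_linear_lie_group G.

Lemma intertwinesM m n p (a : 'M[R]_q -> 'M[K]_m) (b : 'M[R]_q -> 'M[K]_n)
    (c : 'M[R]_q -> 'M[K]_p) (A : 'M[K]_(m, n)) (B : 'M[K]_(n, p)) :
  intertwines G a b A -> intertwines G b c B -> intertwines G a c (A *m B).
Proof. by move=> hA hB g Gg; rewrite mulmxA hA // -mulmxA hB // mulmxA. Qed.

(** Full-rank factorisation: T is the inclusion of the image of E and S the projection onto it;
    cancelling the full-rank factors in E E = E gives S T = 1. *)
Lemma idempotent_factor (F : fieldType) n (E : 'M[F]_n) : E *m E = E ->
  exists (S : 'M[F]_(\rank E, n)) (T : 'M[F]_(n, \rank E)), T *m S = E /\ S *m T = 1%:M.
Proof.
move=> EE; exists (row_base E), (col_base E); split; first exact: mulmx_base.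
apply: (row_full_inj (col_base_full E)); apply: (row_free_inj (row_base_free E)).
by rewrite mulmx1 mulmx_base mulmxA mulmx_base -mulmxA mulmx_base EE.
Qed.

Lemma idempotent_rank_lt (F : fieldType) n (E : 'M[F]_n) : E *m E = E -> E != 1%:M ->
  (\rank E < n)%N.
Proof.
move=> EE; apply: contraR; rewrite -leqNgt => h.
have fE : row_full E by rewrite /row_full eqn_leq rank_leq_col.
by apply/eqP; apply: (row_full_inj fE); rewrite EE mulmx1.
Qed.

(** The projections onto the invariant subspace given by U form a nonempty affine set stable under
    conjugation by G; a fixed point is an equivariant projection, and no invariant inner product is
    required. *)
Lemma invariant_idempotent n (sigma : 'M[R]_q -> 'M[K]_n) (U : 'M[K]_n) :
  continuous_repr G sigma -> (forall g, G g -> stablemx U (sigma g)^T) ->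
  U != 0 -> ~~ row_full U ->
  exists E : 'M[K]_n, [/\ E *m E = E, E != 0, E != 1%:M & intertwines G sigma sigma E].
Proof.
move=> rs stU U0 Uf.
pose W := [set P : 'M[K]_n | P *m U^T = U^T /\ (P^T <= U)%MS].
have W0 : W !=set0.
  exists (pinvmx U *m U)^T; split; last by rewrite trmxK submxMl.
  by rewrite -trmx_mul mulmxA mulmxKpV.
have aW : affine_closed W.
  move=> a P Q P' [P1 P2] [Q1 Q2] [P1' P2']; split.
    by rewrite mulmxDl -scalemxAl mulmxBl P1 Q1 subrr scaler0 add0r.
  rewrite linearD linearZ linearB /=.
  by rewrite addmx_sub // scalemx_sub // addmx_sub // -scaleN1r scalemx_sub.
have stab g : G g -> exists D : 'M[K]_n, sigma g *m U^T = U^T *m D.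
  by move=> /stU /submxP[D hD]; exists D^T; rewrite -trmx_mul -hD trmx_mul trmxK.
have stW g P : G g -> W P -> W (sigma g *m P *m sigma (invmx g)).
  move=> Gg [P1 P2]; have Gi := ll_inv hG Gg; split.
    have [D hD] := stab _ Gi; rewrite -mulmxA hD -mulmxA [P *m _]mulmxA P1 -hD mulmxA.
    by rewrite (repr_invK hG rs Gg).1 mul1mx.
  rewrite !trmx_mul mulmxA; apply: submx_trans (submxMr _ _) (stU _ Gg).
  exact: submx_trans (submxMl _ _) P2.
have [E [E1 E2] cE] := equivariant_fixed_point hG rs rs W0 aW stW.
exists E; split => //.
- have /submxP[D hD] := E2.
  have EU : E = U^T *m D^T by rewrite -trmx_mul -hD trmxK.
  by rewrite [X in _ *m X]EU mulmxA E1 -EU.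
- by apply: contraNneq U0 => E0; rewrite -trmx_eq0 -E1 E0 mul0mx.
- apply: contraNneq Uf => E1'; rewrite -sub1mx; move: E2; by rewrite E1' trmx1.
Qed.

Lemma sub_repr n r (sigma : 'M[R]_q -> 'M[K]_n) (S : 'M[K]_(r, n)) (T : 'M[K]_(n, r)) :
  continuous_repr G sigma -> S *m T = 1%:M -> intertwines G sigma sigma (T *m S) ->
  [/\ continuous_repr G (fun g => S *m sigma g *m T),
      intertwines G (fun g => S *m sigma g *m T) sigma S &
      intertwines G sigma (fun g => S *m sigma g *m T) T].
Proof.
move=> rs ST cE; split.
- split.
  + by rewrite (cr_1 rs) mulmx1.
  + move=> g h Gg Gh; rewrite (cr_mul rs) //.
    rewrite -[RHS]mulmxA -[S *m sigma h *m T]mulmxA (mulmxA T) (mulmxA (T *m S)) -cE //.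
    by rewrite -!mulmxA ST mulmx1 !mulmxA.
  + apply/subspace_continuousP => g Gg.
    have h := (subspace_continuousP _ _).1 (cr_continuous rs) g Gg.
    by apply: cvg_mulmx; [apply: cvg_mulmx => //|]; exact: cvg_cst.
- by move=> g Gg; rewrite -!mulmxA cE // !mulmxA ST mul1mx.
- by move=> g Gg; rewrite !mulmxA -cE // -!mulmxA ST mulmx1.
Qed.

Variables (LL : Type) (dl : LL -> nat) (rho : forall l, 'M[R]_q -> 'M[K]_(dl l)).
Hypothesis hrho : complete_irreducible_reprs G rho.

(** Induction on n: an irreducible sigma is equivalent to some rho^L by completeness, and otherwise
    an equivariant idempotent E and 1 - E give two smaller representations. The outcome is kept as a
    resolution of the identity by intertwiners, the form in which functions are expanded later; in
    dimension 0 it is an empty sum. *)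
Theorem complete_reducibility n (sigma : 'M[R]_q -> 'M[K]_n) :
  continuous_repr G sigma ->
  exists (I : finType) (Lf : I -> LL) (S : forall i, 'M[K]_(dl (Lf i), n))
    (T : forall i, 'M[K]_(n, dl (Lf i))),
    [/\ forall i, intertwines G (rho (Lf i)) sigma (S i),
        forall i, intertwines G sigma (rho (Lf i)) (T i) &
        \sum_i T i *m S i = 1%:M].
Proof.
elim/ltn_ind: n => n IHn in sigma *; move=> rs.
have [n0|n0] := posnP n.
  exists void, (fun i : void => match i with end), (fun i : void => match i with end),
     (fun i : void => match i with end).
  by split=> [[]|[]|]; subst n; rewrite [LHS]flatmx0 [RHS]flatmx0.
have [irr|nirr] := pselect (irreducible_repr G sigma).
  have [L [P [Q [PQ QP h]]]] := ci_complete hrho rs irr.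
  exists unit, (fun=> L), (fun=> Q), (fun=> P); split=> [_|_|].
  - move=> g Gg; rewrite -[RHS]mulmx1 -PQ mulmxA -(mulmxA Q) h // mulmxA QP.
    by rewrite mul1mx.
  - exact: h.
  - by rewrite big_const card_unit /= addr0.
have [U [stU U0 Uf]] : exists U : 'M[K]_n,
    [/\ forall g, G g -> stablemx U (sigma g)^T, U != 0 & ~~ row_full U].
  apply: contrapT => ne; apply: nirr; split=> // U stU.
  have [->|U0] := eqVneq U 0; [by left|right].
  by apply: contrapT => /negP Uf; apply: ne; exists U.
have [E [EE E0 E1 cE]] := invariant_idempotent rs stU U0 Uf.
have FF : (1%:M - E) *m (1%:M - E) = 1%:M - E.
  by rewrite mulmxBr mulmx1 mulmxBl mul1mx EE subrr subr0.
have F1 : 1%:M - E != 1%:M.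
  by apply: contraNneq E0 => /eqP; rewrite subr_eq addrC -subr_eq subrr eq_sym.
have cF : intertwines G sigma sigma (1%:M - E).
  by move=> g Gg; rewrite mulmxBl mulmxBr mul1mx mulmx1 cE.
have [S1 [T1 [TS1 ST1]]] := idempotent_factor EE.
have [S2 [T2 [TS2 ST2]]] := idempotent_factor FF.
rewrite -TS1 in cE; rewrite -TS2 in cF.
have [r1 iS1 iT1] := sub_repr rs ST1 cE.
have [r2 iS2 iT2] := sub_repr rs ST2 cF.
have [I1 [L1 [S1' [T1' [hS1 hT1 sum1]]]]] := IHn _ (idempotent_rank_lt EE E1) _ r1.
have [I2 [L2 [S2' [T2' [hS2 hT2 sum2]]]]] := IHn _ (idempotent_rank_lt FF F1) _ r2.
pose Lf (i : I1 + I2) := match i with inl i => L1 i | inr i => L2 i end.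
exists (I1 + I2)%type, Lf,
  (fun i : I1 + I2 => match i return 'M[K]_(dl (Lf i), n) with
                      | inl i => S1' i *m S1 | inr i => S2' i *m S2 end),
  (fun i : I1 + I2 => match i return 'M[K]_(n, dl (Lf i)) with
                      | inl i => T1 *m T1' i | inr i => T2 *m T2' i end).
split.
- by case=> i; [apply: intertwinesM (hS1 i) iS1|apply: intertwinesM (hS2 i) iS2].
- by case=> i; [apply: intertwinesM iT1 (hT1 i)|apply: intertwinesM iT2 (hT2 i)].
- rewrite big_sumType /=.
  under eq_bigr do rewrite -mulmxA [_ *m (_ *m S1)]mulmxA.
  under [X in _ + X]eq_bigr do rewrite -mulmxA [_ *m (_ *m S2)]mulmxA.
  rewrite -!mulmx_sumr -!mulmx_suml sum1 sum2 !mul1mx TS1 TS2.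
  by rewrite addrC subrK.
Qed.
End CompleteReducibility.

(** * Monomials and the spanning property *)

Section Span.
Variables (K : pzRingType) (V : lmodType K).
Implicit Types (S W : set V).

Lemma subspaceD W u v : subspace W -> W u -> W v -> W (u + v).
Proof. by move=> [_ WP] Wu Wv; rewrite -[u]scale1r; apply: WP. Qed.

Lemma subspaceZ W a u : subspace W -> W u -> W (a *: u).
Proof. by move=> [W0 WP] Wu; rewrite -[_ *: _]addr0; apply: WP. Qed.

Lemma subspace_sum W (I : Type) (r : seq I) (P : pred I) (a : I -> K) (u : I -> V) :
  subspace W -> (forall i, P i -> W (u i)) -> W (\sum_(i <- r | P i) a i *: u i).
Proof.
move=> sW Wu; elim/big_ind: _ => [|x y|i Pi]; first by case: sW.
  exact: subspaceD.
by apply: subspaceZ => //; apply: Wu.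
Qed.

Lemma sub_lspan S : S `<=` lspan S.
Proof.
move=> v Sv; exists 1%N, (fun=> 1), (fun=> v); split=> //.
by rewrite big_ord1 scale1r.
Qed.

Lemma lspan_subspace S : subspace (lspan S).
Proof.
split; first by exists 0%N, (fun=> 0), (fun=> 0); split; [case|rewrite big_ord0].
move=> a _ _ [n [x [u [Su ->]]]] [m [y [v [Sv ->]]]].
exists (n + m)%N, (fun i => match fintype.split i with inl i => a * x i | inr i => y i end),
  (fun i => match fintype.split i with inl i => u i | inr i => v i end).
split=> [i|]; first by case: fintype.split.
rewrite big_split_ord /= scaler_sumr; congr (_ + _); apply: eq_bigr => i _.
  by rewrite -[lshift m i]/(unsplit (inl i)) unsplitK scalerA.
by rewrite -[rshift n i]/(unsplit (inr i)) unsplitK.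
Qed.

Lemma lspan_min S W : subspace W -> S `<=` W -> lspan S `<=` W.
Proof. by move=> sW SW _ [n [x [u [Su ->]]]]; apply: subspace_sum => // i _; apply: SW. Qed.

Lemma lspan_range_fin (I : finType) (f : I -> V) v :
  lspan (range f) v <-> exists a : I -> K, v = \sum_i a i *: f i.
Proof.
split=> [|[a ->]]; last first.
  by apply: subspace_sum => [|i _]; [exact: lspan_subspace|apply: sub_lspan; exists i].
move: v; apply: lspan_min => [|_ [i _ <-]].
  split; first by exists (fun=> 0); rewrite big1 // => i _; rewrite scale0r.
  move=> a _ _ [x ->] [y ->]; exists (fun i => a * x i + y i).
  by rewrite scaler_sumr -big_split; apply: eq_bigr => i _; rewrite scalerDl scalerA.
exists (fun j => (j == i)%:R); rewrite (bigD1 i) //= eqxx scale1r big1 ?addr0 //.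
by move=> j /negPf->; rewrite scale0r.
Qed.

Lemma lspan_lspan S W : S `<=` lspan W -> lspan S `<=` lspan W.
Proof. by apply: lspan_min; apply: lspan_subspace. Qed.
End Span.

Section FunctionProducts.
Variables (K : pzRingType) (X : Type) (A : comAlgType K).
Implicit Types (S T : set (X -> A)) (f g : X -> A).

Lemma fct_scaleAl (a : K) f g : (a *: f) * g = a *: (f * g).
Proof. by apply/funext => x; rewrite !fctE scalerAl. Qed.

Lemma fct_scaleAr (a : K) f g : f * (a *: g) = a *: (f * g).
Proof. by apply/funext => x; rewrite !fctE scalerAr. Qed.

Lemma lspanM S T f g : lspan S f -> lspan T g ->
  lspan [set h | exists f g, [/\ S f, T g & h = f * g]] (f * g).
Proof.
set Q := [set h | _] => Sf Tg.
have sQ : subspace (lspan Q) by exact: lspan_subspace.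
have {Sf} : forall b, T b -> lspan Q (f * b).
  move=> b Tb; move: f Sf; apply: lspan_min; last first.
    by move=> a Sa; apply: sub_lspan; exists a, b.
  split=> [|a u v Qu Qv]; first by rewrite /mkset mul0r; case: sQ.
  by rewrite /mkset mulrDl fct_scaleAl; case: sQ => _; apply.
move=> H; move: g Tg; apply: lspan_min => [|b Tb]; last exact: H.
split=> [|a u v Qu Qv]; first by rewrite /mkset mulr0; case: sQ.
by rewrite /mkset mulrDr fct_scaleAr; case: sQ => _; apply.
Qed.
End FunctionProducts.

Section Words.
Variables (R : realType) (s : scalar_kind) (q : nat).
Local Notation K := (scalars R s).
Variables (G : set 'M[R]_q) (Om : Type) (act : 'M[R]_q -> Om -> Om).
Variables (A : comAlgType K) (LL : choiceType) (dl : LL -> nat).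
Variable phi : forall l, 'I_(dl l) -> Om -> A.
Variable rho : forall l, 'M[R]_q -> 'M[K]_(dl l).
Variable N : nat.
Local Notation fn := (('I_N -> Om) -> A).

Definition letter : choiceType := {l : LL & 'I_(dl l)}.

(* A word of letters (l_i, m_i) encodes the monomial [\prod_i phibar^{l_i}_{m_i}];
   the index family of the paper is the list of first components of the letters. *)
Definition monomial (w : seq letter) : fn := \prod_(x <- w) phibar phi N (tagged x).

Definition monomials (ls : seq LL) : set fn :=
  [set f | exists2 w : seq letter, map tag w = ls & f = monomial w].

Lemma range_phibar_prod n (l : n.-tuple LL) :
  range (phibar_prod phi N l) = monomials l.
Proof.
apply/seteqP; split=> [_ [m _ <-]|_ [w wl ->]].
  exists [seq Tagged (fun l => 'I_(dl l)) (m i) | i <- enum 'I_n].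
    rewrite -map_comp -[RHS](map_tnth_enum l); exact: eq_map.
  rewrite /monomial big_map big_enum /=; apply/funext => r.
  by rewrite /phibar_prod fct_prodE.
have sw : size w = n by rewrite -(size_tuple l) -wl size_map.
have ex (i : 'I_n) : {m : 'I_(dl (tnth l i)) |
    Tagged (fun l => 'I_(dl l)) m = tnth (tcast sw (in_tuple w)) i}.
  have : tag (tnth (tcast sw (in_tuple w)) i) = tnth l i.
    rewrite -[LHS](tnth_map tag); apply: (congr1 (fun t => tnth t i)).
    by apply: val_inj => /=; rewrite -wl val_tcast.
  by case: (tnth _ i) => l' m /= e; case: _ / e; exists m.
exists (fun i => sval (ex i)) => //.
apply/funext => r; rewrite /phibar_prod /monomial fct_prodE.
rewrite [RHS](_ : _ = \prod_(x <- tcast sw (in_tuple w)) phibar phi N (tagged x) r).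
  rewrite big_tuple; apply: eq_bigr => i _.
  by case: (ex i) => m /= <-.
by rewrite val_tcast.
Qed.

Lemma Vbar_monomials n (l : n.-tuple LL) : Vbar phi N l = lspan (monomials l).
Proof. by rewrite /Vbar range_phibar_prod. Qed.

Lemma monomial_cat w1 w2 : monomial (w1 ++ w2) = monomial w1 * monomial w2.
Proof. by rewrite /monomial big_cat. Qed.

Lemma monomials_cat ls1 ls2 : monomials (ls1 ++ ls2) =
  [set h | exists f g, [/\ monomials ls1 f, monomials ls2 g & h = f * g]].
Proof.
apply/seteqP; split=> [_ [w wl ->]|_ [_ [_ [[w1 w1l ->] [w2 w2l ->] ->]]]].
  exists (monomial (take (size ls1) w)), (monomial (drop (size ls1) w)); split.
  - by exists (take (size ls1) w) => //; rewrite map_take wl take_size_cat.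
  - by exists (drop (size ls1) w) => //; rewrite map_drop wl drop_size_cat.
  - by rewrite -monomial_cat cat_take_drop.
by exists (w1 ++ w2); rewrite ?map_cat ?w1l ?w2l ?monomial_cat.
Qed.

Definition transforms n (f : 'I_n -> fn) (sigma : 'M[R]_q -> 'M[K]_n) : Prop :=
  forall g, G g -> forall i r, f i (diag_act act g r) = \sum_j sigma g i j *: f j r.

Definition tensor_family m n (f : 'I_m -> fn) (h : 'I_n -> fn) (i : 'I_(m * n)) : fn :=
  f (mxtens_unindex i).1 * h (mxtens_unindex i).2.

Definition tensor_repr m n (sigma : 'M[R]_q -> 'M[K]_m) (tau : 'M[R]_q -> 'M[K]_n) g :=
  tensmx (sigma g) (tau g).

Lemma sum_mxtens (V : nmodType) m n (F : 'I_(m * n) -> V) :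
  \sum_k F k = \sum_i \sum_j F (mxtens_index (i, j)).
Proof.
rewrite pair_big /=; apply: reindex; exists (@mxtens_unindex m n) => [[i j] _|k _].
  exact: mxtens_indexK.
by case: (mxtens_unindex k) (mxtens_unindexK k) => i j.
Qed.

Lemma tensor_transforms m n (f : 'I_m -> fn) (h : 'I_n -> fn)
    (sigma : 'M[R]_q -> 'M[K]_m) (tau : 'M[R]_q -> 'M[K]_n) :
  transforms f sigma -> transforms h tau ->
  transforms (tensor_family f h) (tensor_repr sigma tau).
Proof.
move=> ft ht g Gg k r; rewrite /tensor_family !mulrfctE ft // ht //.
rewrite sum_mxtens mulr_suml; apply: eq_bigr => i _.
rewrite mulr_sumr; apply: eq_bigr => j _.
by rewrite /tensor_repr mxE mxtens_indexK /= -scalerAl -scalerAr scalerA.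
Qed.

Lemma tensor_continuous m n (sigma : 'M[R]_q -> 'M[K]_m) (tau : 'M[R]_q -> 'M[K]_n) :
  continuous_repr G sigma -> continuous_repr G tau ->
  continuous_repr G (tensor_repr sigma tau).
Proof.
move=> rs rt; split.
- rewrite /tensor_repr (cr_1 rs) (cr_1 rt); apply/matrixP => i j; rewrite !mxE.
  rewrite -natrM mulnb; congr (_%:R); congr nat_of_bool.
  rewrite -(can_eq (@mxtens_unindexK m n)) -[RHS]/(_ == _).
  by case: (mxtens_unindex i) (mxtens_unindex j) => a b [c d].
- by move=> g h Gg Gh; rewrite /tensor_repr (cr_mul rs) // (cr_mul rt) // tensmx_mul.
- apply/subspace_continuousP => g Gg; apply/mx_cvgP => i j.
  rewrite /tensor_repr mxE; under eq_fun do rewrite mxE.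
  have hs := (subspace_continuousP _ _).1 (cr_continuous rs) g Gg.
  have ht := (subspace_continuousP _ _).1 (cr_continuous rt) g Gg.
  by apply: cvgM; [have /mx_cvgP := hs|have /mx_cvgP := ht]; apply.
Qed.

Hypothesis hphi : transforms_by G act phi rho.
Hypothesis hrho : forall l, continuous_repr G (rho l).

Lemma phibar_transforms l : transforms (fun m : 'I_(dl l) => phibar phi N m) (rho l).
Proof.
move=> g Gg m r; rewrite /phibar /diag_act.
under eq_bigr do rewrite (hphi _ _ Gg).
by rewrite exchange_big; apply: eq_bigr => j _; rewrite scaler_sumr.
Qed.

(** The representation is the tensor product of the rho^l over ls, starting from the constant 1 with
    the trivial representation. As f may be linearly dependent, sigma cannot be recovered from f and
    is carried along. *)
Lemma monomials_family ls : exists n (f : 'I_n -> fn) sigma,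
  [/\ continuous_repr G sigma, transforms f sigma & range f = monomials ls].
Proof.
elim: ls => [|l ls [n [f [sigma [rs ft fm]]]]].
  exists 1%N, (fun=> 1), (fun=> 1%:M); split.
  - split=> //; first by move=> g h _ _; rewrite mulmx1.
    by apply/subspace_continuousP => g _; apply: cvg_cst.
  - by move=> g Gg i r; rewrite big_ord1 mxE ord1 eqxx scale1r.
  - apply/seteqP; split=> [_ [_ _ <-]|_ [[]// _ ->]].
      by exists [::] => //; rewrite /monomial big_nil.
    by exists 0 => //; rewrite /monomial big_nil.
exists (dl l * n)%N, (tensor_family (fun m : 'I_(dl l) => phibar phi N m) f),
  (tensor_repr (rho l) sigma); split.
- exact: tensor_continuous.
- exact: tensor_transforms (@phibar_transforms l) ft.
- apply/seteqP; split=> [_ [i _ <-]|_ [[|[l' m] w]// [<- wl] ->]].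
    have : monomials ls (f (mxtens_unindex i).2) by rewrite -fm; exists (mxtens_unindex i).2.
    move=> [w wl fw]; exists (Tagged (fun l => 'I_(dl l)) (mxtens_unindex i).1 :: w).
      by rewrite /= wl.
    by rewrite /tensor_family fw /monomial big_cons.
  have [j _ fj] : range f (monomial w) by rewrite fm; exists w.
  exists (mxtens_index (m, j)) => //.
  by rewrite /tensor_family mxtens_indexK /= fj /monomial big_cons.
Qed.
End Words.

Arguments monomial {R s Om A LL dl} phi N w.
Arguments monomials {R s Om A LL dl} phi N ls.

(** * Coupling arrays as intertwiners *)

Section Coupling.
Variables (R : realType) (s : scalar_kind) (q : nat).
Local Notation K := (scalars R s).
Variable G : set 'M[R]_q.
Hypothesis hG : compact_connected_linear_lie_group G.
Variables (LL : choiceType) (dl : LL -> nat).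
Variable rho : forall l, 'M[R]_q -> 'M[K]_(dl l).

(** Leibniz rule: the difference quotient of a product of entries is (sigma - 1)/t times tau plus 1
    times (tau - 1)/t, and tau(exp(tX)) tends to 1. *)
Lemma drepr_tensor m n (sigma : 'M[R]_q -> 'M[K]_m) (tau : 'M[R]_q -> 'M[K]_n) X :
  continuous_repr G sigma -> continuous_repr G tau -> lie_algebra G X ->
  drepr (tensor_repr sigma tau) X =
  tensmx (drepr sigma X) 1%:M + tensmx 1%:M (drepr tau X).
Proof.
move=> rs rt GX.
have [ds _] := repr_derivative rs GX.
have [dt _] := repr_derivative rt GX.
have [dst _] := repr_derivative (tensor_continuous rs rt) GX.
have FF : ProperFilter ((0 : R)^') by exact: Proper_dnbhs_numFieldType.
apply: (cvg_unique (@norm_hausdorff _ _) dst).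
have t1 : (fun t : R => tau (expmx (t *: X))) @ (0 : R)^' --> (1%:M : 'M[K]_n).
  rewrite -(cr_1 rt); apply: (@repr_cvg _ _ _ G) => //.
  - by have := GX 0; rewrite scale0r expmx0.
  - exact: nearW.
  - rewrite -(expmx0 R q) -(scale0r X); apply: expmx_cvg.
    exact: cvg_within.
apply/mx_cvgP => i j.
pose u t := (of_real s t)^-1 *: (sigma (expmx (t *: X)) - 1%:M).
pose v t := (of_real s t)^-1 *: (tau (expmx (t *: X)) - 1%:M).
rewrite (_ : (fun t => _) = (fun t : R =>
   u t (mxtens_unindex i).1 (mxtens_unindex j).1 *
   tau (expmx (t *: X)) (mxtens_unindex i).2 (mxtens_unindex j).2 +
   (1%:M : 'M[K]_m) (mxtens_unindex i).1 (mxtens_unindex j).1 *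
   v t (mxtens_unindex i).2 (mxtens_unindex j).2)).
  rewrite [X in _ --> X]mxE [X in _ --> X + _]mxE [X in _ --> _ + X]mxE.
  apply: cvgD; apply: cvgM; last 1 first.
  - by have /mx_cvgP := dt; apply.
  - by have /mx_cvgP := ds; apply.
  - by have /mx_cvgP := t1; apply.
  - exact: cvg_cst.
apply/funext => t; rewrite /u /v /tensor_repr !mxE.
rewrite -[in LHS](can_eq (@mxtens_unindexK m n)).
case: (mxtens_unindex i) (mxtens_unindex j) => a b [a' b'] /=.
rewrite xpair_eqE -mulnb natrM; ring.
Qed.

(** With rows k and columns (k1, k2), equivariance of a coupling becomes the intertwining of rho^L
    with the tensor product. *)
Definition coupling_mx L1 L2 L (c : cidx dl L1 L2 L -> K^o) : 'M[K]_(dl L, dl L1 * dl L2) :=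
  \matrix_(k, i) c ((mxtens_unindex i).1, (mxtens_unindex i).2, k).

Variables (D : nat) (X : 'I_D -> 'M[R]_q).
Hypothesis hX : lie_generators G X.
Hypothesis hrho : forall l, continuous_repr G (rho l).

(** Write C for the matrix of c. Row ((k1, k2), k) of M applied to c is the entry at k, (k1, k2) of
    C times the derivative of the tensor product, minus the derivative of rho^L times C; the
    multiplication on the right explains the transposed indices k1', k1 and k2', k2 in M.
    [intertwines_drepr] passes from these derivatives to G. *)
Lemma ker_Mcoupling_intertwines L1 L2 L (c : cidx dl L1 L2 L -> K^o) :
  ker_Mcoupling rho X L1 L2 L c <->
  intertwines G (rho L) (tensor_repr (rho L1) (rho L2)) (coupling_mx c).
Proof.
rewrite (intertwines_drepr hG _ hX (hrho L) (tensor_continuous (hrho L1) (hrho L2))).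
have entry d k1 k2 k :
    \sum_col Mcoupling rho X (d, (k1, k2, k)) col * c col =
    (coupling_mx c *m drepr (tensor_repr (rho L1) (rho L2)) (X d)
     - drepr (rho L) (X d) *m coupling_mx c) k (mxtens_index (k1, k2)).
  rewrite (drepr_tensor (hrho L1) (hrho L2) (proj1 hX d)).
  rewrite 2![in RHS]mxE [X in _ = _ + X]mxE [X in _ = X - _]sum_mxtens.
  transitivity (\sum_(i : 'I_(dl L1) * 'I_(dl L2)) \sum_k'
    Mcoupling rho X (d, (k1, k2, k)) (i, k') * c (i, k')).
    by rewrite pair_bigA /=; apply: eq_bigr => -[].
  transitivity (\sum_k1' \sum_k2' \sum_k'
    Mcoupling rho X (d, (k1, k2, k)) (k1', k2', k') * c (k1', k2', k')).
    by rewrite [RHS]pair_bigA /=; apply: eq_bigr => -[].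
  have -> : (drepr (rho L) (X d) *m coupling_mx c) k (mxtens_index (k1, k2)) =
     \sum_k1' \sum_k2' (k1 == k1')%:R * (k2 == k2')%:R *
       \sum_k' drepr (rho L) (X d) k k' * c (k1', k2', k').
    rewrite mxE (bigD1 k1) //= (bigD1 k2) //= !eqxx !mul1r.
    rewrite [X in _ = _ + X + _]big1 ?addr0; last first.
      by move=> j; rewrite eq_sym => /negPf->; rewrite mulr0 mul0r.
    rewrite [X in _ = _ + X]big1 ?addr0; last first.
      by move=> i; rewrite eq_sym => /negPf->; rewrite big1 // => j _; rewrite !mul0r.
    by apply: eq_bigr => j _; rewrite [coupling_mx _ _ _]mxE mxtens_indexK.
  rewrite -sumrB; apply: eq_bigr => k1' _; rewrite -sumrB; apply: eq_bigr => k2' _.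
  rewrite /Mcoupling !mxE !mxtens_indexK /=.
  under eq_bigr do rewrite mulrBl.
  rewrite sumrB mulr_sumr; congr (_ - _); last by apply: eq_bigr => k' _; ring.
  rewrite (bigD1 k) //= big1 ?addr0; last first.
    by move=> k'; rewrite eq_sym => /negPf->; rewrite !mulr0 add0r mul0r.
  by rewrite eqxx [k1 == k1']eq_sym [k2 == k2']eq_sym !mulr1 mulrC.
split=> [kc d|hc [d [[k1 k2] k]]].
  apply/esym/eqP; rewrite -subr_eq0; apply/eqP/matrixP => k i.
  by case: (mxtens_indexP i) => k1 k2; rewrite -entry [RHS]mxE kc.
by rewrite entry hc subrr mxE.
Qed.
End Coupling.

(** * The coupled functions span *)

Section Spanning.
Variables (R : realType) (s : scalar_kind) (q : nat).
Local Notation K := (scalars R s).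
Variables (G : set 'M[R]_q) (Om : Type) (act : 'M[R]_q -> Om -> Om).
Hypothesis hG : compact_connected_linear_lie_group G.
Variables (A : comAlgType K) (LL : choiceType) (dl : LL -> nat) (N : nat).
Local Notation fn := (('I_N -> Om) -> A).
Variable phi : forall l, 'I_(dl l) -> Om -> A.
Variable rho : forall l, 'M[R]_q -> 'M[K]_(dl l).
Hypothesis hact : group_action G act.
Hypothesis hphi : transforms_by G act phi rho.
Hypothesis hrho : complete_irreducible_reprs G rho.

Definition comb m n (C : 'M[K]_(m, n)) (h : 'I_n -> fn) (k : 'I_m) : fn :=
  \sum_i C k i *: h i.

Lemma combM m n p (C : 'M[K]_(m, n)) (D : 'M[K]_(n, p)) (h : 'I_p -> fn) :
  comb (C *m D) h = comb C (comb D h).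
Proof.
apply/funext => k; rewrite /comb; under [RHS]eq_bigr do rewrite scaler_sumr.
rewrite exchange_big; apply: eq_bigr => i _; rewrite mxE scaler_suml.
by apply: eq_bigr => j _; rewrite scalerA.
Qed.

Lemma comb1 n (h : 'I_n -> fn) : comb 1%:M h = h.
Proof.
apply/funext => k; rewrite /comb (bigD1 k) //= mxE eqxx scale1r big1 ?addr0 //.
by move=> i; rewrite mxE eq_sym => /negPf->; rewrite scale0r.
Qed.

Lemma combE m n (C : 'M[K]_(m, n)) (h : 'I_n -> fn) k r :
  comb C h k r = \sum_i C k i *: h i r.
Proof. by rewrite /comb fct_sumE. Qed.

Lemma comb_suml (I : finType) m n (C : I -> 'M[K]_(m, n)) (h : 'I_n -> fn) k :
  comb (\sum_i C i) h k = \sum_i comb (C i) h k.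
Proof.
rewrite /comb exchange_big; apply: eq_bigr => j _.
by rewrite summxE scaler_suml.
Qed.

Lemma comb_act n (h : 'I_n -> fn) sigma : transforms G act h sigma ->
  forall g, G g -> forall i r, h i (diag_act act g r) = comb (sigma g) h i r.
Proof. by move=> hs g Gg i r; rewrite hs // combE. Qed.

Lemma comb_transforms m n (sigma : 'M[R]_q -> 'M[K]_m) (tau : 'M[R]_q -> 'M[K]_n)
    (C : 'M[K]_(m, n)) (h : 'I_n -> fn) :
  transforms G act h tau -> intertwines G sigma tau C -> transforms G act (comb C h) sigma.
Proof.
move=> ht sC g Gg k r; rewrite -combE -combM sC // combM !combE.
by apply: eq_bigr => i _; rewrite (comb_act ht).
Qed.

Lemma Vbar_equivP n (l : n.-tuple LL) L (F : 'I_(dl L) -> fn) :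
  Vbar_equiv G act phi rho N l L F <->
  (forall k, lspan (monomials phi N l) (F k)) /\ transforms G act F (rho L).
Proof.
rewrite /Vbar_equiv /= Vbar_monomials; split=> -[VF eF]; split=> // g Gg.
  by move=> i r; apply: eF.
by move=> r k; apply: eF.
Qed.

(* Averaging over G: an equivariant tuple in the span of a family that
   transforms by tau has an equivariant array of coefficients. *)
Lemma equivariant_coefficients m n (sigma : 'M[R]_q -> 'M[K]_m) (tau : 'M[R]_q -> 'M[K]_n)
    (F : 'I_m -> fn) (h : 'I_n -> fn) :
  continuous_repr G sigma -> continuous_repr G tau ->
  transforms G act F sigma -> transforms G act h tau ->
  (forall k, lspan (range h) (F k)) ->
  exists2 C : 'M[K]_(m, n), intertwines G sigma tau C & F = comb C h.
Proof.
move=> rs rt Fs ht Fh.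
(* An affine set of arrays, stable under the action of G because both F and h transform under G. *)
pose W := [set C : 'M[K]_(m, n) | comb C h = F].
have [|||C WC sC] := @equivariant_fixed_point R s q G hG m n sigma tau rs rt W.
- have /choice [a aP] : forall k, exists a : 'I_n -> K, F k = \sum_i a i *: h i.
    by move=> k; apply/lspan_range_fin.
  exists (\matrix_(k, i) a k i); apply/funext => k; rewrite aP.
  by apply: eq_bigr => i _; rewrite mxE.
- move=> a C1 C2 C3 h1 h2 h3; apply/funext => k; rewrite /comb.
  under eq_bigr do rewrite !mxE scalerDl -scalerA scalerBl.
  rewrite big_split /= -scaler_sumr sumrB.
  have e1 : \sum_i C1 k i *: h i = F k by rewrite -h1.
  have e2 : \sum_i C2 k i *: h i = F k by rewrite -h2.
  have e3 : \sum_i C3 k i *: h i = F k by rewrite -h3.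
  by rewrite e1 e2 e3 subrr scaler0 add0r.
- move=> g C Gg WC; have Gi := ll_inv hG Gg.
  apply/funext => k; apply/funext => r.
  pose r' := diag_act act (invmx g) r.
  have rr' : r = diag_act act g r'.
    apply/funext => i; rewrite /r' /diag_act -(proj2 hact) //.
    by rewrite mulmxV ?(ll_unit hG) // (proj1 hact).
  rewrite -mulmxA !combM {2}rr' (comb_act Fs) // -WC.
  rewrite !combE; apply: eq_bigr => k' _; congr (_ *: _).
  by rewrite !combE; apply: eq_bigr => i _; rewrite (comb_act ht).
by exists C.
Qed.

(** One member of [coupled], freed from the bases so that its trilinearity in c, u, v can be
    used. *)
Definition couple L1 L2 L (c : cidx dl L1 L2 L -> K^o) (u : 'I_(dl L1) -> fn)
    (v : 'I_(dl L2) -> fn) : 'I_(dl L) -> fn :=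
  fun k r => \sum_(k1 < dl L1) \sum_(k2 < dl L2) c (k1, k2, k) *: (u k1 r * v k2 r).

Lemma couple_comb L1 L2 L (c : cidx dl L1 L2 L -> K^o) u v :
  couple c u v = comb (coupling_mx c) (tensor_family u v).
Proof.
apply/funext => k; apply/funext => r; rewrite combE sum_mxtens /couple.
apply: eq_bigr => k1 _; apply: eq_bigr => k2 _.
by rewrite mxE mxtens_indexK /= /tensor_family mxtens_indexK.
Qed.

Lemma lspan_couple L1 L2 L (T1 T2 T3 : Type) (c : T3 -> cidx dl L1 L2 L -> K^o)
    (b1 : T1 -> 'I_(dl L1) -> fn) (b2 : T2 -> 'I_(dl L2) -> fn) W c0 u v :
  subspace W -> (forall j i1 i2, W (couple (c j) (b1 i1) (b2 i2))) ->
  lspan (range c) c0 -> lspan (range b1) u -> lspan (range b2) v -> W (couple c0 u v).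
Proof.
move=> sW Wb hc hu hv; have [W0 WD] := sW.
move: c0 hc; apply: lspan_min => [|_ [j _ <-]].
  split=> [|a x y Wx Wy]; rewrite /mkset.
    rewrite (_ : couple _ _ _ = 0) //; apply/funext => k; apply/funext => r.
    by rewrite /couple; rewrite big1 // => k1 _; rewrite big1 // => k2 _; rewrite scale0r.
  rewrite (_ : couple _ _ _ = a *: couple x u v + couple y u v); first exact: WD.
  apply/funext => k; apply/funext => r; rewrite !fctE /couple scaler_sumr -big_split.
  apply: eq_bigr => k1 _; rewrite scaler_sumr -big_split; apply: eq_bigr => k2 _ /=.
  by rewrite scalerA -scalerDl.
move: u hu; apply: lspan_min => [|_ [i1 _ <-]].
  split=> [|a x y Wx Wy]; rewrite /mkset.
    rewrite (_ : couple _ _ _ = 0) //; apply/funext => k; apply/funext => r.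
    by rewrite /couple; rewrite big1 // => k1 _; rewrite big1 // => k2 _; rewrite mul0r scaler0.
  rewrite (_ : couple _ _ _ = a *: couple (c j) x v + couple (c j) y v); first exact: WD.
  apply/funext => k; apply/funext => r; rewrite !fctE /couple scaler_sumr -big_split.
  apply: eq_bigr => k1 _; rewrite scaler_sumr -big_split; apply: eq_bigr => k2 _ /=.
  by rewrite mulrDl scalerDr -scalerAl !scalerA mulrC.
move: v hv; apply: lspan_min => [|_ [i2 _ <-]//].
split=> [|a x y Wx Wy]; rewrite /mkset.
  rewrite (_ : couple _ _ _ = 0) //; apply/funext => k; apply/funext => r.
  by rewrite /couple; rewrite big1 // => k1 _; rewrite big1 // => k2 _; rewrite mulr0 scaler0.
rewrite (_ : couple _ _ _ = a *: couple (c j) (b1 i1) x + couple (c j) (b1 i1) y); first exact: WD.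
apply/funext => k; apply/funext => r; rewrite !fctE /couple scaler_sumr -big_split.
apply: eq_bigr => k1 _; rewrite scaler_sumr -big_split; apply: eq_bigr => k2 _ /=.
by rewrite mulrDr scalerDr -scalerAr !scalerA mulrC.
Qed.

Lemma tensor_comb m1 m2 n1 n2 (C1 : 'M[K]_(m1, n1)) (C2 : 'M[K]_(m2, n2))
    (f : 'I_n1 -> fn) (h : 'I_n2 -> fn) :
  tensor_family (comb C1 f) (comb C2 h) = comb (tensmx C1 C2) (tensor_family f h).
Proof.
apply/funext => k; rewrite /tensor_family /comb sum_mxtens mulr_suml.
apply: eq_bigr => i _; rewrite mulr_sumr; apply: eq_bigr => j _.
by rewrite mxE mxtens_indexK /= fct_scaleAl fct_scaleAr scalerA.
Qed.

Variables (N1 N2 : nat) (l : N.-tuple LL) (l1 : N1.-tuple LL) (l2 : N2.-tuple LL).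
Hypothesis hl : l = l1 ++ l2 :> seq LL.
Variables (D : nat) (X : 'I_D -> 'M[R]_q).
Hypothesis hX : lie_generators G X.
Variable L : LL.

Lemma couple_Vbar_equiv L1 L2 (c : cidx dl L1 L2 L -> K^o) u v :
  ker_Mcoupling rho X L1 L2 L c ->
  Vbar_equiv G act phi rho N l1 L1 u -> Vbar_equiv G act phi rho N l2 L2 v ->
  Vbar_equiv G act phi rho N l L (couple c u v).
Proof.
move=> kc /Vbar_equivP[u1 u2] /Vbar_equivP[v1 v2]; apply/Vbar_equivP.
rewrite couple_comb; split=> [k|].
  apply: subspace_sum => [|i _]; first exact: lspan_subspace.
  by rewrite hl monomials_cat; apply: lspanM.
apply: comb_transforms (tensor_transforms u2 v2) _.
by apply/(ker_Mcoupling_intertwines hG hX (ci_repr hrho)).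
Qed.

Variables (n1 n2 : LL -> nat) (n12 : LL -> LL -> nat).
Variable b1 : forall L1, 'I_(n1 L1) -> 'I_(dl L1) -> fn.
Variable b2 : forall L2, 'I_(n2 L2) -> 'I_(dl L2) -> fn.
Variable c : forall L1 L2, 'I_(n12 L1 L2) -> cidx dl L1 L2 L -> K^o.
Hypothesis hb1 : forall L1, lspan (range (@b1 L1)) = Vbar_equiv G act phi rho N l1 L1.
Hypothesis hb2 : forall L2, lspan (range (@b2 L2)) = Vbar_equiv G act phi rho N l2 L2.
Hypothesis hc : forall L1 L2, lspan (range (@c L1 L2)) = ker_Mcoupling rho X L1 L2 L.

Lemma coupledE t : coupled b1 b2 c t =
  couple (c (tagged t).2) (b1 (tagged t).1.1) (b2 (tagged t).1.2).
Proof. by case: t => [[L1 L2] [[i1 i2] j]]. Qed.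

Lemma Vbar_equiv_subspace n (l' : n.-tuple LL) L' : subspace (Vbar_equiv G act phi rho N l' L').
Proof.
have [m0 mD] := lspan_subspace (monomials phi N l').
split=> [|a u v /Vbar_equivP[u1 u2] /Vbar_equivP[v1 v2]]; apply/Vbar_equivP.
  split=> [k //|g Gg i r]; rewrite big1 // => j _; exact: scaler0.
split=> [k|g Gg i r]; first exact: mD.
rewrite !fctE u2 // v2 // scaler_sumr -big_split; apply: eq_bigr => j _ /=.
by rewrite scalerDr !scalerA mulrC.
Qed.

Theorem lspan_coupled : lspan (range (coupled b1 b2 c)) = Vbar_equiv G act phi rho N l L.
Proof.
apply/seteqP; split.
  apply: lspan_min => [|_ [t _ <-]]; first exact: Vbar_equiv_subspace.
  rewrite coupledE; apply: couple_Vbar_equiv.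
  - by rewrite -hc; apply: sub_lspan; eexists.
  - by rewrite -hb1; apply: sub_lspan; eexists.
  - by rewrite -hb2; apply: sub_lspan; eexists.
move=> F /Vbar_equivP[F1 F2].
have [p1 [f [sig1 [r1 f1 fm1]]]] := monomials_family N hphi (ci_repr hrho) l1.
have [p2 [h [sig2 [r2 h2 hm2]]]] := monomials_family N hphi (ci_repr hrho) l2.
have [|C sC FC] := equivariant_coefficients (ci_repr hrho L) (tensor_continuous r1 r2)
  F2 (tensor_transforms f1 h2).
  move=> k; move: (F1 k); rewrite hl monomials_cat -fm1 -hm2.
  apply: lspan_min; first exact: lspan_subspace.
  move=> _ [_ [_ [[i _ <-] [j _ <-] ->]]]; apply: sub_lspan.
  by exists (mxtens_index (i, j)) => //; rewrite /tensor_family mxtens_indexK.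
have [I [Li [S1 [T1 [iS1 iT1 sum1]]]]] := complete_reducibility hG hrho r1.
have [J [Lj [S2 [T2 [iS2 iT2 sum2]]]]] := complete_reducibility hG hrho r2.
have Vu i : Vbar_equiv G act phi rho N l1 (Li i) (comb (S1 i) f).
  apply/Vbar_equivP; split; last exact: comb_transforms (iS1 i).
  move=> k; apply: subspace_sum => [|j _]; first exact: lspan_subspace.
  by apply: sub_lspan; rewrite -fm1; exists j.
have Vv i : Vbar_equiv G act phi rho N l2 (Lj i) (comb (S2 i) h).
  apply/Vbar_equivP; split; last exact: comb_transforms (iS2 i).
  move=> k; apply: subspace_sum => [|j _]; first exact: lspan_subspace.
  by apply: sub_lspan; rewrite -hm2; exists j.
(* The array coupling block i of the first factor with block j of the second; it is again an
   intertwiner, since C, T1 i and T2 j are. *)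
pose Cij i j := C *m tensmx (T1 i) (T2 j).
pose cij i j : cidx dl (Li i) (Lj j) L -> K^o := fun x => Cij i j x.2 (mxtens_index x.1).
have cmx i j : coupling_mx (cij i j) = Cij i j.
  by apply/matrixP => k x; rewrite mxE /cij -[in RHS](mxtens_unindexK x); case: (mxtens_unindex x).
(* Inserting the two resolutions of the identity into f and h splits F into couplings of blocks. *)
have FE : F = \sum_i \sum_j couple (cij i j) (comb (S1 i) f) (comb (S2 j) h).
  have fE x : f x = \sum_i comb (T1 i) (comb (S1 i) f) x.
    by rewrite -{1}[f]comb1 -sum1 comb_suml; apply: eq_bigr => i _; rewrite combM.
  have hE x : h x = \sum_i comb (T2 i) (comb (S2 i) h) x.
    by rewrite -{1}[h]comb1 -sum2 comb_suml; apply: eq_bigr => i _; rewrite combM.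
  have tE x : tensor_family f h x = \sum_i \sum_j comb (tensmx (T1 i) (T2 j))
      (tensor_family (comb (S1 i) f) (comb (S2 j) h)) x.
    rewrite /tensor_family fE hE mulr_suml; apply: eq_bigr => i _.
    by rewrite mulr_sumr; apply: eq_bigr => j _; rewrite -tensor_comb.
  rewrite FC; apply/funext => k; rewrite fct_sumE /comb.
  under eq_bigr do rewrite tE scaler_sumr.
  rewrite exchange_big; apply: eq_bigr => i _ /=.
  under eq_bigr do rewrite scaler_sumr.
  rewrite exchange_big [X in _ = X k]fct_sumE; apply: eq_bigr => j _ /=.
  by rewrite couple_comb cmx /Cij combM.
rewrite FE.
have sW := lspan_subspace (range (coupled b1 b2 c)).
elim/big_ind: _ => [|x y|i _]; [by case: sW|exact: subspaceD|].
elim/big_ind: _ => [|x y|j _]; [by case: sW|exact: subspaceD|].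
(* Each coupling of blocks has its array in ker M and its arguments in the equivariant spaces, so it
   expands in the three given families. *)
apply: (lspan_couple (c := @c (Li i) (Lj j)) (b1 := @b1 (Li i)) (b2 := @b2 (Lj j))) => //.
- move=> k i1 i2; apply: sub_lspan.
  by exists (existT _ (Li i, Lj j) (i1, i2, k)).
- rewrite hc; apply/(ker_Mcoupling_intertwines hG hX (ci_repr hrho)).
  rewrite cmx; apply: intertwinesM sC _.
  by move=> g Gg; rewrite /tensor_repr !tensmx_mul iT1 // iT2.
- by rewrite hb1.
- by rewrite hb2.
Qed.
End Spanning.

(** * Multiplication is injective on disjoint index families *)

Section Differences.
Variables (E A : zmodType).
Implicit Types f g : E -> A.

(* A substitute for being a polynomial function of degree at most n, when A is an
   arbitrary algebra: all differences of order n+1 vanish. *)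
Fixpoint pdeg (n : nat) (f : E -> A) : Prop :=
  match n with
  | 0 => forall y d, f (y + d) = f y
  | n.+1 => forall d, pdeg n (fun y => f (y + d) - f y)
  end.

Lemma eq_pdeg n f g : f =1 g -> pdeg n f -> pdeg n g.
Proof. by move/funext->. Qed.

Lemma pdeg0 n : pdeg n (fun=> 0).
Proof. by elim: n => //= n IHn d; apply: eq_pdeg IHn => y; rewrite subr0. Qed.

Lemma pdegD n f g : pdeg n f -> pdeg n g -> pdeg n (fun y => f y + g y).
Proof.
elim: n f g => [|n IHn] f g hf hg; first by move=> y d; rewrite hf hg.
by move=> d; apply: eq_pdeg (IHn _ _ (hf d) (hg d)) => y; rewrite opprD addrACA.
Qed.

Lemma pdeg_shift n f d : pdeg n f -> pdeg n (fun y => f (y + d)).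
Proof.
elim: n f => [|n IHn] f hf; first by move=> y e; rewrite !hf.
by move=> e; apply: eq_pdeg (IHn _ (hf e)) => y; rewrite addrAC.
Qed.

Lemma pdeg_additive n (h : A -> A) f :
  (forall a b, h (a - b) = h a - h b) -> pdeg n f -> pdeg n (fun y => h (f y)).
Proof.
move=> hB; elim: n f => [|n IHn] f hf; first by move=> y d; rewrite hf.
by move=> d; apply: eq_pdeg (IHn _ (hf d)) => y.
Qed.

Lemma pdeg_sum n (I : Type) (r : seq I) (f : I -> E -> A) :
  (forall i, pdeg n (f i)) -> pdeg n (fun y => \sum_(i <- r) f i y).
Proof.
move=> hf; elim: r => [|i r IHr].
  by apply: eq_pdeg (pdeg0 n) => y; rewrite big_nil.
by apply: eq_pdeg (pdegD (hf i) IHr) => y; rewrite big_cons.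
Qed.

(** Induction on n: the difference of f along one increment has degree one less and vanishes at sums
    of at most n - 1 increments, since these involve f at sums of at most n. Hence adding an
    increment never changes f, whose value at y0 is 0. *)
Lemma pdeg_vanish (I : Type) (delta : I -> E) n f y0 :
  pdeg n f ->
  (forall s : seq I, (size s <= n)%N -> f (y0 + \sum_(i <- s) delta i) = 0) ->
  forall s : seq I, f (y0 + \sum_(i <- s) delta i) = 0.
Proof.
elim: n f => [|n IHn] f hf f0 s.
  by rewrite hf; have := f0 [::] isT; rewrite big_nil addr0.
have step i s' : f (y0 + \sum_(j <- i :: s') delta j) = f (y0 + \sum_(j <- s') delta j).
  have e t : y0 + (delta i + t) = y0 + t + delta i by rewrite addrA addrAC.
  rewrite big_cons e; apply/eqP; rewrite -subr_eq0; apply/eqP.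
  apply: (IHn _ (hf (delta i))) => s'' ss.
  have := f0 (i :: s''); rewrite big_cons e => -> //.
  by rewrite f0 ?subr0 // leqW.
elim: s => [|i s IHs]; first exact: f0.
by rewrite step.
Qed.
End Differences.

Section Coordinates.
Variables (A : comPzRingType) (C : Type).

(** Discrete Leibniz rule: the difference of y_c f(y) along d is y_c times the difference of f, plus
    d_c f(y + d). *)
Lemma pdeg_coord n (c : C) (f : (C -> A) -> A) :
  pdeg n f -> pdeg n.+1 (fun y => y c * f y).
Proof.
elim: n f => [|n IHn] f hf d.
  move=> y e; rewrite !hf -!mulrBl; congr (_ * _).
  have t (u : C -> A) : (u + d) c - u c = d c by rewrite fctE addrC addKr.
  by rewrite !t.
have h1 := IHn _ (hf d).
have h2 : pdeg n.+1 (fun y => d c * f (y + d)).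
  by apply: pdeg_additive (pdeg_shift _ hf) => a b; rewrite mulrBr.
apply: eq_pdeg (pdegD h1 h2) => y; rewrite !fctE; ring.
Qed.

Lemma pdeg_monomial (w : seq C) : pdeg (size w) (fun y : C -> A => \prod_(c <- w) y c).
Proof.
elim: w => [|c w IHw]; first by move=> y d; rewrite !big_nil.
by apply: eq_pdeg (pdeg_coord c IHw) => y; rewrite big_cons.
Qed.
End Coordinates.

(** If x lies outside S, toggling x in J pairs the supersets of S with opposite signs. *)
Lemma sum_alternating_supersets (A : pzRingType) (T : finType) (S : {set T}) :
  \sum_(J : {set T} | S \subset J) (-1) ^+ #|~: J| = (S == [set: T]%SET)%:R :> A.
Proof.
case: eqVneq => [->|/eqP ST].
  rewrite (big_pred1 [set: T]%SET) ?finset.setCT ?cards0 // => J.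
  by rewrite finset.subTset.
have [x xS] : exists x, x \notin S.
  apply: contrapT => ne; apply: ST; apply/finset.setP => x; rewrite inE.
  by apply: contrapT => /negP xS; apply: ne; exists x.
rewrite (bigID (fun J : {set T} => x \in J)) /=.
rewrite (reindex_onto (fun J : {set T} => x |: J) (fun J => J :\ x)) /=; last first.
  by move=> J /andP[_ xJ]; rewrite finset.setD1K.
rewrite (eq_bigl (fun J : {set T} => (S \subset J) && (x \notin J))); last first.
  move=> J; rewrite finset.setU11 andbT; apply/andP/andP => -[h1 h2].
    have xJ : x \notin J by rewrite -(eqP h2) finset.setD11.
    split=> //; apply/fintype.subsetP => y yS; have := fintype.subsetP h1 y yS.
    by rewrite !inE => /orP[/eqP yx|//]; rewrite yx (negPf xS) in yS.
  by rewrite finset.setU1K // (fintype.subset_trans h1) ?finset.subsetUr.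
rewrite -big_split /= big1 // => J /andP[_ xJ].
have : #|~: J| = #|~: (x |: J)|.+1.
  apply/eqP; rewrite -(eqn_add2l #|J|) cardsC addnS -addSn -add1n.
  by rewrite -[1%N]/(true : nat) -xJ -cardsU1 cardsC.
by move=> ->; rewrite exprS mulN1r subrr.
Qed.

(** Ryser's formula for the permanent. Expanding the products gives maps with image inside J; by
    inclusion-exclusion only the surjective maps survive, and these are the permutations. *)
Lemma polarization (A : comPzRingType) n (x : 'I_n -> 'I_n -> A) :
  \sum_(J : {set 'I_n}) (-1) ^+ #|~: J| * \prod_i \sum_(j in J) x i j =
  \sum_(p : 'S_n) \prod_i x i (p i).
Proof.
transitivity (\sum_(J : {set 'I_n}) \sum_(f : {ffun 'I_n -> 'I_n} | [set f i | i : 'I_n]%SET \subset J)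
   (-1) ^+ #|~: J| * \prod_i x i (f i)).
  apply: eq_bigr => J _; rewrite bigA_distr_big big_distrr /=.
  apply: eq_bigl => f; apply/ffun_onP/fintype.subsetP => [h _ /imsetP[i _ ->]|h i].
    exact: h.
  by apply: h; apply: imset_f.
rewrite (exchange_big_dep xpredT) //=.
under eq_bigr => f _ do rewrite -mulr_suml sum_alternating_supersets.
rewrite (bigID (fun f : {ffun 'I_n -> 'I_n} => injectiveb f)) /=.
rewrite [X in _ + X]big1 ?addr0; last first.
  move=> f finj; rewrite (_ : (_ == _) = false) ?mul0r //.
  apply: contraNF finj => /eqP fT; apply/injectiveP.
  have : #|[set f i | i : 'I_n]%SET| == #|'I_n| by rewrite fT cardsT.
  by move=> /imset_injP h i j; apply: h.
rewrite (reindex (@pval 'I_n)) /=; last first.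
  exists (insubd (1%g : 'S_n)) => [p _|f finj].
    by apply: val_inj; rewrite val_insubd (valP p).
  by rewrite -[pval _]/(val _) val_insubd; rewrite inE in finj; rewrite finj.
apply: eq_big => [p|p _]; first exact: (valP p).
rewrite (_ : (_ == _) = true) ?mul1r; last first.
  apply/eqP/finset.setP => j; rewrite inE; apply/imsetP; exists ((p^-1)%g j) => //.
  by rewrite pvalE permKV.
by apply: eq_bigr => i _; rewrite pvalE.
Qed.

(** * Linear relations between monomials *)

Section MonomialIndependence.
Variables (R : realType) (s : scalar_kind).
Local Notation K := (scalars R s).
Variables (Om : Type) (A : comAlgType K) (LL : choiceType) (dl : LL -> nat).
Variable phi : forall l, 'I_(dl l) -> Om -> A.
Variables (H : set (Om -> A)) (dot : (Om -> A) -> (Om -> A) -> K).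
Variable Hn : forall n, set (('I_n -> Om) -> A).
Variable dotn : forall n, (('I_n -> Om) -> A) -> (('I_n -> Om) -> A) -> K.
Hypothesis hphiH : forall l m, H (@phi l m).
Hypothesis hortho : orthonormal_functions phi dot.
Hypothesis hdotn : induced_scalar_products H dot Hn dotn.
Local Notation letter := (letter dl).

Let psi (p : Om) (c : letter) : A := phi (tagged c) p.

Lemma dot_letters (c c' : letter) : dot (phi (tagged c)) (phi (tagged c')) = (c == c')%:R.
Proof.
case: c c' => [l m] [l' m'] /=; have [e|ne] := eqVneq l l'.
  case: _ / e m' => m'; rewrite (proj1 hortho) -tag_eqE /tag_eq /= eqxx /=.
  by rewrite tagged_asE.
rewrite (proj2 hortho); last exact/eqP.
by rewrite -tag_eqE /tag_eq /= (negPf ne).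
Qed.

Lemma natmul_eq0 (z : A) m : (0 < m)%N -> z *+ m = 0 -> z = 0.
Proof.
by move=> m0; rewrite -scaler_nat => /eqP; rewrite scaler_eq0 pnatr_eq0 eqn0Ngt m0 => /eqP.
Qed.

Variables (N : nat) (N0 : (0 < N)%N) (X : finType) (a : X -> K) (w : X -> N.-tuple letter).

(** The candidate relation as a polynomial with one variable per letter; at the sum of the vectors
    psi (r i) its value is the combination of monomials evaluated at r. *)
Let P (y : letter -> A) : A := \sum_x a x *: \prod_(c <- w x) y c.

Let P_pdeg : pdeg N P.
Proof.
rewrite /P; apply: pdeg_sum => x; apply: pdeg_additive => [u v|].
  exact: scalerBr.
by have := pdeg_monomial A (w x); rewrite size_tuple.
Qed.

Let P_natmul y k : P (y *+ k) = P y *+ (k ^ N).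
Proof.
rewrite /P -sumrMnl; apply: eq_bigr => x _; rewrite scalerMnr; congr (_ *: _).
transitivity (\prod_(c <- w x) y c *+ k ^ size (w x)); last by rewrite size_tuple.
elim: (tval (w x)) => [|c u IHu].
  by rewrite !big_nil.
by rewrite !big_cons IHu natmulfctE expnS mulrnAl mulrnAr -mulrnA mulnC.
Qed.

Hypothesis P0 : forall r : 'I_N -> Om, P (\sum_i psi (r i)) = 0.

Let P_seq (sq : seq Om) : size sq = N -> P (\sum_(p <- sq) psi p) = 0.
Proof.
move=> sN; pose t := Tuple (introT eqP sN).
by have := P0 (tnth t); rewrite -(big_tuple _ _ t xpredT psi).
Qed.

(** From the base point N psi(p0), adding at most N increments psi(p) - psi(p0) replaces copies of
    p0 by other points, so the argument is still a sum over exactly N points; [pdeg_vanish] then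
    lifts the limit on the number of increments. *)
Let P_orthant p0 (sq : seq Om) : P (psi p0 *+ N + \sum_(p <- sq) (psi p - psi p0)) = 0.
Proof.
apply: (pdeg_vanish (delta := fun p => psi p - psi p0) P_pdeg) => u uN.
rewrite sumrB big_const_seq count_predT -[iter _ _ _]/(iter (size u) (+%R (psi p0)) 0).
rewrite iter_addr_0 addrCA -mulrnBr // .
have -> : psi p0 *+ (N - size u) = \sum_(p <- nseq (N - size u) p0) psi p.
  by rewrite big_nseq iter_addr_0.
by rewrite -big_cat P_seq // size_cat size_nseq subnKC.
Qed.

(* The points j N psi(p0) + Q z with 1 <= j <= N+1 and Q = (N+1)! are multiples
   of lattice points treated by P_orthant, and there are enough of them to
   determine a polynomial of degree N in j. *)
Let P_all (sq : seq Om) : P (\sum_(p <- sq) psi p) = 0.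
Proof.
case: sq => [|p0 sq].
  (* Homogeneity of positive degree N, with the multiple 0. *)
  rewrite big_nil -(mulr0n 0) P_natmul exp0n // mulr0n //.
set t := p0 :: sq.
pose Q := (N.+1)`!.
have Q0 : (0 < Q)%N by exact: fact_gt0.
have flat (u : seq Om) m : \sum_(p <- flatten (nseq m u)) (psi p - psi p0) =
    (\sum_(p <- u) (psi p - psi p0)) *+ m.
  elim: m => [|m IHm]; first by rewrite big_nil mulr0n.
  by rewrite big_cat IHm mulrS.
have line u j : (0 < j <= N.+1)%N ->
    P ((psi p0 *+ N) *+ j + (\sum_(p <- u) (psi p - psi p0)) *+ Q) = 0.
  move=> /andP[j0 jN].
  have jQ : (j %| Q)%N by apply: dvdn_fact; rewrite j0.
  (* As j divides Q, the point is j times one treated by [P_orthant]. *)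
  rewrite -(divnK jQ) mulrnA -mulrnDl P_natmul -flat P_orthant mul0rn //.
have line' u j : (0 < j)%N ->
    P ((psi p0 *+ N) *+ j + (\sum_(p <- u) (psi p - psi p0)) *+ Q) = 0.
  case: j => // j _.
  (* Start at j = 1 with constant increment N psi(p0): at most N increments reach j = N + 1, where
     [line] still applies. *)
  have := pdeg_vanish (delta := fun=> psi p0 *+ N) P_pdeg
     (y0 := psi p0 *+ N + (\sum_(p <- u) (psi p - psi p0)) *+ Q) _ (nseq j tt).
  rewrite big_nseq iter_addr_0 addrAC -mulrS; apply => v vN.
  rewrite big_const_seq count_predT iter_addr_0 addrAC -mulrS.
  by apply: line; rewrite ltnS.
apply: (@natmul_eq0 _ ((Q * N) ^ N)%N).
  by rewrite expn_gt0 muln_gt0 Q0 N0.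
rewrite -P_natmul.
(* The factor Q N puts the sum over t on such a line: its copies of psi(p0) become Q |t| copies of N
   psi(p0). *)
have -> : (\sum_(p <- t) psi p) *+ (Q * N) = (psi p0 *+ N) *+ (Q * size t) +
   (\sum_(p <- flatten (nseq N t)) (psi p - psi p0)) *+ Q.
  rewrite flat -!mulrnA sumrB big_const_seq count_predT iter_addr_0 mulrnBl.
  rewrite -mulrnA [X in _ + (_ - X)](_ : _ = psi p0 *+ (N * (Q * size t))).
    by rewrite addrC [(N * Q)%N]mulnC subrK.
  by congr (_ *+ _); rewrite mulnC -mulnA mulnCA; congr muln; rewrite mulnC.
by apply: line'; rewrite muln_gt0 Q0.
Qed.

(** Polarisation involves sums over subsets of the N points, which [P_all] covers. Inverting the
    permutations moves them from the points to the letters. *)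
Let P_polarized (r : 'I_N -> Om) :
  \sum_x \sum_(p : 'S_N) a x *: \prod_i psi (r i) (tnth (w x) (p i)) = 0.
Proof.
have h (J : {set 'I_N}) : P (\sum_(j in J) psi (r j)) = 0.
  have := P_all [seq r j | j <- enum J]; rewrite big_map big_enum; exact.
transitivity (\sum_(J : {set 'I_N}) (-1) ^+ #|~: J| * P (\sum_(j in J) psi (r j))).
  rewrite /P; under [RHS]eq_bigr do rewrite mulr_sumr.
  rewrite [RHS]exchange_big; apply: eq_bigr => x _ /=.
  rewrite -scaler_sumr.
  under [RHS]eq_bigr do rewrite -scalerAr.
  rewrite -scaler_sumr; congr (_ *: _).
  pose x' i j := psi (r j) (tnth (w x) i).
  rewrite (reindex_inj invg_inj) /=.
  transitivity (\sum_(p : 'S_N) \prod_i x' i (p i)).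
    apply: eq_bigr => p _; rewrite (reindex_inj (@perm_inj _ p)) /=.
    by apply: eq_bigr => i _; rewrite permK.
  rewrite -polarization; apply: eq_bigr => J _; congr (_ * _).
  by rewrite big_tuple; apply: eq_bigr => i _; rewrite fct_sumE.
by rewrite big1 // => J _; rewrite h mulr0.
Qed.

(** Pairing the polarised relation with the tensor of w0 leaves, for each x, the number of
    permutations carrying w x to w0: zero off the class of w0, and the same positive number on all
    of it. *)
Theorem monomial_class_sum (w0 : N.-tuple letter) : \sum_(x | perm_eq (w x) w0) a x = 0.
Proof.
pose tens (v : 'I_N -> letter) : ('I_N -> Om) -> A := tensor (fun i => phi (tagged (v i))).
have [sp ht] := hdotn N.
have Htens v : Hn (tens v) by apply: (proj1 (ht _ _)) => i; apply: hphiH.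
have dott v v' : dotn (tens v) (tens v') = [forall i, v i == v' i]%:R.
  rewrite (proj2 (ht _ _)); [|by move=> i; apply: hphiH..].
  under eq_bigr do rewrite dot_letters.
  case: forallP => [h|nh].
    by rewrite big1 // => i _; rewrite h.
  have [i ni] : exists i, v i != v' i.
    by apply: contrapT => ne; apply: nh => i; apply: contrapT => /negP ni; apply: ne; exists i.
  by rewrite (bigD1 i) //= (negPf ni) mul0r.
have dotsum (I : Type) (rs : seq I) (b : I -> K) (v : I -> 'I_N -> letter) v0 :
    Hn (\sum_(i <- rs) b i *: tens (v i)) /\
    dotn (\sum_(i <- rs) b i *: tens (v i)) (tens v0) =
    \sum_(i <- rs) b i * [forall j, v i j == v0 j]%:R.
  have [Hs0 HsD] := sp_subspace sp.
  elim: rs => [|i rs [IH1 IH2]].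
    rewrite !big_nil; split=> //.
    have := sp_linear sp (-1) Hs0 Hs0 (Htens v0).
    by rewrite scaler0 addr0 mulN1r addNr.
  rewrite !big_cons; split; first exact: HsD.
  by rewrite (sp_linear sp) // dott IH2.
have rel : \sum_(xp : X * 'S_N) a xp.1 *: tens (fun i => tnth (w xp.1) (xp.2 i)) = 0.
  apply/funext => r; rewrite fct_sumE -[RHS](P_polarized r) [RHS]pair_bigA /=.
  by apply: eq_bigr => -[x p] _.
have [_] := dotsum _ (index_enum _) (fun xp : X * 'S_N => a xp.1)
  (fun xp i => tnth (w xp.1) (xp.2 i)) (tnth w0).
rewrite rel.
have [_] := dotsum void [::] (fun=> 0) (fun x _ => match x with end) (tnth w0).
rewrite !big_nil => -> /esym; rewrite -(pair_bigA _ (fun x (p : 'S_N) => a x * [forall j, tnth (w x) (p j) == tnth w0 j]%:R)) /=.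
pose cnt (v : N.-tuple letter) := \sum_(p : 'S_N) ([forall j, tnth v (p j) == tnth w0 j]%:R : K).
under eq_bigr do rewrite -mulr_sumr -/(cnt _).
have cnt0 (v : N.-tuple letter) : perm_eq v w0 = false -> cnt v = 0.
  move=> nv; rewrite /cnt big1 // => p _; case: forallP => // h; case/negP: (negbT nv).
  rewrite perm_sym; apply/tuple_permP; exists p.
  by congr tval; apply: eq_from_tnth => i; rewrite tnth_mktuple (eqP (h i)).
have cnt1 (v : N.-tuple letter) : perm_eq v w0 -> cnt v = cnt w0.
  move=> /tuple_permP[p vp]; rewrite /cnt (reindex_inj (mulIg p^-1%g)) /=.
  apply: eq_bigr => p' _; congr (_%:R); congr nat_of_bool; apply: eq_forallb => j.
  have -> : v = [tuple tnth w0 (p i) | i < N] by apply: val_inj.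
  by rewrite tnth_mktuple permM permKV.
rewrite (bigID (fun x => perm_eq (w x) w0)) /= [X in _ + X]big1 ?addr0; last first.
  by move=> x /negbTE nx; rewrite cnt0 ?mulr0.
under eq_bigr => x hx do rewrite cnt1 //.
rewrite -mulr_suml => /eqP; rewrite mulf_eq0 => /orP[/eqP //|].
rewrite /cnt -natr_sum pnatr_eq0 sum_nat_eq0 => /forallP/(_ 1%g).
by rewrite (_ : [forall j, _] = true) //; apply/forallP => j; rewrite perm1.
Qed.
End MonomialIndependence.

Section ProductInjectivity.
Variables (R : realType) (s : scalar_kind).
Local Notation K := (scalars R s).
Variables (Om : Type) (A : comAlgType K) (LL : choiceType) (dl : LL -> nat).
Variable phi : forall l, 'I_(dl l) -> Om -> A.
Local Notation letter := (letter dl).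

Lemma finite_words (ls : seq LL) : exists (X : finType) (w : X -> seq letter),
  (forall x, map tag (w x) = ls) /\ (forall u : seq letter, map tag u = ls -> exists x, w x = u).
Proof.
elim: ls => [|l ls [X [w [w1 w2]]]].
  by exists unit, (fun=> [::]); split=> // -[|//] _; exists tt.
exists ('I_(dl l) * X)%type, (fun x => Tagged (fun l => 'I_(dl l)) x.1 :: w x.2); split.
  by move=> x /=; rewrite w1.
move=> [|[l' m] u]//= [e]; case: _ / e m => m /w2[x <-].
by exists (m, x).
Qed.

Lemma monomial_perm N (u v : seq letter) : perm_eq u v -> monomial phi N u = monomial phi N v.
Proof. by move=> uv; apply: perm_big. Qed.

(** Each term is spread evenly over its class, whose members share one monomial; exchanging the sums
    brings out the class sums. *)
Lemma monomial_classes_eq0 N (X : finType) (w : X -> seq letter) (a : X -> K) :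
  (forall x0, \sum_(x | perm_eq (w x) (w x0)) a x = 0) ->
  \sum_x a x *: monomial phi N (w x) = 0.
Proof.
move=> h.
pose c x : K := (#|[pred y | perm_eq (w x) (w y)]|)%:R.
have c0 x : c x != 0.
  by rewrite pnatr_eq0 -lt0n; apply/card_gt0P; exists x; rewrite inE.
have cE x y : perm_eq (w x) (w y) -> c x = c y.
  by move=> xy; congr (_%:R); apply: eq_card => z; rewrite !inE (permPl xy).
transitivity (\sum_x \sum_(y | perm_eq (w x) (w y)) (a x / c y) *: monomial phi N (w y)).
  apply: eq_bigr => x _.
  under eq_bigr => y xy do rewrite -(cE _ _ xy) -(monomial_perm N xy).
  by rewrite sumr_const -scaler_nat scalerA mulrC divfK.
rewrite (exchange_big_dep xpredT) //= big1 // => y _.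
by rewrite -scaler_suml -mulr_suml h mul0r scale0r.
Qed.

(** Filtering the letters by whether their tags lie in ls1 recovers the two parts, and filtering
    respects permutation. *)
Lemma perm_cat_disjoint (ls1 ls2 : seq LL) (u u' v v' : seq letter) :
  (forall x, x \in ls1 -> x \notin ls2) ->
  map tag u = ls1 -> map tag u' = ls1 -> map tag v = ls2 -> map tag v' = ls2 ->
  perm_eq (u ++ v) (u' ++ v') = perm_eq u u' && perm_eq v v'.
Proof.
move=> dis ul ul' vl vl'; apply/idP/andP => [h|[h1 h2]]; last exact: perm_cat.
pose p (x : letter) := tag x \in ls1.
have pT (z : seq letter) : map tag z = ls1 -> seq.filter p z = z /\ seq.filter (predC p) z = [::].
  move=> zl; have al : all p z by apply/allP => x xz; rewrite /p -zl map_f.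
  split; first exact/all_filterP.
  by apply/eqP; rewrite -[_ == _]negbK -has_filter has_predC al.
have pF (z : seq letter) : map tag z = ls2 -> seq.filter p z = [::] /\ seq.filter (predC p) z = z.
  move=> zl; have al : all (predC p) z.
    apply/allP => x xz; rewrite /= /p; apply/negP => /dis.
    by rewrite -zl map_f.
  split; last exact/all_filterP.
  apply/eqP; rewrite -[_ == _]negbK -has_filter -all_predC //.
split.
  have := perm_filter p h; rewrite !filter_cat.
  by rewrite (pT _ ul).1 (pT _ ul').1 (pF _ vl).1 (pF _ vl').1 !cats0.
have := perm_filter (predC p) h; rewrite !filter_cat.
by rewrite (pT _ ul).2 (pT _ ul').2 (pF _ vl).2 (pF _ vl').2.
Qed.

Variables (H : set (Om -> A)) (dot : (Om -> A) -> (Om -> A) -> K).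
Variable Hn : forall n, set (('I_n -> Om) -> A).
Variable dotn : forall n, (('I_n -> Om) -> A) -> (('I_n -> Om) -> A) -> K.
Hypothesis hphiH : forall l m, H (@phi l m).
Hypothesis hortho : orthonormal_functions phi dot.
Hypothesis hdotn : induced_scalar_products H dot Hn dotn.

(** Let A_t(x0), B_t(y0) be the class sums of f_t, h_t. By disjointness those of the relation are
    the sums over t of A_t(x0) B_t(y0), so these vanish. For fixed x0, the combination of the h_t
    with coefficients A_t(x0) then has zero class sums, hence is 0, and independence of h gives
    A_t(x0) = 0. *)
Theorem product_injective N (ls1 ls2 : seq LL) n (f h : 'I_n -> ('I_N -> Om) -> A) :
  (0 < N)%N -> (size ls1 + size ls2)%N = N ->
  (forall x, x \in ls1 -> x \notin ls2) ->
  (forall t, lspan (monomials phi N ls1) (f t)) ->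
  (forall t, lspan (monomials phi N ls2) (h t)) ->
  lin_indep h -> \sum_t f t * h t = 0 -> forall t, f t = 0.
Proof.
move=> N0 szN dis fS hS hind rel.
have [X1 [w1 [w1l w1s]]] := finite_words ls1.
have [X2 [w2 [w2l w2s]]] := finite_words ls2.
have fam (ls : seq LL) (X : finType) (w : X -> seq letter) (g : 'I_n -> ('I_N -> Om) -> A) :
    (forall u : seq letter, map tag u = ls -> exists x, w x = u) ->
    (forall t, lspan (monomials phi N ls) (g t)) ->
    exists al : 'I_n -> X -> K, forall t, g t = \sum_x al t x *: monomial phi N (w x).
  move=> ws gS.
  suff /choice [al alP] : forall t, exists al : X -> K, g t = \sum_x al x *: monomial phi N (w x).
    by exists al.
  move=> t.
  apply/(lspan_range_fin (fun x => monomial phi N (w x))).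
  move: (gS t); apply: lspan_min; first exact: lspan_subspace.
  by move=> _ [u /ws[x <-] ->]; apply: sub_lspan; exists x.
have [al fE] := fam _ _ _ _ w1s fS; have [be hE] := fam _ _ _ _ w2s hS.
have sw x y : size (w1 x ++ w2 y) == N.
  by rewrite size_cat -(size_map tag) -(size_map tag (w2 y)) w1l w2l szN.
pose w (z : 'I_n * (X1 * X2)) : N.-tuple letter := Tuple (sw z.2.1 z.2.2).
pose a (z : 'I_n * (X1 * X2)) := al z.1 z.2.1 * be z.1 z.2.2.
have tri (V : nmodType) (F : 'I_n * (X1 * X2) -> V) :
    \sum_z F z = \sum_t \sum_x \sum_y F (t, (x, y)).
  transitivity (\sum_t \sum_xy F (t, xy)); first by rewrite pair_bigA; apply: eq_bigr => -[].
  by apply: eq_bigr => t _; rewrite pair_bigA; apply: eq_bigr => -[].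
have cls x0 y0 : \sum_t (\sum_(x | perm_eq (w1 x) (w1 x0)) al t x) *
                       (\sum_(y | perm_eq (w2 y) (w2 y0)) be t y) = 0.
  have P0 (r : 'I_N -> Om) :
      \sum_z a z *: \prod_(c <- w z) (\sum_i (fun c => phi (tagged c) (r i))) c = 0.
    have := congr1 (fun F => F r) rel; rewrite [X in X r = _]fct_sumE => rel'.
    rewrite -[RHS]rel' tri; apply: eq_bigr => t _.
    rewrite mulrfctE fE hE !fct_sumE mulr_suml; apply: eq_bigr => x _.
    rewrite mulr_sumr; apply: eq_bigr => y _.
    rewrite /a /= !fctE -scalerAl -scalerAr scalerA; congr (_ *: _).
    rewrite big_cat /= /monomial !fct_prodE.
    by congr (_ * _); apply: eq_bigr => c _; rewrite fct_sumE.
  have := monomial_class_sum hphiH hortho hdotn N0 P0 (Tuple (sw x0 y0)).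
  rewrite big_mkcond tri => E; rewrite -[RHS]E; apply: eq_bigr => t _.
  rewrite mulr_suml [LHS]big_mkcond; apply: eq_bigr => x _.
  rewrite mulr_sumr [in LHS]big_mkcond /=.
  case: ifP => hx; last first.
    by rewrite big1 // => y _; rewrite (perm_cat_disjoint dis (w1l _) (w1l _) (w2l _) (w2l _)) hx.
  by apply: eq_bigr => y _; rewrite (perm_cat_disjoint dis (w1l _) (w1l _) (w2l _) (w2l _)) hx.
have A0 x0 t : \sum_(x | perm_eq (w1 x) (w1 x0)) al t x = 0.
  apply: (hind n id _ (fun t => \sum_(x | perm_eq (w1 x) (w1 x0)) al t x)) => //.
  under eq_bigr => t' _ do rewrite hE scaler_sumr.
  rewrite exchange_big /=.
  under eq_bigr do under eq_bigr do rewrite scalerA.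
  under eq_bigr do rewrite -scaler_suml.
  apply: monomial_classes_eq0 => y0; rewrite exchange_big /= -[RHS](cls x0 y0).
  by apply: eq_bigr => t' _; rewrite mulr_sumr.
by move=> t; rewrite fE; apply: monomial_classes_eq0 => x0; apply: A0.
Qed.
End ProductInjectivity.

(** * Schur's lemma and independence of isotypic blocks *)

Section Schur.
Variables (R : realType) (s : scalar_kind) (q : nat).
Local Notation K := (scalars R s).
Variable G : set 'M[R]_q.

(** [irreducible_repr] tests subspaces stable under the transposes; passing to the annihilator of
    the row space gives the same dichotomy for stability under sigma itself. *)
Lemma irreducible_row_stable m n (sigma : 'M[R]_q -> 'M[K]_n) (M : 'M[K]_(m, n)) :
  irreducible_repr G sigma -> (forall g, G g -> stablemx M (sigma g)) ->
  M = 0 \/ row_full M.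
Proof.
move=> [_ irr] stM.
have [|K0|Kf] := irr (kermx M^T).
- move=> g /stM/submxP[D MD]; apply/sub_kermxP.
  by rewrite -mulmxA -trmx_mul MD trmx_mul mulmxA mulmx_ker mul0mx.
- right; rewrite /row_full -mxrank_tr.
  by apply/eqP; apply/eqP; rewrite -[_ == _]/(row_free M^T) -kermx_eq0 K0.
- left; apply: trmx_inj; apply: (row_full_inj Kf).
  by rewrite mulmx_ker trmx0 mulmx0.
Qed.

Lemma schur_complex n (sigma : 'M[R]_q -> 'M[R[i]]_n) (T : 'M[R[i]]_n) :
  irreducible_repr (s := ComplexScalars) G sigma ->
  (forall g, G g -> sigma g *m T = T *m sigma g) -> exists a, T = a%:M.
Proof.
move=> [n0 irr] hT.
have /(@closed_rootP R[i])[a ra] : size (char_poly T^T) != 1.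
  by rewrite size_char_poly; case: n n0 {sigma irr T hT}.
exists a; have : eigenvalue T^T a by rewrite eigenvalue_root_char.
rewrite /eigenvalue => E0.
have [|E0'|Ef] := irr (eigenspace T^T a).
- move=> g Gg; apply: comm_mx_stable_eigenspace.
  by rewrite /comm_mx -!trmx_mul hT.
- by rewrite E0' eqxx in E0.
- apply: trmx_inj; apply: (row_full_inj Ef).
  by rewrite tr_scalar_mx mul_mx_scalar; apply/eigenspaceP.
Qed.

(** Schur's lemma is applied after extension to complex scalars, where an eigenvalue exists. It
    comes from K, being the image of a diagonal entry of T. *)
Lemma schur_scalar n (sigma : 'M[R]_q -> 'M[K]_n) (T : 'M[K]_n) :
  absolutely_irreducible_repr G sigma -> intertwines G sigma sigma T ->
  exists a, T = a%:M.
Proof.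
move=> irr hT.
pose tc : K -> R[i] := @to_complex R s.
have tcD x y : tc (x + y) = tc x + tc y by rewrite /tc; case: s x y => //= x y; rewrite rmorphD.
have tcM x y : tc (x * y) = tc x * tc y by rewrite /tc; case: s x y => //= x y; rewrite rmorphM.
have tc0 : tc 0 = 0 by rewrite /tc; case: s.
have tcI : injective tc by rewrite /tc; case: s => //= x y [].
have tcmul m p k (A : 'M[K]_(m, p)) (B : 'M[K]_(p, k)) :
    map_mx tc (A *m B) = map_mx tc A *m map_mx tc B.
  apply/matrixP => i j; rewrite !mxE (big_morph tc tcD tc0).
  by apply: eq_bigr => l _; rewrite tcM !mxE.
have [|a Ta] := @schur_complex n (fun g => map_mx tc (sigma g)) (map_mx tc T) irr.
  by move=> g Gg; rewrite -!tcmul hT.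
case: irr => n0 _; pose i0 := Ordinal n0; exists (T i0 i0).
have Tij i j : tc (T i j) = a *+ (i == j) by move/matrixP: Ta => /(_ i j); rewrite !mxE.
apply/matrixP => i j; apply: tcI; rewrite Tij mxE; case: eqP => _; last by rewrite mulr0n tc0.
by rewrite mulr1n Tij eqxx.
Qed.

Variables (LL : Type) (dl : LL -> nat) (rho : forall l, 'M[R]_q -> 'M[K]_(dl l)).
Hypothesis hrho : complete_irreducible_reprs G rho.

(** The row space of C is stable under rho^l' and its column space under rho^l; if C is nonzero both
    are full, and the two one-sided inverses agree, giving an equivalence. *)
Lemma schur_zero l l' (C : 'M[K]_(dl l, dl l')) :
  l <> l' -> intertwines G (rho l) (rho l') C -> C = 0.
Proof.
move=> ll' hC.
have [|->//|Cf] := @irreducible_row_stable _ _ (rho l') C (ci_irr hrho l').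
  by move=> g Gg; rewrite -hC // submxMl.
have [] := proj2 (ci_irr hrho l) <<C^T>>%MS.
- move=> g Gg; rewrite (eqmxMr _ (genmxE _)) genmxE -trmx_mul hC // trmx_mul.
  exact: submxMl.
- by move=> /eqP; rewrite -mxrank_eq0 genmxE mxrank_eq0 trmx_eq0 => /eqP.
rewrite /row_full genmxE -[_ == _]/(row_full C^T) => /row_fullP[B BC].
have /row_fullP[B' B'C] := Cf.
case: (ci_inequiv hrho ll'); exists C, B'; split=> //.
have CB : C *m B^T = 1%:M by apply: trmx_inj; rewrite trmx_mul trmxK BC trmx1.
by rewrite -[B']mulmx1 -CB !mulmxA -[C *m B' *m C]mulmxA B'C mulmx1.
Qed.
End Schur.

Section LinIndep.
Variables (K : nzRingType) (V : lmodType K) (T : Type) (f : T -> V).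

Lemma lin_indep_fin (I : finType) (t : I -> T) (a : I -> K) :
  lin_indep f -> injective t -> \sum_i a i *: f (t i) = 0 -> forall i, a i = 0.
Proof.
move=> fi ti rel i; rewrite -(enum_rankK i).
apply: (fi _ (fun j => t (enum_val j)) _ (fun j => a (enum_val j))).
  by move=> j j' /ti/enum_val_inj.
by rewrite -(big_enum_val (A := predT) (fun i => a i *: f (t i))).
Qed.
End LinIndep.

Lemma lin_indep_notin_lspan (K : nzRingType) (V : lmodType K) (I : finType) (f : I -> V) i0 :
  lin_indep f -> ~ lspan (f @` [set~ i0]) (f i0).
Proof.
move=> fi h.
have [a a0 E] : [set v | exists2 a : I -> K, a i0 = 0 & v = \sum_i a i *: f i] (f i0).
  move: (f i0) h; apply: lspan_min.
    split=> [|x _ _ [a a0 ->] [b b0 ->]].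
      by exists (fun=> 0) => //; rewrite big1 // => i _; rewrite scale0r.
    exists (fun i => x * a i + b i); first by rewrite a0 b0 mulr0 addr0.
    by rewrite scaler_sumr -big_split; apply: eq_bigr => i _; rewrite scalerDl scalerA.
  move=> _ [i ii0 <-]; exists (fun j => (j == i)%:R).
    by case: eqP ii0 => [->|//]; case.
  rewrite (bigD1 i) //= eqxx scale1r big1 ?addr0 // => j /negPf->.
  by rewrite scale0r.
have : a i0 - 1 = 0.
  rewrite -(lin_indep_fin (t := id) (a := fun i => a i - (i == i0)%:R) fi _ _ i0) ?eqxx //.
  under eq_bigr do rewrite scalerBl.
  rewrite sumrB -E (bigD1 i0) //= eqxx scale1r big1 ?addr0 ?subrr // => j /negPf->.
  by rewrite scale0r.
by rewrite a0 sub0r => /eqP; rewrite oppr_eq0 oner_eq0.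
Qed.

Section BlockIndependence.
Variables (R : realType) (s : scalar_kind) (q : nat).
Local Notation K := (scalars R s).
Variables (G : set 'M[R]_q) (Om : Type) (act : 'M[R]_q -> Om -> Om).
Hypothesis hG : compact_connected_linear_lie_group G.
Variables (A : comAlgType K) (LL : choiceType) (dl : LL -> nat) (N : nat).
Local Notation fn := (('I_N -> Om) -> A).
Variable rho : forall l, 'M[R]_q -> 'M[K]_(dl l).
Hypothesis hact : group_action G act.
Hypothesis hrho : complete_irreducible_reprs G rho.

Section DirectSum.
Variables (I : finType) (Lf : I -> LL).
Let J : finType := {i : I & 'I_(dl (Lf i))}.

Let inj i : 'M[K]_(#|J|, dl (Lf i)) :=
  \matrix_(x, k) (enum_val x == Tagged (fun i => 'I_(dl (Lf i))) k)%:R.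
Let proj i : 'M[K]_(dl (Lf i), #|J|) := (inj i)^T.

Let projK i : proj i *m inj i = 1%:M.
Proof.
apply/matrixP => k k'; rewrite !mxE.
rewrite (bigD1 (enum_rank (Tagged (fun i => 'I_(dl (Lf i))) k))) //= big1 ?addr0.
  by rewrite !mxE enum_rankK eqxx mul1r -tag_eqE /tag_eq /= eqxx tagged_asE.
move=> x xk; rewrite !mxE (_ : _ == _ = false) ?mul0r //; apply/negbTE.
by apply: contraNneq xk => <-; rewrite enum_valK.
Qed.

Let proj_inj0 i i' : i != i' -> proj i *m inj i' = 0.
Proof.
move=> ii'; apply/matrixP => k k'; rewrite !mxE big1 // => x _; rewrite !mxE.
case: eqP => [->|]; last by rewrite mul0r.
by rewrite -tag_eqE /tag_eq /= (negPf ii') mulr0.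
Qed.

Let inj_proj : \sum_i inj i *m proj i = 1%:M.
Proof.
apply/matrixP => x y; rewrite summxE mxE.
have e i : (inj i *m proj i) x y = ((x == y) && (tag (enum_val x) == i))%:R.
  rewrite mxE; under eq_bigr do rewrite !mxE.
  case: (eqVneq (tag (enum_val x)) i) => [<-|xi]; last first.
    rewrite andbF big1 // => k _.
    by rewrite -tag_eqE /tag_eq /= (negPf xi) mul0r.
  rewrite andbT (bigD1 (tagged (enum_val x))) //= big1 ?addr0 => [|k kx].
    rewrite taggedK eqxx mul1r; congr (_%:R).
    by rewrite (can_eq enum_valK) eq_sym.
  rewrite -tag_eqE /tag_eq /= eqxx /= tagged_asE eq_sym (negPf kx) mul0r //.
under eq_bigr do rewrite e.
rewrite (bigD1 (tag (enum_val x))) //= eqxx andbT big1 ?addr0 // => i.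
by rewrite eq_sym => /negPf->; rewrite andbF.
Qed.

Let sum_repr g : 'M[K]_#|J| := \sum_i inj i *m rho (Lf i) g *m proj i.

Let sum_repr_inj i g : sum_repr g *m inj i = inj i *m rho (Lf i) g.
Proof.
rewrite /sum_repr mulmx_suml (bigD1 i) //= big1 ?addr0 => [|i' ii'].
  by rewrite -!mulmxA projK mulmx1.
by rewrite -!mulmxA proj_inj0 ?mulmx0.
Qed.

Let sum_repr_continuous : continuous_repr G sum_repr.
Proof.
split.
- by rewrite -inj_proj; apply: eq_bigr => i _; rewrite (cr_1 (ci_repr hrho _)) mulmx1.
- move=> g h Gg Gh; rewrite {3}/sum_repr mulmx_sumr; apply: eq_bigr => i _.
  by rewrite (cr_mul (ci_repr hrho _)) // !mulmxA sum_repr_inj.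
- apply/subspace_continuousP => g Gg.
  apply: cvg_big => [|i _]; first exact: add_continuous.
  have h := (subspace_continuousP _ _).1 (cr_continuous (ci_repr hrho (Lf i))) g Gg.
  by apply: cvg_mulmx; [apply: cvg_mulmx => //|]; exact: cvg_cst.
Qed.

(** The blocks are strung together into one family transforming by the direct sum of the rho^(Lf i);
    the array from [equivariant_coefficients] is then cut into its columns by block. *)
Lemma equivariant_span (F : forall i, 'I_(dl (Lf i)) -> fn) m
    (sigma : 'M[R]_q -> 'M[K]_m) (u : 'I_m -> fn) :
  continuous_repr G sigma ->
  (forall i, transforms G act (F i) (rho (Lf i))) -> transforms G act u sigma ->
  (forall k, lspan [set f | exists i k', f = F i k'] (u k)) ->
  exists2 C : forall i, 'M[K]_(m, dl (Lf i)),
    forall i, intertwines G sigma (rho (Lf i)) (C i) &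
    forall k, u k = \sum_i comb (C i) (F i) k.
Proof.
move=> rs hF hu uF.
pose h (x : 'I_#|J|) := F (tag (enum_val x)) (tagged (enum_val x)).
have projF i : comb (proj i) h = F i.
  apply/funext => k; rewrite /comb.
  rewrite (bigD1 (enum_rank (Tagged (fun i => 'I_(dl (Lf i))) k))) //= big1 ?addr0.
    by rewrite !mxE /h enum_rankK eqxx scale1r.
  move=> x xk; rewrite !mxE (_ : _ == _ = false) ?scale0r //; apply/negbTE.
  by apply: contraNneq xk => <-; rewrite enum_valK.
have hE x : h x = \sum_i comb (inj i) (F i) x.
  rewrite -{1}[h]comb1 -inj_proj comb_suml; apply: eq_bigr => i _.
  by rewrite combM projF.
have ht : transforms G act h sum_repr.
  move=> g Gg x r; rewrite hE [X in X _ = _]fct_sumE.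
  under [RHS]eq_bigr do rewrite hE [X in _ *: X _]fct_sumE scaler_sumr.
  rewrite exchange_big; apply: eq_bigr => i _.
  suff : transforms G act (comb (inj i) (F i)) sum_repr by apply.
  by apply: comb_transforms (hF i) _ => g' _; apply: sum_repr_inj.
have [|C sC ->] := equivariant_coefficients hG hact rs sum_repr_continuous hu ht.
  move=> k; move: (uF k); apply: lspan_lspan => _ [i [k' ->]].
  apply: sub_lspan; exists (enum_rank (Tagged (fun i => 'I_(dl (Lf i))) k')) => //.
  by rewrite /h enum_rankK.
exists (fun i => C *m inj i) => [i|k].
  by apply: intertwinesM sC _ => g _; apply: sum_repr_inj.
rewrite -[C in LHS]mulmx1 -inj_proj mulmx_sumr comb_suml; apply: eq_bigr => i _.
by rewrite mulmxA combM projF.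
Qed.
End DirectSum.

Hypothesis habs : forall l, absolutely_irreducible_repr G (rho l).
Variables (n : LL -> nat) (b : forall L, 'I_(n L) -> 'I_(dl L) -> fn).
Hypothesis hb : forall L i, transforms G act (@b L i) (rho L).
Hypothesis bi : forall L, lin_indep (@b L).

(** By Schur's lemma, a block with another L contributes 0 and one with the same L a scalar multiple
    of a basis tuple other than i0. *)
Lemma comb_other_block L0 (i0 : 'I_(n L0)) (p : {L & 'I_(n L)}) (C : 'M[K]_(dl L0, dl (tag p))) :
  p != Tagged (fun L => 'I_(n L)) i0 -> intertwines G (rho L0) (rho (tag p)) C ->
  lspan (@b L0 @` [set~ i0]) (comb C (b (tagged p))).
Proof.
have sW := lspan_subspace (@b L0 @` [set~ i0]).
case: p C => L i /=; have [e|ne] := eqVneq L L0; last first.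
  move=> C _ /(schur_zero hrho) ->; last by move=> e; rewrite e eqxx in ne.
  rewrite (_ : comb _ _ = 0); first by case: sW.
  by apply/funext => k; rewrite /comb big1 // => j _; rewrite mxE scale0r.
subst L0 => C; rewrite -tag_eqE /tag_eq /= eqxx tagged_asE /= => ii0.
move=> /(schur_scalar (habs L))[a ->].
rewrite (_ : comb _ _ = a *: b i).
  by apply: subspaceZ => //; apply: sub_lspan; exists i => //; apply/eqP.
apply/funext => k; rewrite /comb (bigD1 k) //= mxE eqxx mulr1n big1 ?addr0 //.
by move=> j; rewrite mxE eq_sym => /negPf->; rewrite mulr0n scale0r.
Qed.

Definition block_family (p : {p : {L & 'I_(n L)} & 'I_(dl (tag p))}) : fn :=
  b (tagged (tag p)) (tagged p).

(* The coefficient rows of one block in all relations form a row space stable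
   under rho. If it is nonzero, irreducibility puts the whole block in the span of
   the others, and by Schur's lemma in the span of those with the same L. *)
Theorem block_family_lin_indep : lin_indep block_family.
Proof.
move=> m t tinj a rel i; apply: contrapT => ai0.
pose p0 := tag (t i); pose L0 := tag p0.
pose S : set fn := [set f | exists j k', tag (t j) != p0 /\ f = b (tagged (tag (t j))) k'].
have sS := lspan_subspace S.
pose sumb (v : 'rV[K]_(dl L0)) : fn := \sum_k v 0 k *: b (tagged p0) k.
pose U := [set v : 'rV[K]_(dl L0) | lspan S (sumb v)].
have sU : subspace U.
  rewrite /U /sumb; split=> [|x u v Uu Uv].
    rewrite /mkset big1; first by case: sS.
    by move=> k _; rewrite mxE scale0r.
  rewrite /mkset (_ : \sum_k _ = x *: sumb u + sumb v); first by case: sS => _; apply.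
  rewrite scaler_sumr -big_split; apply: eq_bigr => k _.
  by rewrite !mxE scalerDl scalerA.
have [M UM] := subspace_rowspace sU.
have stS g f : G g -> lspan S f -> lspan S (fun r => f (diag_act act g r)).
  move=> Gg; move: f; apply: lspan_min.
    by split=> [|x u v Su Sv]; [case: sS|case: sS => _; apply].
  move=> _ [j [k [jp ->]]].
  rewrite /mkset (_ : (fun r => _) =
    \sum_k' rho (tag (tag (t j))) g k k' *: b (tagged (tag (t j))) k').
    by apply: subspace_sum => // k' _; apply: sub_lspan; exists j, k'.
  by apply/funext => r; rewrite hb // fct_sumE.
have stM g : G g -> stablemx M (rho L0 g).
  move=> Gg; apply/row_subP => j; rewrite row_mul.
  have /UM/(stS _ _ Gg) := row_sub j M.
  set v := row j M; rewrite -UM /U /mkset; congr (lspan S); apply/funext => r.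
  rewrite /sumb !fct_sumE.
  under eq_bigr do rewrite fctE hb // scaler_sumr.
  rewrite exchange_big; apply: eq_bigr => k _; rewrite fctE mxE scaler_suml.
  by apply: eq_bigr => k' _; rewrite scalerA.
(* If M = 0, the coefficients of block p0 in the given relation form a row of U, hence vanish,
   against a i <> 0. Otherwise every component of block p0 lies in the span of the others. *)
have [M0|Mf] := irreducible_row_stable (ci_irr hrho L0) stM.
  pose v : 'rV[K]_(dl L0) :=
    \row_k \sum_(j | t j == Tagged (fun p => 'I_(dl (tag p))) k) a j.
  have : U v.
    rewrite /U /mkset (_ : sumb v = \sum_(j | tag (t j) == p0) a j *: block_family (t j)).
      have : \sum_(j | tag (t j) == p0) a j *: block_family (t j) =
         \sum_(j | tag (t j) != p0) (- a j) *: block_family (t j).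
        apply/eqP; rewrite -subr_eq0 -sumrN; under [X in _ + X]eq_bigr do rewrite scaleNr opprK.
        by apply/eqP; rewrite -[RHS]rel [RHS](bigID (fun j => tag (t j) == p0)).
      move=> ->; apply: subspace_sum => // j jp; apply: sub_lspan.
      by exists j, (tagged (t j)).
    rewrite /sumb; under eq_bigr do rewrite mxE scaler_suml.
    rewrite (exchange_big_dep (fun j => tag (t j) == p0)) //=; last first.
      by move=> k j _ /eqP->.
    apply: eq_bigr => j; rewrite /block_family; case: (t j) => p k /= /eqP pp0.
    subst p; rewrite (big_pred1 k) // => k'.
    by rewrite -tag_eqE /tag_eq /= eqxx tagged_asE eq_sym.
  rewrite UM M0 submx0 => /eqP/rowP/(_ (tagged (t i))); rewrite !mxE (bigD1 i) ?taggedK //=.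
  rewrite big1 ?addr0 // => j /andP[/eqP tj ji].
  by case/negP: ji; apply/eqP/tinj; rewrite tj ?taggedK.
have spanb k : lspan S (b (tagged p0) k).
  have : U (delta_mx 0 k) by apply/UM; rewrite submx_full.
  rewrite /U /mkset /sumb (bigD1 k) //= big1 ?addr0 => [|k' /negPf kk'].
    by rewrite mxE !eqxx scale1r.
  by rewrite mxE kk' andbF scale0r.
pose I : finType := {j : 'I_m | tag (t j) != p0}.
have [|||C hC bC] := @equivariant_span I (fun j => tag (tag (t (val j))))
  (fun j => b (tagged (tag (t (val j))))) _ _ (b (tagged p0)) (ci_repr hrho L0).
- by move=> j; apply: hb.
- exact: hb.
- move=> k; move: (spanb k); apply: lspan_lspan => _ [j [k' [jp ->]]].
  by apply: sub_lspan; exists (exist _ j jp : I), k'.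
apply: (lin_indep_notin_lspan (i0 := tagged p0) (bi (L := L0))).
rewrite (_ : b _ = \sum_(j : I) comb (C j) (b (tagged (tag (t (val j)))))); last first.
  by apply/funext => k; rewrite bC [X in _ = X k]fct_sumE.
rewrite -[\sum_j _](eq_bigr _ (fun j _ => scale1r _)).
apply: subspace_sum => [|j _]; first exact: lspan_subspace.
by apply: comb_other_block (hC j); rewrite taggedK; exact: valP j.
Qed.
End BlockIndependence.

(** * Independence of the coupled family and dimensions *)

Lemma lin_indep_comp (K : pzRingType) (V : lmodType K) (T U : Type) (f : T -> V) (t : U -> T) :
  lin_indep f -> injective t -> lin_indep (fun x => f (t x)).
Proof. by move=> fi ti n u ui a; apply: (fi n (fun j => t (u j))) => j j' /ti/ui. Qed.

Lemma lin_indep_card_le (K : fieldType) (V : lmodType K) (I J : finType) (b : I -> V) (u : J -> V) :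
  lin_indep b -> (forall i, lspan (range u) (b i)) -> (#|I| <= #|J|)%N.
Proof.
move=> bi /(_ _)/lspan_range_fin bu.
have /choice[a aP] := bu.
pose M : 'M[K]_(#|I|, #|J|) := \matrix_(x, y) a (enum_val x) (enum_val y).
rewrite leqNgt; apply/negP => lt.
have : kermx M != 0.
  by rewrite kermx_eq0 /row_free neq_ltn (leq_ltn_trans (rank_leq_col M) lt).
case/rowV0Pn => v /sub_kermxP vM /rV0Pn[x]; apply/negP; rewrite negbK; apply/eqP.
apply: (bi _ enum_val _ (fun x => v 0 x)); first exact: enum_val_inj.
under eq_bigr do rewrite aP scaler_sumr.
rewrite exchange_big big1 // => j _.
under eq_bigr do rewrite scalerA; rewrite -scaler_suml.
move/matrixP: vM => /(_ 0 (enum_rank j)); rewrite !mxE => e.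
rewrite [X in X *: _](_ : _ = 0) ?scale0r // -[RHS]e.
by apply: eq_bigr => y _; rewrite mxE enum_rankK.
Qed.

Lemma dimension_basis (K : fieldType) (V : lmodType K) (I : finType) (W : set V) (b : I -> V) :
  is_basis W b -> dimension W = #|I|.
Proof.
move=> [bi bW]; rewrite /dimension; apply: xget_unique.
  exists (fun x => b (enum_val x)); split.
    exact: lin_indep_comp bi enum_val_inj.
  rewrite -bW; congr (lspan _); apply/seteqP; split=> [_ [x _ <-]|_ [i _ <-]].
    by exists (enum_val x).
  by exists (enum_rank i) => //; rewrite enum_rankK.
move=> n [b' [bi' bW']]; apply/eqP; rewrite -[n in n == _]card_ord eqn_leq.
apply/andP; split.
  by apply: (lin_indep_card_le (u := b) bi') => i; rewrite bW -bW'; apply: sub_lspan; exists i.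
by apply: (lin_indep_card_le (u := b') bi) => i; rewrite bW' -bW; apply: sub_lspan; exists i.
Qed.

(** Grouping equal values of t gives an injective family. This form is needed because several
    coupled functions involve the same product of components. *)
Lemma lin_indep_fibers (K : nzRingType) (V : lmodType K) (T : choiceType) (f : T -> V)
    (I : finType) (t : I -> T) (a : I -> K) :
  lin_indep f -> \sum_i a i *: f (t i) = 0 -> forall y, \sum_(i | t i == y) a i = 0.
Proof.
move=> fi rel y.
have [[i0 /eqP ti0]|none] := pselect (exists i, t i == y); last first.
  by rewrite big_pred0 // => i; apply/negP => ti; apply: none; exists i.
pose J : finType := seq_sub (codom t).
have mem i : t i \in codom t by apply: codom_f.
pose g (j : J) := \sum_(i | t i == ssval j) a i.
rewrite -ti0 -[LHS]/(g (SeqSub (mem i0))).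
apply: (@lin_indep_fin _ _ _ f J (fun j : J => ssval j) g fi).
  exact: val_inj.
rewrite -[RHS]rel /g; under eq_bigr do rewrite scaler_suml.
rewrite (exchange_big_dep xpredT) //=; apply: eq_bigr => i _.
by rewrite (big_pred1 (SeqSub (mem i))).
Qed.

(** The indices of the coupled functions range over all of LL, which may be infinite; independence
    in a finitely spanned space bounds duplicate-free sequences, and a longest one must list
    everything. *)
Lemma finite_type_seq (T : eqType) p : (forall u : seq T, uniq u -> (size u <= p)%N) ->
  exists2 u : seq T, uniq u & forall x, x \in u.
Proof.
move=> bd.
pose P k := `[< exists2 u : seq T, uniq u & size u = k >].
have exP : exists k, P k by exists 0; apply/asboolP; exists [::].
have ubP k : P k -> (k <= p)%N by move=> /asboolP[u uu <-]; apply: bd.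
case: (ex_maxnP exP ubP) => k /asboolP[u uu uk] kmax.
exists u => // x; apply: contraT => xu.
have : (k.+1 <= k)%N by apply: kmax; apply/asboolP; exists (x :: u); rewrite /= ?xu ?uk.
by rewrite ltnn.
Qed.

Section CoupledIndependence.
Variables (R : realType) (s : scalar_kind).
Local Notation K := (scalars R s).
Variables (Om : Type) (A : comAlgType K) (LL : choiceType) (dl : LL -> nat).
Variable phi : forall l, 'I_(dl l) -> Om -> A.
Variables (H : set (Om -> A)) (dot : (Om -> A) -> (Om -> A) -> K).
Variable Hn : forall n, set (('I_n -> Om) -> A).
Variable dotn : forall n, (('I_n -> Om) -> A) -> (('I_n -> Om) -> A) -> K.
Hypothesis hphiH : forall l m, H (@phi l m).
Hypothesis hortho : orthonormal_functions phi dot.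
Hypothesis hdotn : induced_scalar_products H dot Hn dotn.
Variables (N : nat) (ls1 ls2 : seq LL).
Local Notation fn := (('I_N -> Om) -> A).
Hypothesis N0 : (0 < N)%N.
Hypothesis szN : (size ls1 + size ls2)%N = N.
Hypothesis dis : forall x, x \in ls1 -> x \notin ls2.

(** Grouping by the second index yields a relation between products to which [product_injective]
    applies; what remains, for each value of the second index, is a relation in e1. *)
Lemma product_lin_indep (T1 T2 : choiceType) (e1 : T1 -> fn) (e2 : T2 -> fn) :
  (forall x, lspan (monomials phi N ls1) (e1 x)) ->
  (forall x, lspan (monomials phi N ls2) (e2 x)) ->
  lin_indep e1 -> lin_indep e2 -> lin_indep (fun p : T1 * T2 => e1 p.1 * e2 p.2).
Proof.
move=> S1 S2 i1 i2 n t tinj a rel j0.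
pose J : finType := seq_sub (codom (fun j => (t j).2)).
have mem j : (t j).2 \in codom (fun j => (t j).2) by apply: (codom_f (fun j => (t j).2)).
pose f (b : 'I_#|J|) : fn := \sum_(j | (t j).2 == ssval (enum_val b)) a j *: e1 (t j).1.
have f0 : forall b, f b = 0.
  apply: (product_injective hphiH hortho hdotn N0 szN dis (h := fun b => e2 (ssval (enum_val b)))).
  - by move=> b; apply: subspace_sum => // ; exact: lspan_subspace.
  - by move=> b; apply: S2.
  - by apply: lin_indep_comp i2 _ => b b' /val_inj/enum_val_inj.
  rewrite -[RHS]rel.
  rewrite -(big_enum_val (A := predT)
    (fun b : J => (\sum_(j | (t j).2 == ssval b) a j *: e1 (t j).1) * e2 (ssval b))) /=.
  under eq_bigr do rewrite mulr_suml.
  rewrite (exchange_big_dep xpredT) //=; apply: eq_bigr => j _.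
  by rewrite (big_pred1 (SeqSub (mem j))) //= fct_scaleAl.
pose a' j := if (t j).2 == (t j0).2 then a j else 0.
have rel' : \sum_j a' j *: e1 (t j).1 = 0.
  rewrite -[RHS](f0 (enum_rank (SeqSub (mem j0)))) /f enum_rankK [RHS]big_mkcond.
  by apply: eq_bigr => j _; rewrite /a' /=; case: ifP => // _; rewrite scale0r.
have := lin_indep_fibers i1 rel' (t j0).1.
rewrite (bigD1 j0) //= /a' eqxx big1 ?addr0 // => j /andP[/eqP e1' jj0].
case: eqP => // e2'; case/eqP: jj0; apply: tinj.
by rewrite [LHS]surjective_pairing e1' e2' -surjective_pairing.
Qed.

Variables (L : LL) (n1 n2 : LL -> nat) (n12 : LL -> LL -> nat).
Variable b1 : forall L1, 'I_(n1 L1) -> 'I_(dl L1) -> fn.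
Variable b2 : forall L2, 'I_(n2 L2) -> 'I_(dl L2) -> fn.
Variable c : forall L1 L2, 'I_(n12 L1 L2) -> cidx dl L1 L2 L -> K^o.
Hypothesis S1 : forall L1 i k, lspan (monomials phi N ls1) (@b1 L1 i k).
Hypothesis S2 : forall L2 i k, lspan (monomials phi N ls2) (@b2 L2 i k).
Hypothesis b1_indep : lin_indep (block_family b1).
Hypothesis b2_indep : lin_indep (block_family b2).
Hypothesis c_indep : forall L1 L2, lin_indep (@c L1 L2).

(** The k-th component of a relation is a relation between products of components of b1 and b2.
    Collecting the coefficient of each product gives, for fixed L1, i1, L2, i2, a relation between
    the independent arrays c, entry by entry. *)
Theorem coupled_lin_indep : lin_indep (coupled b1 b2 c).
Proof.
move=> m t tinj a rel j0.
case tj0: (t j0) => [[L1 L2] [[i1 i2] i12]].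
pose w i := \sum_(j | t j == existT _ (L1, L2) (i1, i2, i) :> bidx n1 n2 n12) a j.
have -> : a j0 = w i12.
  rewrite /w (bigD1 j0) ?tj0 //= big1 ?addr0 // => j /andP[/eqP tj jj0].
  by case/eqP: jj0; apply: tinj; rewrite tj tj0.
apply: (@lin_indep_fin _ _ _ (@c L1 L2) _ id w (c_indep (L1 := L1) (L2 := L2))) => //.
apply/funext => -[[k1 k2] k]; rewrite [X in X _ = _]fct_sumE.
(* A term of the k-th component is a member of the relation together with (k1, k2). Members
   differing only in the last index j share the same products, so [ga] need not be injective. *)
pose X : finType := {j : 'I_m & ('I_(dl (tag (t j)).1) * 'I_(dl (tag (t j)).2))%type}.
pose mk L1 L2 (z : 'I_(n1 L1) * 'I_(n2 L2)) (x : 'I_(dl L1) * 'I_(dl L2)) :=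
  (Tagged (fun p => 'I_(dl (tag p))) (i := Tagged (fun L => 'I_(n1 L)) z.1) x.1,
   Tagged (fun p => 'I_(dl (tag p))) (i := Tagged (fun L => 'I_(n2 L)) z.2) x.2).
pose ga (x : X) := mk _ _ (tagged (t (tag x))).1 (tagged x).
pose al (x : X) := a (tag x) * c (tagged (t (tag x))).2 (tagged x, k).
have relX : \sum_x al x *: (block_family b1 (ga x).1 * block_family b2 (ga x).2) = 0.
  apply/funext => r; have := congr1 (fun F => F k r) rel.
  rewrite [X in X k r = _]fct_sumE [X in X r = _]fct_sumE => rel'.
  rewrite [X in X r = _]fct_sumE -[RHS]rel'.
  rewrite -(sig_big_dep xpredT (fun j => xpredT) (fun j (z : 'I_(dl (tag (t j)).1) * 'I_(dl (tag (t j)).2)) =>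
    al (Tagged _ z) *: (block_family b1 (ga (Tagged _ z)).1 * block_family b2 (ga (Tagged _ z)).2) r)).
  apply: eq_bigr => j _; rewrite !fctE /al /ga /=.
  case: (t j) => [[L1' L2'] [[i1' i2'] i']] /=.
  rewrite scaler_sumr; under [RHS]eq_bigr do rewrite scaler_sumr.
  rewrite [RHS]pair_bigA; apply: eq_bigr => -[k1' k2'] _ /=.
  by rewrite scalerA mulrfctE.
have := lin_indep_fibers (product_lin_indep (fun x => S1 _ _) (fun x => S2 _ _) b1_indep b2_indep) relX (mk _ _ (i1, i2) (k1, k2)).
rewrite -(sig_big_dep xpredT
  (fun j (z : 'I_(dl (tag (t j)).1) * 'I_(dl (tag (t j)).2)) =>
    mk _ _ (tagged (t j)).1 z == mk _ _ (i1, i2) (k1, k2))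
  (fun j z => a j * c (tagged (t j)).2 (z, k))) /= => E.
transitivity (\sum_i \sum_(j | t j == existT _ (L1, L2) (i1, i2, i) :> bidx n1 n2 n12)
   a j * c i (k1, k2, k)).
  by apply: eq_bigr => i _; rewrite -mulr_suml.
rewrite (exchange_big_dep xpredT) //= -[RHS]E; apply: eq_bigr => j _.
rewrite /ga /al /=; case: (t j) => [[L1' L2'] [[i1' i2'] i']] /=.
have [e|ne] := pselect ((L1', L2') = (L1, L2)); last first.
  rewrite [LHS]big_pred0 => [|i]; last by apply/negP => /eqP/(congr1 tag)/ne.
  rewrite [RHS]big_pred0 // => z; apply/negP => /eqP.
  by move=> /(congr1 (fun u => (tag (tag u.1), tag (tag u.2))))/ne.
case: e => e1 e2; subst L1' L2'.
under eq_bigl do rewrite -tag_eqE /tag_eq /= eqxx tagged_asE !xpair_eqE.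
under [RHS]eq_bigl do rewrite /mk xpair_eqE -!tag_eqE /tag_eq /= -!tag_eqE /tag_eq /= !eqxx !tagged_asE /=.
have [e1|n1'] := eqVneq i1' i1; last by rewrite !big_pred0_eq.
have [e2|n2'] := eqVneq i2' i2; last by rewrite !big_pred0 // => x /=; rewrite ?andbF.
subst i1' i2'; rewrite /= (big_pred1 i') //.
rewrite (big_pred1 (k1, k2)) // => -[k1' k2'] /=.
by rewrite !tagged_asE xpair_eqE.
Qed.
End CoupledIndependence.

(** The tags occurring in u exhaust the support of the sum, and sorting u by tag counts each fibre
    once. *)
Lemma card_sigma_type (P : choiceType) (T : P -> finType) (u : seq {p : P & T p}) :
  uniq u -> (forall x, x \in u) ->
  finite_set [set p | #|T p| != 0%N] /\ size u = \sum_(p \in [set: P]) #|T p|.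
Proof.
move=> uu uT.
pose v := undup (map tag u).
have vT p : #|T p| != 0%N -> p \in v.
  rewrite -lt0n => /card_gt0P[x _]; rewrite mem_undup.
  exact: (map_f tag (uT (Tagged T x))).
have fv : finite_set [set` v] by exact: finite_seq.
split; first by apply: sub_finite_set fv => p /vT.
have := finmap.seq_fsetE tt v; move: (finmap.seq_fset tt v) => F FE.
rewrite (fsbigTE F) => [|p]; last by rewrite FE; apply: contraNeq; apply: vT.
rewrite (perm_big v) /=; last by apply: uniq_perm; rewrite ?finmap.fset_uniq ?undup_uniq.
have card p : #|T p| = \sum_(x <- u | tag x == p) 1%N.
  rewrite sum1_count -size_filter cardE -(size_map (fun x => Tagged T x)).
  apply: perm_size; apply: uniq_perm.
  - by rewrite map_inj_uniq ?enum_uniq // => x y /eqP; rewrite eq_Tagged => /eqP.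
  - exact: filter_uniq.
  move=> [p' x]; rewrite mem_filter uT andbT /=; apply/mapP/eqP => [[y _ /(congr1 tag)]//|pp'].
  by case: _ / pp'; exists x; rewrite ?mem_enum.
under eq_bigr do rewrite card.
rewrite (exchange_big_dep xpredT) //= -sum1_size; apply: eq_big_seq => x xu.
rewrite -big_filter (_ : seq.filter _ v = [:: tag x]) ?big_seq1 //.
rewrite -(filter_pred1_uniq (undup_uniq _) (_ : tag x \in v)) ?mem_undup ?map_f //.
exact: eq_filter.
Qed.

(** Only a bound on dimensions is sought: the spanning tuples put one monomial in one component and
    need not be equivariant. *)
Lemma Vbar_equiv_finite_span (R : realType) (s : scalar_kind) (q : nat) (G : set 'M[R]_q)
    (Om : Type) (act : 'M[R]_q -> Om -> Om) (A : comAlgType (scalars R s))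
    (LL : choiceType) (dl : LL -> nat) (phi : forall l, 'I_(dl l) -> Om -> A)
    (rho : forall l, 'M[R]_q -> 'M[scalars R s]_(dl l)) N n (l : n.-tuple LL) L :
  transforms_by G act phi rho -> (forall l, continuous_repr G (rho l)) ->
  exists (J : finType) (v : J -> 'I_(dl L) -> ('I_N -> Om) -> A),
    Vbar_equiv G act phi rho N l L `<=` lspan (range v).
Proof.
move=> hphi hrho.
have [m [f [sigma [_ _ fm]]]] := monomials_family N hphi hrho l.
exists ('I_(dl L) * 'I_m)%type, (fun x k => if k == x.1 then f x.2 else 0).
move=> F /Vbar_equivP[F1 _]; apply/lspan_range_fin.
have /choice[a aP] : forall k, exists a : 'I_m -> scalars R s, F k = \sum_i a i *: f i.
  by move=> k; apply/lspan_range_fin; rewrite fm.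
exists (fun x => a x.1 x.2); apply/funext => k; rewrite aP.
rewrite -(pair_bigA _ (fun k' i => a k' i *: (fun k => if k == k' then f i else 0))) /=.
rewrite [X in _ = X k]fct_sumE (bigD1 k) //= [X in _ = _ + X]big1 ?addr0 => [|k' kk'].
  by rewrite [X in _ = X k]fct_sumE; apply: eq_bigr => i _; rewrite -[RHS]/(_ *: (if k == k then _ else _)) eqxx.
by rewrite [X in X k = _]fct_sumE big1 // => i _; rewrite -[LHS]/(_ *: (if k == k' then _ else _)) eq_sym (negPf kk') scaler0.
Qed.

Unset Implicit Arguments.

Theorem proposition2p16
    (R : realType) (s : scalar_kind)
    (q : nat) (G : set 'M[R]_q)
    (hG : compact_connected_linear_lie_group G)
    (D : nat) (X : 'I_D -> 'M[R]_q) (hX : lie_generators G X)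
    (Om : Type) (act : 'M[R]_q -> Om -> Om) (hact : group_action G act)
    (A : comAlgType (scalars R s))
    (LL : choiceType) (dl : LL -> nat)
    (phi : forall l, 'I_(dl l) -> Om -> A)
    (rho : forall l, 'M[R]_q -> 'M[scalars R s]_(dl l))
    (hrho : complete_irreducible_reprs G rho)
    (hphi : transforms_by G act phi rho)
    (H : set (Om -> A)) (dot : (Om -> A) -> (Om -> A) -> scalars R s)
    (hdot : scalar_product H dot)
    (hphiH : forall l m, H (phi l m))
    (hortho : orthonormal_functions phi dot)
    (Hn : forall n, set (('I_n -> Om) -> A))
    (dotn : forall n, (('I_n -> Om) -> A) -> (('I_n -> Om) -> A) -> scalars R s)
    (hdotn : induced_scalar_products H dot Hn dotn)
    (N N1 N2 : nat) (hN1 : (0 < N1)%N) (hN2 : (0 < N2)%N)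
    (hN : (N1 + N2)%N = N)
    (l : N.-tuple LL) (L : LL) (l1 : N1.-tuple LL) (l2 : N2.-tuple LL)
    (hl : l = l1 ++ l2 :> seq LL)
    (b1 : forall L1, 'I_(dimension (Vbar_equiv G act phi rho N l1 L1)) ->
            'I_(dl L1) -> ('I_N -> Om) -> A)
    (hb1 : forall L1, is_basis (Vbar_equiv G act phi rho N l1 L1) (b1 L1))
    (b2 : forall L2, 'I_(dimension (Vbar_equiv G act phi rho N l2 L2)) ->
            'I_(dl L2) -> ('I_N -> Om) -> A)
    (hb2 : forall L2, is_basis (Vbar_equiv G act phi rho N l2 L2) (b2 L2))
    (c : forall L1 L2, 'I_(dimension (V2_equiv G act phi rho L1 L2 L)) ->
           cidx dl L1 L2 L -> (scalars R s)^o)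
    (hc : forall L1 L2, is_basis (ker_Mcoupling rho X L1 L2 L) (c L1 L2)) :
  lspan (range (coupled b1 b2 c)) = Vbar_equiv G act phi rho N l L /\
  ((forall l0, absolutely_irreducible_repr G (rho l0)) ->
   (forall p q, tnth l1 p <> tnth l2 q) ->
   let d (p : LL * LL) : nat :=
     (dimension (V2_equiv G act phi rho p.1 p.2 L) *
      dimension (Vbar_equiv G act phi rho N l1 p.1) *
      dimension (Vbar_equiv G act phi rho N l2 p.2))%N in
   [/\ is_basis (Vbar_equiv G act phi rho N l L) (coupled b1 b2 c),
       finite_set [set p | d p != 0%N] &
       dimension (Vbar_equiv G act phi rho N l L) =
         \sum_(p \in [set: LL * LL]) d p]).
Proof.
have V1 L1 i : (forall k, lspan (monomials phi N l1) (b1 L1 i k)) /\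
    transforms G act (b1 L1 i) (rho L1).
  by apply/Vbar_equivP; rewrite -(hb1 L1).2; apply: sub_lspan; exists i.
have V2 L2 i : (forall k, lspan (monomials phi N l2) (b2 L2 i k)) /\
    transforms G act (b2 L2 i) (rho L2).
  by apply/Vbar_equivP; rewrite -(hb2 L2).2; apply: sub_lspan; exists i.
have span : lspan (range (coupled b1 b2 c)) = Vbar_equiv G act phi rho N l L.
  exact: (lspan_coupled hG hact hphi hrho hl hX (fun L1 => (hb1 L1).2) (fun L2 => (hb2 L2).2)
    (fun L1 L2 => (hc L1 L2).2)).
split=> // habs dis d.
have ind : lin_indep (coupled b1 b2 c).
  apply: (coupled_lin_indep hphiH hortho hdotn (N := N) (ls1 := l1) (ls2 := l2)).
  - by rewrite -hN addn_gt0 hN1.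
  - by rewrite !size_tuple.
  - move=> x /tnthP[i ->]; apply/negP => /tnthP[j]; exact: dis.
  - by move=> L1 i; apply: (V1 L1 i).1.
  - by move=> L2 i; apply: (V2 L2 i).1.
  - apply: (block_family_lin_indep hG hact hrho habs) => L1; last by have [] := hb1 L1.
    by move=> i; apply: (V1 L1 i).2.
  - apply: (block_family_lin_indep hG hact hrho habs) => L2; last by have [] := hb2 L2.
    by move=> i; apply: (V2 L2 i).2.
  - by move=> L1 L2; have [] := hc L1 L2.
have [J [v Jv]] := Vbar_equiv_finite_span N l L hphi (ci_repr hrho).
pose B p : finType := ('I_(dimension (Vbar_equiv G act phi rho N l1 p.1)) *
  'I_(dimension (Vbar_equiv G act phi rho N l2 p.2)) *
  'I_(dimension (V2_equiv G act phi rho p.1 p.2 L)))%type.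
pose T := {p : LL * LL & B p}.
(* A duplicate-free sequence of indices gives independent members of a space spanned by |J| tuples,
   so its length is at most |J|; hence u lists all indices. *)
have [|u uu uT] := @finite_type_seq T #|J|.
  move=> u uu; rewrite -[size u]card_ord.
  apply: (lin_indep_card_le (b := fun i => coupled b1 b2 c (tnth (in_tuple u) i)) (u := v)).
    by apply: (lin_indep_comp ind); apply/tuple_uniqP.
  by move=> i; apply: Jv; rewrite -span; apply: sub_lspan; eexists.
have [fin szu] := card_sigma_type uu uT.
have dE p : #|B p| = d p by rewrite !card_prod !card_ord mulnC mulnA.
split=> //.
  by move: fin; under eq_set do rewrite dE.
have bas : is_basis (Vbar_equiv G act phi rho N l L)
    (fun i : 'I_(size u) => coupled b1 b2 c (tnth (in_tuple u) i)).
  split.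
    by apply: (lin_indep_comp ind); apply/tuple_uniqP.
  rewrite -span; congr (lspan _); apply/seteqP; split=> [_ [i _ <-]|_ [x _ <-]].
    by eexists.
  by have /tnthP[i ->] := uT x : x \in in_tuple u; exists i.
rewrite (dimension_basis bas) card_ord szu; apply: eq_fsbigr => p _; exact: dE.
Qed.
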